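(* Consider the dead leaves model in dimension $d=1$, with $S$, $R$, $\lambda$ and $\eta$ as defined in the context. Assume that $\mathbb E[R]<\infty$ and $\mathbb E[\mathcal H_0(\partial S)]<\infty$. Then $\eta$ is a stationary point process on $\mathbb R$ with intensity $\lambda^{-1}\,\mathbb E[\mathcal H_0(\partial S)]$.
   Context: Notation: $\mathcal H_k$ is $k$-dimensional Hausdorff measure ($\mathcal H_0$ is counting measure, $\mathcal H_1$ on $\mathbb R$ is Lebesgue measure). For $A\subset\mathbb R$, $A^o$ is its interior and $\partial A=\overline A\setminus A^o$ its topological boundary; $A+x:=\{a+x:a\in A\}$. Dead leaves model in $d=1$: Let $\mathcal C$ be the space of compact subsets of $\mathbb R$, with the $\sigma$-algebra generated by the Fell topology (generated by all sets $\{F\in\mathcal C:F\cap G\ne\emptyset\}$ with $G$ open and $\{F\in\mathcal C:F\cap K=\emptyset\}$ with $K$ compact). Let $\mathbb Q$ be a probability measure on $\mathcal C$ (the grain distribution) assigning strictly positive measure to the collection of sets having non-empty interior. $S$ denotes a random element of $\mathcal C$ with distribution $\mathbb Q$; $\lambda:=\mathbb E[\mathcal H_1(S)]$; $R:=\sup\{|x|:x\in S\}$, with $R=0$ if $S=\emptyset$. Let $\sum_{i=1}^\infty\delta_{(x_i,t_i)}$ be a homogeneous Poisson process of unit intensity in $\mathbb R\times\mathbb R$ and, independently of it, let $(S_i)_{i\ge1}$ be independent random elements of $\mathcal C$ with distribution $\mathbb Q$. (Leaf $i$ is $S_i+x_i$, arriving at time $t_i$.) The boundary of the time-reversed DLM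 tessellation is $$\Phi:=\bigcup_{i:t_i\ge0}\Big[(\partial S_i+x_i)\setminus\bigcup_{j:0\le t_j<t_i}(S_j^o+x_j)\Big],$$ and $\eta:=\mathcal H_0(\Phi\cap\cdot)$. A point process is stationary if its distribution is shift invariant; its intensity is then the constant $\gamma$ with $\mathbb E[\eta(B)]=\gamma\,\mathcal H_1(B)$ for Borel $B$. *)

(* Defs.v *)
From HB Require Import structures.
From mathcomp Require Import all_boot all_order all_algebra.
From mathcomp Require Import all_classical all_reals all_analysis.
From mathcomp Require Import measurable_realfun.

Set Implicit Arguments.
Unset Strict Implicit.
Unset Printing Implicit Defensive.
Import Order.TTheory GRing.Theory Num.Theory.
Import numFieldNormedType.Exports.
Local Open Scope classical_set_scope.
Local Open Scope ring_scope.

Definition translate {R : realType} (x : R) (A : set R) : set R :=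
  [set a + x | a in A].

Definition boundary {T : topologicalType} (A : set T) : set T :=
  closure A `\` A°.

Record compact_set (R : realType) := CompactSet {
  compact_set_val :> set R ;
  compact_set_compact : compact compact_set_val }.

(* compact_set R carries the Fell topology and its Borel sigma-algebra. *)
Section fell.
Context {R : realType}.
Local Notation T := (compact_set R).

HB.instance Definition _ := gen_eqMixin T.
HB.instance Definition _ := gen_choiceMixin T.
HB.instance Definition _ := isPointed.Build T (CompactSet (@compact0 R)).

Definition fell_subbase : set_system T :=
  [set [set F : T | F `&` G !=set0] | G in (open : set_system R)] `|`
  [set [set F : T | F `&` K = set0] | K in (compact : set_system R)].

HB.instance Definition _ := isSubBaseTopological.Build T fell_subbase id.

Definition fell_borel : set_system T := <<s (open : set_system T) >>.

Let fell_borel0 : fell_borel set0.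
Proof. exact: sigma_algebra0. Qed.

Let fell_borelC (A : set T) : fell_borel A -> fell_borel (~` A).
Proof. exact: sigma_algebraC. Qed.

Let fell_borelU (F : (set T)^nat) :
  (forall i, fell_borel (F i)) -> fell_borel (\bigcup_i F i).
Proof. exact: sigma_algebra_bigcup. Qed.

Definition fell_display : measure_display.
Proof. by constructor. Qed.

HB.instance Definition _ := @isMeasurable.Build fell_display T fell_borel
  fell_borel0 fell_borelC fell_borelU.

End fell.

(* Locally finite, integer-valued measures: the values of a point process. *)
Record point_config (R : realType) := PointConfig {
  point_config_measure :> {measure set (measurableTypeR R) -> \bar R} ;
  point_config_nat : forall B : set (measurableTypeR R), measurable B ->
    bounded_set (B : set R) ->
    exists n : nat, point_config_measure B = n%:R%:E }.

(* point_config R carries the sigma-algebra generated by the evaluations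
   mu |-> mu B at Borel sets B. *)
Section point_config_measurable.
Context {R : realType}.
Local Notation T := (point_config R).

Let mzero_nat (B : set (measurableTypeR R)) : measurable B ->
  bounded_set (B : set R) -> exists n : nat, @mzero _ _ R B = n%:R%:E.
Proof. by move=> _ _; exists 0%N. Qed.

HB.instance Definition _ := gen_eqMixin T.
HB.instance Definition _ := gen_choiceMixin T.
HB.instance Definition _ := isPointed.Build T (PointConfig mzero_nat).

Definition point_config_sigma : set_system T :=
  <<s \bigcup_(B in (measurable : set_system (measurableTypeR R)))
        preimage_set_system [set: T] (fun mu : T => mu B) measurable >>.

Let point_config_sigma0 : point_config_sigma set0.
Proof. exact: sigma_algebra0. Qed.

Let point_config_sigmaC (A : set T) :
  point_config_sigma A -> point_config_sigma (~` A).
Proof. exact: sigma_algebraC. Qed.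

Let point_config_sigmaU (F : (set T)^nat) :
  (forall i, point_config_sigma (F i)) -> point_config_sigma (\bigcup_i F i).
Proof. exact: sigma_algebra_bigcup. Qed.

Definition point_config_display : measure_display.
Proof. by constructor. Qed.

HB.instance Definition _ := @isMeasurable.Build point_config_display T
  point_config_sigma point_config_sigma0 point_config_sigmaC
  point_config_sigmaU.

End point_config_measurable.

(* The shift B |-> mu (B - y) of a point configuration mu. *)
Section shift.
Context {R : realType} (y : R) (mu : point_config R).
Local Notation mR := (measurableTypeR R).

Let addy : mR -> mR := fun u : R => u + y.

Let measurable_addy : measurable_fun [set: mR] addy.
Proof.
have h : @measurable_fun _ _ R R setT (id \+ cst y).
  by apply: measurable_funD.
by move=> _ B mB; exact: (h measurableT B mB).
Qed.

Definition shift_measure : set mR -> \bar R := pushforward mu addy.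

Let shift0 : shift_measure set0 = 0%E.
Proof. by rewrite /shift_measure /pushforward preimage_set0 measure0. Qed.

Let shift_ge0 A : (0 <= shift_measure A)%E.
Proof. exact: measure_ge0. Qed.

Let shift_sigma_additive : semi_sigma_additive shift_measure.
Proof.
pose h := isMeasurableFun.Build _ _ _ _ addy measurable_addy.
pose f : {mfun mR >-> mR} := HB.pack addy h.
exact: (@measure_semi_sigma_additive _ _ _ (pushforward mu f)).
Qed.

HB.instance Definition _ := isMeasure.Build _ _ _ shift_measure
  shift0 shift_ge0 shift_sigma_additive.

Let shift_nat (B : set mR) : measurable B -> bounded_set (B : set R) ->
  exists n : nat, shift_measure B = n%:R%:E.
Proof.
move=> mB bB; rewrite /shift_measure /pushforward.
apply: point_config_nat.
  by rewrite -[X in measurable X]setTI; exact: measurable_addy.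
have [M M0 BM] := @ex_strict_bound_gt0 R R R idfun (globally B) _ bB.
exists (M + `|y|); split; first exact: num_real.
move=> r Mr x /BM /= xM; rewrite (le_trans _ (ltW Mr))//.
have -> : x = x + y - y by rewrite addrK.
by rewrite (le_trans (ler_normB _ _))// lerD2r ltW.
Qed.

Definition shift : point_config R := PointConfig shift_nat.

End shift.

Section independence.
Context d (Omega : measurableType d) (R : realType).
Variable P : probability Omega R.
Local Open Scope ereal_scope.

Definition mutually_independent (I : eqType) d' (T : measurableType d')
    (X : I -> Omega -> T) : Prop :=
  forall (s : seq I) (A : I -> set T), uniq s ->
    (forall i, measurable (A i)) ->
    P (\bigcap_(i in [set` s]) (X i @^-1` A i)) =
    \prod_(i <- s) P (X i @^-1` A i).

Definition sigma_generated (I : Type) d' (T : measurableType d')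
    (X : I -> Omega -> T) : set_system Omega :=
  <<s \bigcup_i preimage_set_system [set: Omega] (X i) measurable >>.

Definition independent_families (I J : Type) d1 (T1 : measurableType d1)
    d2 (T2 : measurableType d2) (X : I -> Omega -> T1) (Y : J -> Omega -> T2) :
    Prop :=
  forall E F, sigma_generated X E -> sigma_generated Y F ->
    P (E `&` F) = P E * P F.

End independence.

Section poisson_process.
Context d (Omega : measurableType d) (R : realType).
Variable P : probability Omega R.
Local Notation plane := (measurableTypeR R * measurableTypeR R)%type.
Local Open Scope ereal_scope.

Definition point_count (z : nat -> Omega -> plane) (A : set plane)
    (w : Omega) : \bar R :=
  \sum_(0 <= i <oo) \d_(z i w) A.

Definition area : set plane -> \bar R := lebesgue_measure \x lebesgue_measure.

Record unit_poisson_process (z : nat -> Omega -> plane) : Prop := {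
  upp_measurable : forall i, measurable_fun setT (z i) ;
  upp_finite : forall A, measurable A -> area A < +oo -> forall k : nat,
    P [set w | point_count z A w = k%:R%:E] =
    (fine (area A) ^+ k / k`!%:R * expR (- fine (area A)))%:E ;
  upp_infinite : forall A, measurable A -> area A = +oo ->
    P [set w | point_count z A w = +oo] = 1 ;
  upp_independent : forall n (A : 'I_n -> set plane),
    (forall k, measurable (A k)) -> trivIset setT A ->
    mutually_independent P (fun k => point_count z (A k)) }.

End poisson_process.

Section dead_leaves.
Context {R : realType}.
Local Notation mR := (measurableTypeR R).

(* Leaf i is the compact set S i translated by x = (z i).1; it arrives at time
   t = (z i).2. *)
Definition dlm_boundary (z : nat -> mR * mR) (S : nat -> compact_set R) :
    set R :=
  \bigcup_(i in [set i | 0 <= ((z i).2 : R)])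
    (translate (z i).1 (boundary (S i)) `\`
     \bigcup_(j in [set j | 0 <= ((z j).2 : R) < (z i).2])
       translate (z j).1 (S j)°).

Definition dlm_eta (z : nat -> mR * mR) (S : nat -> compact_set R)
    (B : set R) : \bar R :=
  counting (dlm_boundary z S `&` B).

(* sup set0 = 0, so the radius of the empty set is 0. *)
Definition radius (K : compact_set R) : R := sup [set `|x| | x in K].

Definition mean_radius (Q : probability (compact_set R) R) : \bar R :=
  (\int[Q]_K (radius K)%:E)%E.

Definition mean_length (Q : probability (compact_set R) R) : \bar R :=
  (\int[Q]_K lebesgue_measure (K : set mR))%E.

Definition mean_boundary_count (Q : probability (compact_set R) R) : \bar R :=
  (\int[Q]_K counting (boundary (K : set R)))%E.

End dead_leaves.

Section point_process.
Context d (Omega : measurableType d) (R : realType).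
Variable P : probability Omega R.
Local Notation mR := (measurableTypeR R).
Local Open Scope ereal_scope.

(* eta is a point process if it is almost surely equal, as a measure on the
   Borel sets, to a random element N of the space of point configurations; the
   law of eta is that of N. On a null event the counting measure of an
   arbitrary random set may fail to be locally finite or measurable. *)
Definition point_process_version (eta : Omega -> set R -> \bar R)
    (N : Omega -> point_config R) : Prop :=
  measurable_fun setT N /\
  {ae P, forall w, forall B : set mR, measurable B -> N w B = eta w B}.

Definition shift_invariant (N : Omega -> point_config R) : Prop :=
  forall (y : R) (M : set (point_config R)), measurable M ->
    pushforward P (fun w => shift y (N w)) M = pushforward P N M.

Definition has_intensity (N : Omega -> point_config R) (gamma : \bar R) :
    Prop :=
  forall B : set mR, measurable B ->
    \int[P]_w N w B = gamma * lebesgue_measure B.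

Definition stationary_point_process (eta : Omega -> set R -> \bar R)
    (gamma : \bar R) : Prop :=
  exists N, [/\ point_process_version eta N, shift_invariant N
              & has_intensity N gamma].

End point_process.

(* Main.v *)
Require Import Defs.
From HB Require Import structures.
From mathcomp Require Import all_boot all_order all_algebra.
From mathcomp Require Import finmap.
From mathcomp Require Import all_classical all_reals all_analysis.
From mathcomp Require Import measurable_realfun.
From mathcomp Require Import ring lra.

(** A leaf is a pair of a point of the plane, its place and its arrival time, and
    of a compact set, its grain. The leaves form a Poisson process on the product
    of the plane and the space of compact sets, whose intensity [leaf_intensity]
    is the product of the area and of the law $Q$ of the grain. An edge of a leaf,
    that is a boundary point of the translated grain, belongs to the boundary of
    the tessellation if the leaf arrives at a time $t\ge 0$ and no leaf that
    arrives in $[0,t)$ covers the edge with its interior.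

    Intensity. The leaves that cover a given point before time $t$ are the
    leaves of a set of intensity $\lambda t$: for a fixed grain, the places from
    which its interior covers the point form a reflected translate of this
    interior, and the finite boundary of the grain has length zero
    ([covers_intensity]). Hence an edge that arrives at time $t$ is visible with
    probability $e^{-\lambda t}$, and by the Mecke equation the expected number of
    visible edges in $B$ is
    $E[H_0(\partial S)]\,H_1(B)\int_0^\infty e^{-\lambda t}\,dt$
    ([edge_intensity], [edge_measure_mean]).

    The hypotheses give the process only through the counts of the points of the
    plane and through independence, so the two properties of the leaves that
    this computation uses are derived from the counts. First, the probability
    that no leaf lies in $D$ is $e^{-\mu(D)}$ ([avoid_prob]): given the points,
    it is a product over the points, and the Laplace functional of the Poisson
    process evaluates its mean ([poisson_laplace]), first for step functions,
    where only finitely many independent counts occur. Second, the Mecke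
    equation is needed only for the event that no leaf lies in the section at
    $x$ of a countable union of rectangles $A_q\times D_q$ with
    $A_q\cap D_q=\emptyset$ ([palm_sections]); for one rectangle it says that the
    expected number of points in $A$ factors from the event that $D$ is void
    ([palm]), which follows from void probabilities and the mean number of
    leaves ([campbell]) alone. The relation of covering is such a countable
    union, because a rational interval and a rational time can be put between
    the two leaves ([coversE]).

    The point process. The boundary of a random compact set is enumerated
    measurably by suprema over rational intervals ([boundary_ptsE],
    [counting_boundary]); this gives a measure [edge_measure] that depends
    measurably on the leaves and counts visible edges. Almost surely no two
    leaves share an edge point ([edge_pt_neq]), because two points of the Poisson
    process almost surely do not differ by a prescribed amount
    ([poisson_diff_null]); then [edge_measure] is the counting measure of the
    boundary of the tessellation ([edge_measure_dlm]).

    Stationarity. The numbering of the points is arbitrary, so only the law of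
    the set of leaves can be translation invariant; void probabilities determine
    this law and are invariant ([leaves_law]). The number of visible edges in $B$
    is a measurable functional of this set: on a partition into thin strips a
    bounded region has eventually at most one leaf in each cell, and then
    visibility is expressed by which sets are void ([conf_count_range]). The
    functional commutes with translations, so the law of the point process is
    invariant ([edge_config_stationary]). *)

Set Implicit Arguments.
Unset Strict Implicit.
Unset Printing Implicit Defensive.
Import Order.TTheory GRing.Theory Num.Theory.
Import numFieldNormedType.Exports.
Local Open Scope classical_set_scope.
Local Open Scope ring_scope.

(** * Rational intervals and compact sets of the line *)

Section rational_intervals.
Context {R : realType}.

(** A countable base of open intervals, indexed by the natural numbers so that
    the countable unions and intersections below are indexed by them; a number
    that codes no pair of rationals stands for the empty interval. *)
Definition rat_itv (n : nat) : set R :=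
  if choice.unpickle n is Some (a, b) then `](ratr a), (ratr b)[%classic else set0.

Lemma rat_itv_open n : open (rat_itv n).
Proof.
by rewrite /rat_itv; case: choice.unpickle => [[a b]|]; [exact: interval_open|exact: open0].
Qed.

Lemma rat_itv_measurable n : measurable (rat_itv n : set (measurableTypeR R)).
Proof.
by rewrite /rat_itv; case: choice.unpickle => [[a b]|//]; exact: measurable_itv.
Qed.

Lemma rat_itv_interval n : is_interval (rat_itv n).
Proof.
rewrite /rat_itv; case: choice.unpickle => [[a b]|]; first exact: interval_is_interval.
by move=> x y.
Qed.

Lemma rat_itv_between (a y b : R) : a < y < b ->
  exists n, rat_itv n y /\ rat_itv n `<=` `]a, b[.
Proof.
move=> /andP[/rat_in_itvoo[p +] /rat_in_itvoo[q +]].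
rewrite !in_itv/= => /andP[ap py] /andP[yq qb].
exists (choice.pickle (p, q)); rewrite /rat_itv choice.pickleK; split => [|x] /=.
  by rewrite in_itv/= py.
rewrite !in_itv/= => /andP[px xq].
by rewrite (lt_trans ap px) (lt_trans xq qb).
Qed.

Lemma rat_itv_nbhs (y : R) (U : set R) : nbhs y U ->
  exists n, rat_itv n y /\ rat_itv n `<=` U.
Proof.
move=> /nbhs_ballP[e /= e0 yeU].
have [|n [ny nI]] := @rat_itv_between (y - e) y (y + e).
  by rewrite ltrBlDr !ltrDl e0.
exists n; split => // x /nI /=; rewrite in_itv/= => xI.
by apply: yeU; rewrite /ball/= ltr_distlC.
Qed.

End rational_intervals.

Section compact_sets.
Context {R : realType}.
Implicit Types (K : compact_set R) (I : set R).

Lemma compact_set_closed K : closed (K : set R).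
Proof.
by apply: compact_closed; [exact: Rhausdorff|case: K].
Qed.

Lemma compact_boundaryE K : boundary K = K `\` K°.
Proof.
by rewrite /boundary -(closure_id _).1//; exact: compact_set_closed.
Qed.

Lemma interior_rat_itvP K y :
  K° y <-> exists n, rat_itv n y /\ rat_itv n `<=` K.
Proof.
split=> [|[n [ny nK]]]; first exact: rat_itv_nbhs.
apply: (@filterS _ (nbhs y) _ (rat_itv n)) => //.
by apply: open_nbhs_nbhs; split => //; exact: rat_itv_open.
Qed.

(** The interval $I$ is connected, so when no boundary point of $K$ lies in it
    the trace of $K$ on $I$ is both open and closed in $I$. *)
Lemma boundary_hitsP K I : open I -> is_interval I ->
  boundary K `&` I !=set0 <-> K `&` I !=set0 /\ ~ I `<=` K.
Proof.
move=> oI /connected_intervalP cI; split.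
  rewrite compact_boundaryE => -[y [[Ky nKy] Iy]]; split; first by exists y.
  move=> IK; apply: nKy; apply: (@filterS _ (nbhs y) _ I) => //.
  exact: open_nbhs_nbhs.
move=> [KI nIK]; apply: contrapT => nb; apply: nIK.
suff <- : I `&` K = I by [].
apply: cI; first by rewrite setIC.
- exists K°; first exact: open_interior.
  apply/seteqP; split=> y [Iy Ky]; split => //; last exact: interior_subset.
  apply: contrapT => nKy; apply: nb; exists y; split => //.
  by rewrite compact_boundaryE.
- by exists K => //; exact: compact_set_closed.
Qed.

(** As $K$ is closed, inclusion of an open set is a countable conjunction of
    hitting conditions, which the Fell topology makes measurable. *)
Lemma sub_compactP K I : open I ->
  I `<=` K <-> forall n, rat_itv n `&` I !=set0 -> K `&` (rat_itv n `&` I) !=set0.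
Proof.
move=> oI; split=> [IK n [y [ny Iy]]|h y Iy].
  by exists y; split => //; exact: IK.
apply: contrapT => nKy.
have [n [ny nU]] : exists n, rat_itv n y /\ rat_itv n `<=` I `&` ~` K.
  apply: rat_itv_nbhs; apply: filterI; first exact: open_nbhs_nbhs.
  by apply: open_nbhs_nbhs; split => //; exact/closed_openC/compact_set_closed.
have [|x [Kx [nx _]]] := h n; first by exists y.
by have [] := nU _ nx.
Qed.

End compact_sets.

(** * Measurability for the Fell topology *)

Section fell_measurability.
Context {R : realType}.
Local Notation mR := (measurableTypeR R).
Local Notation C := (compact_set R).
Implicit Types (K : C) (I G : set R).

Lemma measurable_hits G : open G -> measurable [set K : C | K `&` G !=set0].
Proof.
move=> oG; apply: sub_sigma_algebra.
exists [set [set K : C | K `&` G !=set0]]; last by rewrite bigcup_set1.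
move=> _ ->; exists [fset [set K : C | (K : set R) `&` G !=set0]]%fset.
  by move=> A /fset1P ->; rewrite inE; left; exists G.
rewrite (_ : [set` _] = [set [set K : C | (K : set R) `&` G !=set0]]) ?bigcap_set1//.
by apply/seteqP; split=> A /fset1P.
Qed.

Lemma measurable_supset I : open I -> measurable [set K : C | I `<=` K].
Proof.
move=> oI.
rewrite (_ : [set _ | _] = \bigcap_n
    [set K : C | rat_itv n `&` I !=set0 -> (K : set R) `&` (rat_itv n `&` I) !=set0]).
  apply: bigcapT_measurable => n.
  have [h|h] := pselect (rat_itv n `&` I !=set0); last first.
    rewrite (_ : [set _ | _] = setT); first exact: measurableT.
    by apply/seteqP; split => // K _ /h.
  rewrite (_ : [set _ | _] = [set K : C | (K : set R) `&` (rat_itv n `&` I) !=set0]).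
    by apply: measurable_hits; apply: openI => //; exact: rat_itv_open.
  by apply/seteqP; split => K //=; exact.
apply/seteqP; split => K /= h; first by move=> n _; exact/(sub_compactP K oI).1.
by apply/(sub_compactP K oI) => n; exact: h.
Qed.

Lemma measurable_boundary_hits I : open I -> is_interval I ->
  measurable [set K : C | boundary K `&` I !=set0].
Proof.
move=> oI iI.
rewrite (_ : [set _ | _] = [set K : C | (K : set R) `&` I !=set0] `\` [set K : C | I `<=` K]).
  by apply: measurableD; [exact: measurable_hits|exact: measurable_supset].
by apply/seteqP; split => K /=; [move/(boundary_hitsP _ oI iI)|move=> ?; apply/boundary_hitsP].
Qed.

Lemma measurable_mem : measurable [set p : mR * C | (p.2 : set R) p.1].
Proof.
rewrite -[X in measurable X]setCK; apply: measurableC.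
rewrite (_ : ~` _ = \bigcup_n (rat_itv n `*` ~` [set K : C | (K : set R) `&` rat_itv n !=set0])).
  apply: bigcupT_measurable => n; apply: measurableX.
    exact: rat_itv_measurable.
  by apply: measurableC; apply: measurable_hits; exact: rat_itv_open.
apply/seteqP; split => [[y K] /= nKy|[y K] [n _ [/= ny nK]] Ky]; last first.
  by apply: nK; exists y.
have [n [ny nU]] : exists n, rat_itv n y /\ rat_itv n `<=` ~` (K : set R).
  apply: rat_itv_nbhs; apply: open_nbhs_nbhs; split => //.
  exact/closed_openC/compact_set_closed.
by exists n => //; split => //= -[x [Kx /nU]].
Qed.

Lemma measurable_mem_interior : measurable [set p : mR * C | (p.2 : set R)° p.1].
Proof.
rewrite (_ : [set _ | _] = \bigcup_n (rat_itv n `*` [set K : C | rat_itv n `<=` K])).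
  apply: bigcupT_measurable => n; apply: measurableX.
    exact: rat_itv_measurable.
  by apply: measurable_supset; exact: rat_itv_open.
apply/seteqP; split => [[y K] /interior_rat_itvP[n [ny nK]]|[y K] [n _ [ny nK]]].
  by exists n.
by apply/interior_rat_itvP; exists n.
Qed.

End fell_measurability.

(** * A measurable enumeration of the boundary points *)

Section boundary_enumeration.
Context {R : realType}.
Local Notation mR := (measurableTypeR R).
Local Notation C := (compact_set R).
Implicit Types (K : C).

Lemma counting_esum (T : choiceType) (A : set T) :
  counting A = (\esum_(i in A) (1 : \bar R))%E.
Proof.
rewrite /counting; case: asboolP => [fA|iA].
  rewrite esum_fset// fsbig_finite//= card_fset_sum1 natr_sum -sumEFin.
  exact: eq_bigr.
apply/esym/eqyP => r r0; apply: esum_ge.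
have [B BA nB] := infinite_set_fset (Num.truncn r).+1 iA.
exists [set` B]; first by split => //; exact: finite_fset.
rewrite fsbig_finite//= set_fsetK sumEFin lee_fin.
rewrite (_ : \sum_(i <- _) 1 = (\sum_(i <- B) 1)%N%:R :> R).
  rewrite -card_fset_sum1 (le_trans (ltW (truncnS_gt r)))// ler_nat.
  exact: nB.
by rewrite natr_sum.
Qed.

Definition boundary_hit (n : nat) : set C :=
  [set K | boundary K `&` rat_itv n !=set0].

(** The supremum is a measurable function of the compact set. If the boundary is
    finite it is attained, and each boundary point is the supremum over a rational
    interval that isolates it. *)
Definition boundary_pt (n : nat) (K : C) : mR := sup (boundary K `&` rat_itv n).

(** Each value is kept at its first index only, which makes the enumeration
    injective. *)
Definition boundary_new (n : nat) : set C :=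
  [set K | boundary_hit n K /\ forall k, (k < n)%N ->
     boundary_hit k K -> boundary_pt k K <> boundary_pt n K].

Lemma boundary_hit_has_sup n K :
  boundary_hit n K -> has_sup (boundary K `&` rat_itv n).
Proof.
move=> h; split => //; move: h => -[y [_]]; rewrite /rat_itv.
case: choice.unpickle => [[a b] _|//]; exists (ratr b) => x [_] /=.
by rewrite in_itv/= => /andP[_ /ltW].
Qed.

Lemma measurable_boundary_hit n : measurable (boundary_hit n).
Proof.
apply: measurable_boundary_hits; first exact: rat_itv_open.
exact: rat_itv_interval.
Qed.

Lemma measurable_boundary_pt n : measurable_fun setT (boundary_pt n).
Proof.
apply: (@measurability _ _ C mR setT (boundary_pt n) (@RGenOInfty.G R)); first exact: RGenOInfty.measurableE.
move=> _ [_ [r ->] <-]; rewrite setTI.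
rewrite (_ : _ @^-1` _ =
    [set K : C | boundary K `&` (rat_itv n `&` `]r, +oo[) !=set0] `|`
    (~` boundary_hit n `&` (if r < 0 then setT else set0))).
  apply: measurableU.
    apply: measurable_boundary_hits.
      by apply: openI; [exact: rat_itv_open|exact: interval_open].
    move=> x y [xn xr] [yn yr] z xyz; split; first exact: rat_itv_interval xyz.
    by apply: (@interval_is_interval _ `]r, +oo[) xyz.
  apply: measurableI; first by apply: measurableC; exact: measurable_boundary_hit.
  by case: ifP.
apply/seteqP; split => K /=; rewrite in_itv/= andbT.
  have [h rK|h] := pselect (boundary_hit n K); last first.
    rewrite /boundary_pt (_ : _ `&` _ = set0) ?sup0.
      by move=> ->; right; split.
    by rewrite -subset0 => y Iy; apply: h; exists y.
  left; have hs := boundary_hit_has_sup h.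
  have [|y [By ny] ry] := @sup_adherent _ _ (boundary_pt n K - r) _ hs.
    by rewrite subr_gt0.
  exists y; split => //; split => //=; rewrite in_itv/= andbT.
  by move: ry; rewrite opprB addrC subrK.
move=> [[y [By [ny]]] /=|].
  rewrite in_itv/= andbT => /lt_le_trans; apply.
  apply: ub_le_sup => //.
  by have [] : has_sup (boundary K `&` rat_itv n) by
    apply: boundary_hit_has_sup; exists y.
case: ifPn => r0 [h] //; rewrite /boundary_pt (_ : _ `&` _ = set0) ?sup0//.
by rewrite -subset0 => y Iy; apply: h; exists y.
Qed.

Lemma measurable_boundary_new n : measurable (boundary_new n).
Proof.
rewrite (_ : boundary_new n = boundary_hit n `&`
    \bigcap_k [set K | (k < n)%N -> boundary_hit k K -> boundary_pt k K <> boundary_pt n K]).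
  apply: measurableI; first exact: measurable_boundary_hit.
  apply: bigcapT_measurable => k.
  have [kn|kn] := boolP (k < n)%N; last first.
    rewrite (_ : [set _ | _] = setT); first exact: measurableT.
    by apply/seteqP; split.
  rewrite (_ : [set _ | _] = ~` (boundary_hit k `&`
      (fun K => boundary_pt k K == boundary_pt n K) @^-1` [set true])).
    apply/measurableC/measurableI; first exact: measurable_boundary_hit.
    rewrite -[X in measurable X]setTI.
    apply: (measurable_fun_eqr (f := boundary_pt k : C -> R)) => //;
    exact: measurable_boundary_pt.
  apply/seteqP; split => K /= h; first by move=> [hk /eqP]; exact: h.
  by move=> _ hk e; apply: h; split => //; exact/eqP.
by apply/seteqP; split => K /= [h nh]; split => // k; [move=> _ kn|move=> kn]; exact: nh.
Qed.

Let values K := [set boundary_pt n K | n in [set n | boundary_hit n K]].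

Let values_new K :
  values K = [set boundary_pt n K | n in [set n | boundary_new n K]].
Proof.
apply/seteqP; split => _ [n /= hn <-]; last by exists n => //; case: hn.
have ex : exists k, `[< boundary_hit k K /\ boundary_pt k K = boundary_pt n K >].
  by exists n; exact/asboolP.
case: (ex_minnP ex) => k /asboolP[hk ek] kmin.
exists k => //; split => // j jk hj ej.
suff : (k <= j)%N by rewrite leqNgt jk.
by apply: kmin; apply/asboolP; split => //; rewrite ej.
Qed.

Let boundary_sub_closure K : boundary K `<=` closure (values K).
Proof.
move=> y By U /nbhs_ballP[e /= e0 yeU].
have [|n [ny nI]] := @rat_itv_between _ (y - e / 2) y (y + e / 2).
  by rewrite ltrBlDr !ltrDl divr_gt0.
have hn : boundary_hit n K by exists y.
have hs := boundary_hit_has_sup hn.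
exists (boundary_pt n K); split; first by exists n.
apply: yeU; rewrite /ball/= ltr_distlC.
have yp : y <= boundary_pt n K by apply: ub_le_sup; [case: hs|split].
rewrite (lt_le_trans _ yp)/= ?ltrBlDr ?ltrDl//.
apply: (@le_lt_trans _ _ (y + e / 2)); last first.
  by rewrite ltrD2l ltr_pdivrMr// ltr_pMr// ltr1n.
apply: sup_le_ub; first by case: hs.
by move=> x [_ /nI]/=; rewrite in_itv/= => /andP[_ /ltW].
Qed.

Lemma boundary_pt_mem n K : finite_set (boundary K) -> boundary_hit n K ->
  (boundary K `&` rat_itv n) (boundary_pt n K).
Proof.
move=> fK hn; have [h0 hub] := boundary_hit_has_sup hn.
rewrite (closure_id (boundary K `&` rat_itv n)).1.
  exact: closure_sup.
apply: (accessible_finite_set_closed.1 _ _ (finite_setIl _ fK)).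
exact/hausdorff_accessible/Rhausdorff.
Qed.

Let finite_values K : finite_set (boundary K) <-> finite_set (values K).
Proof.
split=> [fK|fV].
  by apply: (sub_finite_set _ fK) => _ [n /(boundary_pt_mem fK)[]] + _ <-.
apply: (sub_finite_set _ fV) => y /boundary_sub_closure.
rewrite -(closure_id _).1//.
apply: (accessible_finite_set_closed.1 _ _ fV).
exact/hausdorff_accessible/Rhausdorff.
Qed.

Lemma boundary_ptsE K : finite_set (boundary K) ->
  boundary K = [set boundary_pt n K | n in [set n | boundary_new n K]].
Proof.
move=> fK; rewrite -values_new; apply/seteqP; split => [y /boundary_sub_closure|].
  rewrite -(closure_id _).1//.
  apply: (accessible_finite_set_closed.1 _ _ ((finite_values K).1 fK)).
  exact/hausdorff_accessible/Rhausdorff.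
by move=> _ [n /(boundary_pt_mem fK)[]] + _ <-.
Qed.

Lemma boundary_new_inj K m n : boundary_new m K -> boundary_new n K ->
  boundary_pt m K = boundary_pt n K -> m = n.
Proof.
move=> [hm nm] [hn nn] e; have [mn|nm'|//] := ltngtP m n.
- by have := nn _ mn hm; rewrite e.
- by have := nm _ nm' hn; rewrite e.
Qed.

(** The formula holds for infinite boundaries too: every boundary point is a limit
    of the suprema, so finitely many suprema force a finite boundary. *)
Lemma counting_boundary K :
  counting (boundary K) =
  (\sum_(0 <= n <oo) (\1_(boundary_new n) K)%:E)%E :> \bar R.
Proof.
transitivity (counting (values K) : \bar R).
  have [fK|iK] := pselect (finite_set (boundary K)).
    by rewrite (boundary_ptsE fK) -values_new.
  by rewrite /counting !asboolF//; move: iK; rewrite finite_values.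
rewrite counting_esum values_new.
rewrite (reindex_esum [set n | boundary_new n K] _ (boundary_pt^~ K)); last first.
  split; [by move=> n hn; exists n| |by []].
  by move=> m n /set_mem hm /set_mem hn; exact: boundary_new_inj.
rewrite nneseries_esumT; last by move=> n; rewrite lee_fin.
rewrite esum_mkcond; apply: eq_esum => n _.
rewrite indicE; have [h|h] := pselect (boundary_new n K).
  by rewrite !mem_set.
by rewrite !memNset.
Qed.

Lemma measurable_counting_boundary :
  measurable_fun setT (fun K : C => counting (boundary K) : \bar R).
Proof.
under eq_fun do rewrite counting_boundary.
apply: ge0_emeasurable_sum => n; first by move=> K _; rewrite lee_fin.
move=> _; apply/measurable_EFinP; apply: measurable_indic.
exact: measurable_boundary_new.
Qed.

End boundary_enumeration.

(** * Poisson series and functions of independent counts *)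

Section poisson_series.
Context {R : realType}.
Local Open Scope ereal_scope.

Lemma nneseries_single (f : nat -> \bar R) k : (forall i, 0 <= f i) ->
  (forall i, i <> k -> f i = 0) -> \sum_(0 <= i <oo) f i = f k.
Proof.
move=> f0 fk; rewrite (nneseriesD1 _ (n := k))//.
by rewrite eseries0 ?adde0// => i _ /andP[_ /eqP]; exact: fk.
Qed.

Lemma expR_nneseries (x : R) : (0 <= x)%R ->
  \sum_(0 <= k <oo) (x ^+ k / k`!%:R)%:E = (expR x)%:E.
Proof.
move=> x0; rewrite expRE -EFin_lim; last first.
  rewrite /pseries/=; under eq_fun do rewrite mulrC.
  exact: is_cvg_series_exp_coeff.
apply/congr_lim/funext => n/=; rewrite /pseries/= /series/= -sumEFin//.
by under eq_bigr do rewrite mulrC.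
Qed.

Lemma poisson_generating (a c : R) : (0 <= a)%R -> (0 <= c)%R ->
  \sum_(0 <= k <oo) (c ^+ k)%:E * (a ^+ k / k`!%:R * expR (- a))%:E =
  (expR (- ((1 - c) * a)))%:E.
Proof.
move=> a0 c0; have ca0 : (0 <= c * a)%R by rewrite mulr_ge0.
transitivity (\sum_(0 <= k <oo) (expR (- a))%:E * ((c * a) ^+ k / k`!%:R)%:E).
  by apply: eq_eseriesr => k _; rewrite -!EFinM exprMn; congr EFin; ring.
rewrite nneseriesZl; last by move=> k _; rewrite lee_fin divr_ge0// exprn_ge0.
by rewrite expR_nneseries// -EFinM -expRD; congr (expR _)%:E; ring.
Qed.

Lemma poisson_mean (a : R) : (0 <= a)%R ->
  \sum_(0 <= k <oo) (k%:R)%:E * (a ^+ k / k`!%:R * expR (- a))%:E = a%:E.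
Proof.
move=> a0; have e0 := expR_ge0 (- a).
rewrite nneseries_recl//; last first.
  by move=> k _; rewrite mule_ge0// lee_fin ?mulr_ge0 ?divr_ge0 ?exprn_ge0.
rewrite mul0e add0e -(nneseries_addn 1%N); last first.
  by move=> k; rewrite mule_ge0// lee_fin ?mulr_ge0 ?divr_ge0 ?exprn_ge0.
transitivity (\sum_(0 <= k <oo) (a * expR (- a))%:E * (a ^+ k / k`!%:R)%:E).
  apply: eq_eseriesr => k _; rewrite addn1 -!EFinM factS natrM exprS; congr EFin.
  have k0 : (k`!%:R != 0 :> R)%R by rewrite pnatr_eq0 -lt0n fact_gt0.
  have k1 : (k.+1%:R != 0 :> R)%R by rewrite pnatr_eq0.
  by field; rewrite k0 addrC natr1.
rewrite nneseriesZl; last by move=> k _; rewrite lee_fin divr_ge0// exprn_ge0.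
by rewrite expR_nneseries// -EFinM -mulrA -expRD addNr expR0 mulr1.
Qed.

End poisson_series.

Section discrete_variables.
Context d (Omega : measurableType d) (R : realType) (P : probability Omega R).
Local Open Scope ereal_scope.

(** $g(N)$ for an extended-real variable $N$ that takes its values in the
    natural numbers; the function vanishes where $N$ is not a natural number. *)
Definition nat_comp (g : nat -> R) (N : Omega -> \bar R) (w : Omega) : \bar R :=
  \sum_(0 <= k <oo) (g k)%:E * (\1_[set w | N w = k%:R%:E] w)%:E.

Lemma nat_compE (g : nat -> R) N w k : (forall k, 0 <= g k)%R ->
  N w = k%:R%:E -> nat_comp g N w = (g k)%:E.
Proof.
move=> g0 Nw; rewrite /nat_comp (nneseries_single (k := k)).
- by rewrite indicE mem_set// mule1.
- by move=> i; rewrite mule_ge0// lee_fin.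
- move=> i ik; rewrite indicE memNset ?mule0//= Nw => -[] /eqP.
  by rewrite eqr_nat => /eqP /esym.
Qed.

Lemma nat_comp_ge0 g N w : (forall k, 0 <= g k)%R -> 0 <= nat_comp g N w.
Proof.
by move=> g0; apply: nneseries_ge0 => k _ _; rewrite mule_ge0// lee_fin.
Qed.

Lemma measurable_eq_nat N k : measurable_fun setT N ->
  measurable [set w : Omega | N w = k%:R%:E :> \bar R].
Proof.
move=> mN; rewrite -[X in measurable X]setTI.
by apply: (mN measurableT [set k%:R%:E]); exact: emeasurable_set1.
Qed.

Lemma measurable_nat_comp g N : (forall k, 0 <= g k)%R ->
  measurable_fun setT N -> measurable_fun setT (nat_comp g N).
Proof.
move=> g0 mN; apply: ge0_emeasurable_sum => k.
  by move=> w _ _; rewrite mule_ge0// lee_fin.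
move=> _; apply: emeasurable_funM; first exact: measurable_cst.
by apply/measurable_EFinP; apply: measurable_indic; exact: measurable_eq_nat.
Qed.

Lemma integral_nat_comp g N (Y : Omega -> \bar R) : (forall k, 0 <= g k)%R ->
  measurable_fun setT N -> measurable_fun setT Y -> (forall w, 0 <= Y w) ->
  \int[P]_w (Y w * nat_comp g N w) =
  \sum_(0 <= k <oo) (g k)%:E * \int[P]_w (Y w * (\1_[set w | N w = k%:R%:E] w)%:E).
Proof.
move=> g0 mN mY Y0.
have mI k : measurable_fun setT (fun w => (\1_[set w | N w = k%:R%:E] w : R)%:E).
  by apply/measurable_EFinP; apply: measurable_indic; exact: measurable_eq_nat.
transitivity (\int[P]_w \sum_(0 <= k <oo)
    ((g k)%:E * (Y w * (\1_[set w | N w = k%:R%:E] w)%:E))).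
  apply: eq_integral => w _; rewrite /nat_comp.
  have [[k Nk]|h] := pselect (exists k, N w = k%:R%:E).
    have z i : i <> k -> (\1_[set w | N w = i%:R%:E] w : R) = 0%R.
      move=> ik; rewrite indicE memNset//= Nk => -[] /eqP.
      by rewrite eqr_nat => /eqP /esym.
    rewrite !(nneseries_single (k := k)).
    - by rewrite muleCA.
    - by move=> i; rewrite !mule_ge0// lee_fin.
    - by move=> i /z ->; rewrite !mule0.
    - by move=> i; rewrite !mule_ge0// lee_fin.
    - by move=> i /z ->; rewrite !mule0.
  have z i : (\1_[set w | N w = i%:R%:E] w : R) = 0%R.
    by rewrite indicE memNset// => Ni; apply: h; exists i.
  by rewrite !eseries0 ?mule0// => i _ _; rewrite z !mule0.
rewrite integral_nneseries//.
- apply: eq_eseriesr => k _; rewrite ge0_integralZl_EFin//.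
  + by move=> w _; rewrite mule_ge0// lee_fin.
  + exact: emeasurable_funM.
- by move=> k; apply: emeasurable_funM => //; exact: emeasurable_funM.
- by move=> k w _; rewrite !mule_ge0// lee_fin.
Qed.

Lemma integral_nat_comp1 g N : (forall k, 0 <= g k)%R ->
  measurable_fun setT N -> \int[P]_w (nat_comp g N w) =
  \sum_(0 <= k <oo) (g k)%:E * P [set w | N w = k%:R%:E].
Proof.
move=> g0 mN; under eq_integral do rewrite -[nat_comp _ _ _]mul1e.
rewrite (integral_nat_comp (Y := cst 1)) //.
apply: eq_eseriesr => k _; congr (_ * _).
under eq_integral do rewrite mul1e.
by rewrite integral_indic ?setIT//; exact: measurable_eq_nat.
Qed.

Lemma nat_comp_le1 g N w : (forall k, 0 <= g k <= 1)%R -> nat_comp g N w <= 1.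
Proof.
move=> g1; have g0 k : (0 <= g k)%R by case/andP: (g1 k).
have [[k Nk]|h] := pselect (exists k, N w = k%:R%:E).
  by rewrite (nat_compE _ Nk)// lee_fin; case/andP: (g1 k).
rewrite /nat_comp eseries0// => i _ _.
by rewrite indicE memNset ?mule0// => Ni; apply: h; exists i.
Qed.

(** Each factor is expanded along the values of its variable, which turns the
    product into a series of probabilities of intersections. *)
Lemma independent_nat_comp (I : eqType) (N : I -> Omega -> \bar R)
    (g : I -> nat -> R) (s : seq I) :
  (forall i, measurable_fun setT (N i)) -> (forall i k, 0 <= g i k <= 1)%R ->
  mutually_independent P N -> uniq s ->
  \int[P]_w (\prod_(i <- s) nat_comp (g i) (N i) w) =
  \prod_(i <- s) \int[P]_w nat_comp (g i) (N i) w.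
Proof.
move=> mN g1 iN us.
have g0 i k : (0 <= g i k)%R by case/andP: (g1 i k).
pose EE (s' : seq I) (B : I -> set \bar R) := \bigcap_(i in [set` s']) (N i @^-1` B i).
have mEE s' B : (forall i, measurable (B i)) -> measurable (EE s' B).
  move=> mB; apply: fin_bigcap_measurable; first exact: finite_seq.
  by move=> i _; rewrite -[X in measurable X]setTI; exact: mN.
have mY (s0 : seq I) : measurable_fun setT
    (fun w => \prod_(i <- s0) nat_comp (g i) (N i) w).
  elim: s0 => [|i s0 IH].
    by under eq_fun do rewrite big_nil; exact: measurable_cst.
  under eq_fun do rewrite big_cons.
  by apply: emeasurable_funM => //; exact: measurable_nat_comp.
have Y0 (s0 : seq I) w : 0 <= \prod_(i <- s0) nat_comp (g i) (N i) w.
  by apply: prode_ge0 => i _; exact: nat_comp_ge0.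
have fin (s0 : seq I) : \prod_(i <- s0) \int[P]_w nat_comp (g i) (N i) w \is a fin_num.
  apply: prode_fin_num => i _; rewrite ge0_fin_numE; last first.
    by apply: integral_ge0 => w _; exact: nat_comp_ge0.
  apply: (@le_lt_trans _ _ (\int[P]_w cst 1 w)); last first.
    by rewrite integral_cst//= mul1e probability_setT ltry.
  apply: ge0_le_integral => //.
  - by move=> w _; exact: nat_comp_ge0.
  - exact: measurable_nat_comp.
  - by move=> w _; exact: nat_comp_le1.
suff claim s0 s' B : uniq (s0 ++ s') -> (forall i, measurable (B i)) ->
    \int[P]_w ((\prod_(i <- s0) nat_comp (g i) (N i) w) * (\1_(EE s' B) w)%:E) =
    (\prod_(i <- s0) \int[P]_w nat_comp (g i) (N i) w) * P (EE s' B).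
  have := claim s [::] (fun=> setT); rewrite cats0 => /(_ us (fun=> measurableT)).
  have -> : EE [::] (fun=> setT) = setT by apply/seteqP; split.
  rewrite probability_setT mule1 => <-.
  by apply: eq_integral => w _; rewrite indicT mule1.
elim: s0 s' B => [|i s0 IH] s' B us' mB.
  rewrite big_nil mul1e; under eq_integral do rewrite big_nil mul1e.
  by rewrite integral_indic ?setIT//; exact: mEE.
under eq_integral => w _ do rewrite big_cons -muleA muleC.
rewrite integral_nat_comp//; last 2 first.
- by apply: emeasurable_funM => //; apply/measurable_EFinP/measurable_indic; exact: mEE.
- by move=> w; rewrite mule_ge0// lee_fin.
have [is0 is'] : i \notin s0 /\ i \notin s'.
  by move: us' => /= /andP[]; rewrite mem_cat negb_or => /andP[].
pose B' k j := if j == i then [set k%:R%:E : \bar R] else B j.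
have mB' k j : measurable (B' k j).
  by rewrite /B'; case: ifP => // _; exact: emeasurable_set1.
have EB' k : EE (i :: s') (B' k) = EE s' B `&` [set w | N i w = k%:R%:E].
  apply/seteqP; split => w /=.
    move=> h; split; last by have := h i; rewrite /B'/= eqxx; apply; exact: mem_head.
    move=> j /= js'; have := h j; rewrite /B'/=; case: eqP => [ji|_].
      by move: is'; rewrite -ji js'.
    by apply; rewrite inE js' orbT.
  move=> [h hi] j /=; rewrite inE /B'; case: eqP => [-> _|_ /=]; first exact: hi.
  exact: h.
have step k : \int[P]_w (\prod_(j <- s0) nat_comp (g j) (N j) w *
      (\1_(EE s' B) w)%:E * (\1_[set w | N i w = k%:R%:E] w)%:E) =
    (\prod_(j <- s0) \int[P]_w nat_comp (g j) (N j) w) * P (EE s' B) *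
      P [set w | N i w = k%:R%:E].
  transitivity (\int[P]_w (\prod_(j <- s0) nat_comp (g j) (N j) w *
      (\1_(EE (i :: s') (B' k)) w)%:E)).
    by apply: eq_integral => w _; rewrite -muleA -EFinM EB' indicI.
  rewrite IH; last 2 first.
  - by rewrite -[i :: s']cat1s uniq_catCA.
  - exact: mB'.
  rewrite -muleA; congr (_ * _).
  have us2 : uniq s' by move: us' => /= /andP[_]; rewrite cat_uniq => /and3P[].
  rewrite [LHS]iN//=; last by rewrite is'.
  rewrite big_cons muleC; congr (_ * _).
    rewrite [RHS]iN//; apply: eq_big_seq => j js'; rewrite /B'.
    by case: eqP => // ji; move: is'; rewrite -ji js'.
  by rewrite /B' eqxx.
under eq_eseriesr do rewrite step muleCA.
rewrite big_cons -muleA muleC.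
have PE : P (EE s' B) \is a fin_num by apply: fin_num_measure; exact: mEE.
rewrite -(fineK (fin s0)) -(fineK PE) -EFinM nneseriesZl; last first.
  by move=> k _; rewrite mule_ge0// lee_fin.
by rewrite integral_nat_comp1// muleC.
Qed.

End discrete_variables.

(** * The Poisson process of the plane *)

Section plane_area.
Context {R : realType}.
Local Notation mR := (measurableTypeR R).
Local Notation plane := (mR * mR)%type.
Local Open Scope ereal_scope.

HB.instance Definition _ := Measure.copy (@area R)
  (@lebesgue_measure R \x @lebesgue_measure R).

Definition box (n : nat) : set plane :=
  `[(- n%:R)%R, n%:R] `*` `[(- n%:R)%R, n%:R].

Lemma measurable_box n : measurable (box n).
Proof. by apply: measurableX; exact: measurable_itv. Qed.

Lemma area_setX (A B : set mR) : measurable A -> measurable B ->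
  area (A `*` B) = lebesgue_measure A * lebesgue_measure B.
Proof. by move=> mA mB; rewrite [LHS]product_measure1E. Qed.

Lemma lebesgue_window n :
  lebesgue_measure (`[(- n%:R)%R, n%:R] : set mR) = (n.*2%:R)%:E.
Proof.
rewrite lebesgue_measure_itv/= lte_fin -muln2 natrM.
by case: ltP => h; rewrite ?oppr0 -?EFinD; congr EFin; have : (0 <= n%:R :> R)%R := ler0n _ _; lra.
Qed.

Lemma area_box n : area (box n) = ((n.*2 * n.*2)%N%:R)%:E.
Proof.
by rewrite area_setX ?lebesgue_window ?natrM//; exact: measurable_itv.
Qed.

Lemma area_box_fin n : area (box n) < +oo.
Proof. by rewrite area_box ltry. Qed.

Lemma box_nd m n : (m <= n)%N -> box m `<=` box n.
Proof.
move=> mn [x t] [/= hx ht]; split => /=; [move: hx|move: ht];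
by rewrite !in_itv/= => /andP[a b]; rewrite (le_trans _ a) ?(le_trans b)// ?lerN2 ler_nat.
Qed.

Lemma box_cover : \bigcup_n box n = setT.
Proof.
apply/seteqP; split => // -[x t] _.
pose m : R := Num.max `|x : R|%R `|t : R|%R.
exists (Num.truncn m).+1 => //; have h := truncnS_gt m.
by split; rewrite /= in_itv/= -ler_norml; apply/ltW/(le_lt_trans _ h); rewrite le_max lexx ?orbT.
Qed.

Let area_sigma_finite : sigma_finite setT (@area R).
Proof.
exists box; first by rewrite box_cover.
by move=> k; split; [exact: measurable_box|exact: area_box_fin].
Qed.

HB.instance Definition _ := Measure_isSigmaFinite.Build _ _ _ (@area R)
  area_sigma_finite.

Lemma cvg_box_measure (mu : {measure set plane -> \bar R}) (A : set plane) :
  measurable A -> mu (A `&` box n) @[n --> \oo] --> mu A.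
Proof.
move=> mA; rewrite -[X in mu X](setIT A) -box_cover setI_bigcupr.
apply: (@nondecreasing_cvg_mu _ _ _ mu (fun n => A `&` box n)).
- by move=> n; apply: measurableI => //; exact: measurable_box.
- apply: bigcupT_measurable => n; apply: measurableI => //; exact: measurable_box.
- by move=> m n mn; apply/subsetPset; apply: setIS; exact: box_nd.
Qed.

End plane_area.

(** The pushforward along a function whose measurability is a hypothesis, without
    a structure of measurable function on it. *)
Definition image_measure d1 d2 (T1 : measurableType d1) (T2 : measurableType d2)
    (R : realType) (m : {measure set T1 -> \bar R}) (f : T1 -> T2)
    (mf : measurable_fun setT f) : {measure set T2 -> \bar R}.
Proof. by refine (pushforward m f : {measure set T2 -> \bar R}). Defined.

Section poisson_plane.
Context d (Omega : measurableType d) (R : realType) (P : probability Omega R).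
Local Notation mR := (measurableTypeR R).
Local Notation plane := (mR * mR)%type.
Variable z : nat -> Omega -> plane.
Hypothesis hz : unit_poisson_process P z.
Local Open Scope ereal_scope.
Implicit Types A B : set plane.

Lemma measurable_preimage_point i A : measurable A -> measurable (z i @^-1` A).
Proof.
by move=> mA; rewrite -[X in measurable X]setTI; exact: (upp_measurable hz).
Qed.

Lemma measurable_point_count A : measurable A ->
  measurable_fun setT (point_count z A).
Proof.
move=> mA; apply: ge0_emeasurable_sum => // i _.
apply: (eq_measurable_fun (fun w => (\1_(z i @^-1` A) w)%:E)).
  by move=> w _; rewrite diracE indicE; congr (_%:R)%:E; rewrite !inE.
by apply/measurable_EFinP/measurable_indic; exact: measurable_preimage_point.
Qed.

Lemma integral_point_count A : measurable A ->
  \int[P]_w point_count z A w = \sum_(0 <= i <oo) P (z i @^-1` A).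
Proof.
move=> mA.
have E i w : \d_(z i w) A = (\1_(z i @^-1` A) w)%:E :> \bar R.
  by rewrite diracE indicE; congr (_%:R)%:E; rewrite !inE.
transitivity (\int[P]_w \sum_(0 <= i <oo) (\1_(z i @^-1` A) w)%:E).
  by apply: eq_integral => w _; apply: eq_eseriesr => i _; rewrite E.
rewrite integral_nneseries//.
- apply: eq_eseriesr => i _; rewrite integral_indic ?setIT//.
  exact: measurable_preimage_point.
- by move=> i; apply/measurable_EFinP/measurable_indic; exact: measurable_preimage_point.
Qed.

Lemma area_fineK A : area A < +oo -> area A = (fine (area A))%:E.
Proof. by move=> A1; rewrite fineK// ge0_fin_numE. Qed.

Lemma point_count_nat A : measurable A -> area A < +oo ->
  {ae P, forall w, exists k : nat, point_count z A w = k%:R%:E}.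
Proof.
move=> mA A1.
have mE k : measurable [set w | point_count z A w = k%:R%:E].
  by apply: measurable_eq_nat; exact: measurable_point_count.
have mU : measurable (\bigcup_k [set w | point_count z A w = k%:R%:E]).
  exact: bigcupT_measurable.
have PU : P (\bigcup_k [set w | point_count z A w = k%:R%:E]) = 1.
  rewrite measure_semi_bigcup//; last first.
    move=> i j _ _ [w [/= -> []]] /eqP; rewrite eqr_nat => /eqP //.
  rewrite (eq_eseriesr (fun k _ => upp_finite hz mA A1 k)).
  have := @poisson_generating R (fine (area A)) 1 _ ler01.
  rewrite subrr mul0r oppr0 expR0 => <-; last exact: fine_ge0.
  by apply: eq_eseriesr => k _; rewrite expr1n mul1e.
exists (~` \bigcup_k [set w | point_count z A w = k%:R%:E]); split.
- exact: measurableC.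
- by rewrite probability_setC// PU subee.
- by move=> w /= nex [k _ /= h]; apply: nex; exists k.
Qed.

Lemma intensity_finite A : measurable A -> area A < +oo ->
  \sum_(0 <= i <oo) P (z i @^-1` A) = area A.
Proof.
move=> mA A1; rewrite -integral_point_count//.
have g0 (k : nat) : (0 <= k%:R :> R)%R by [].
transitivity (\int[P]_w nat_comp (fun k => k%:R) (point_count z A) w).
  apply: ge0_ae_eq_integral => //.
  - exact: measurable_point_count.
  - by apply: measurable_nat_comp => //; exact: measurable_point_count.
  - by move=> w _; apply: nneseries_ge0.
  - by move=> w _; exact: nat_comp_ge0.
  - apply: filterS (point_count_nat mA A1) => w [k Nk] _.
    by rewrite Nk (nat_compE _ Nk).
rewrite integral_nat_comp1//; last exact: measurable_point_count.
rewrite [RHS]area_fineK// -[RHS]poisson_mean ?fine_ge0//.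
by apply: eq_eseriesr => k _; congr (_ * _); exact: (upp_finite hz mA A1).
Qed.

Lemma poisson_intensity A : measurable A ->
  \sum_(0 <= i <oo) P (z i @^-1` A) = area A.
Proof.
move=> mA.
pose m := mseries (fun i => image_measure P (upp_measurable hz i)) 0.
have mE B : m B = \sum_(0 <= i <oo) P (z i @^-1` B) by [].
rewrite -mE.
rewrite -(cvg_lim (@ereal_hausdorff R) (@cvg_box_measure _ (@area R) A mA)).
rewrite -[LHS](cvg_lim (@ereal_hausdorff R) (@cvg_box_measure _ m A mA)).
suff -> : (fun n => m (A `&` box n)) = (fun n => area (A `&` box n)) by [].
apply/funext => n; rewrite mE intensity_finite//.
  by apply: measurableI => //; exact: measurable_box.
apply: (le_lt_trans _ (area_box_fin n)).
apply: le_measure; rewrite ?inE//; last exact: measurable_box.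
by apply: measurableI => //; exact: measurable_box.
Qed.

Lemma point_count_ge1 A w i : A (z i w) -> 1 <= point_count z A w.
Proof.
move=> Ai; rewrite /point_count (nneseriesD1 _ (n := i))//.
rewrite diracE mem_set//= leeDl//.
exact: nneseries_ge0.
Qed.

Lemma point_count_ge2 A w i j : i <> j -> A (z i w) -> A (z j w) ->
  1 + 1 <= point_count z A w.
Proof.
move=> /eqP ij Ai Aj; rewrite /point_count (nneseriesD1 _ (n := i))//.
rewrite (nneseriesD1 _ (n := j))//; last by rewrite eq_sym.
rewrite !diracE !mem_set//= leeD2l// leeDl//.
exact: nneseries_ge0.
Qed.

Lemma point_count0_prob A : measurable A -> area A < +oo ->
  P [set w | point_count z A w = 0] = (expR (- fine (area A)))%:E.
Proof.
move=> mA A1; have := upp_finite hz mA A1 0.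
by rewrite expr0 fact0 divr1 mul1r => <-.
Qed.

Lemma measurable_point_count_eq A k : measurable A ->
  measurable [set w | point_count z A w = k%:R%:E].
Proof.
by move=> mA; apply: measurable_eq_nat; exact: measurable_point_count.
Qed.

Lemma point_count_neq0_prob A : measurable A -> area A < +oo ->
  P (~` [set w | point_count z A w = 0]) <= area A.
Proof.
move=> mA A1; rewrite probability_setC; last exact: (@measurable_point_count_eq A 0).
rewrite point_count0_prob// [leRHS]area_fineK// -EFinB lee_fin.
by rewrite lerBlDr -lerBlDl; have := expR_ge1Dx (- fine (area A)).
Qed.

Let pair_disjoint i j A B : measurable A -> measurable B -> area A < +oo ->
  area B < +oo -> A `&` B = set0 ->
  P (z i @^-1` A `&` z j @^-1` B) <= area A * area B.
Proof.
move=> mA mB A1 B1 AB.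
pose AA (k : 'I_2) := if k == ord0 then A else B.
have mAA k : measurable (AA k) by rewrite /AA; case: ifP.
have tAA : trivIset setT AA.
  apply/trivIsetP => /= k l _ _; rewrite /AA.
  case: (unliftP ord0 k) => [k' ->|->]; case: (unliftP ord0 l) => [l' ->|->] //=.
  - by rewrite (ord1 k') (ord1 l') eqxx.
  - by rewrite setIC.
have ind := upp_independent hz mAA tAA.
have m0 : forall k : 'I_2, measurable [set~ (0 : \bar R)].
  by move=> _; apply: measurableC; exact: emeasurable_set1.
have := ind [:: ord0; ord_max] (fun=> [set~ 0]) isT m0.
rewrite !big_cons big_nil mule1 => e.
apply: (@le_trans _ _ (P (\bigcap_(k in [set` [:: ord0; ord_max]])
   (point_count z (AA k) @^-1` [set~ 0])))).
  apply: le_measure; rewrite ?inE.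
  - by apply: measurableI; apply: measurable_preimage_point.
  - apply: fin_bigcap_measurable; first exact: finite_seq.
    by move=> k _; apply: measurableC; exact: (@measurable_point_count_eq _ 0).
  - move=> w [Ai Bj] k /=; rewrite !inE => /orP[] /eqP -> /= => h.
      by have := point_count_ge1 Ai; rewrite h lee_fin ler10.
    by have := point_count_ge1 Bj; rewrite h lee_fin ler10.
rewrite e; apply: lee_pmul => //; exact: point_count_neq0_prob.
Qed.

Let pair_same i j A : i <> j -> measurable A -> area A < +oo ->
  P (z i @^-1` A `&` z j @^-1` A) <= area A * area A.
Proof.
move=> ij mA A1.
pose E := [set w | point_count z A w = 0] `|` [set w | point_count z A w = 1%:R%:E].
have mE : measurable E.
  apply: measurableU; first exact: (@measurable_point_count_eq A 0).
  exact: measurable_point_count_eq.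
apply: (@le_trans _ _ (P (~` E))).
  apply: le_measure; rewrite ?inE.
  - by apply: measurableI; apply: measurable_preimage_point.
  - exact: measurableC.
  - by move=> w [Ai Aj] [] /= e; have := point_count_ge2 ij Ai Aj;
      rewrite e -EFinD lee_fin; lra.
rewrite probability_setC// measureU//=; last first.
- rewrite -subset0 => w [/= -> []] /eqP; rewrite eq_sym oner_eq0 //.
- exact: measurable_point_count_eq.
- exact: (@measurable_point_count_eq A 0).
rewrite point_count0_prob// [P _](upp_finite hz mA A1 1).
have aE := area_fineK A1; set a := fine _ in aE *.
rewrite aE expr1 divr1 [X in 1 - X](_ : _ = (expR (- a) + a * expR (- a))%:E)//.
rewrite -EFinB -EFinM lee_fin.
have := expR_ge1Dx (- a); have := expR_ge0 (- a).
have a0 : (0 <= a)%R by exact: fine_ge0.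
nra.
Qed.

(** For disjoint sets both counts are nonzero, and the counts are independent; for
    $A=B$ the count is at least two, which has probability at most the square of
    the area. The general case is cut along $A\cap B$. *)
Lemma poisson_pair i j A B : i <> j -> measurable A -> measurable B ->
  area A < +oo -> area B < +oo ->
  P (z i @^-1` A `&` z j @^-1` B) <= area A * area B.
Proof.
move=> ij mA mB A1 B1.
pose I := A `&` B; pose A' := A `\` B; pose B' := B `\` A.
have mI : measurable I by exact: measurableI.
have mA' : measurable A' by exact: measurableD.
have mB' : measurable B' by exact: measurableD.
have fin (C D : set plane) : measurable C -> measurable D -> C `<=` D -> area D < +oo -> area C < +oo.
  by move=> mC mD CD; apply: le_lt_trans; apply: le_measure; rewrite ?inE.
have I1 : area I < +oo by apply: (fin _ A) => // p [].
have A'1 : area A' < +oo by apply: (fin _ A) => // p [].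
have B'1 : area B' < +oo by apply: (fin _ B) => // p [].
have mz k C : measurable C -> measurable (z k @^-1` C) by exact: measurable_preimage_point.
have -> : z i @^-1` A `&` z j @^-1` B =
  (z i @^-1` A' `&` z j @^-1` I `|` z i @^-1` A' `&` z j @^-1` B') `|`
  (z i @^-1` I `&` z j @^-1` I `|` z i @^-1` I `&` z j @^-1` B').
  apply/seteqP; split => w /=; rewrite /A' /B' /I /=.
    by move=> [Ai Bj]; have [] := pselect (B (z i w)); have [] := pselect (A (z j w)); tauto.
  by tauto.
apply: (@le_trans _ _ ((area A' * area I + area A' * area B') +
   (area I * area I + area I * area B'))).
  apply: le_trans (measureU2 _ _ _) _; try by apply: measurableU; apply: measurableI; exact: mz.
  apply: leeD.
    apply: le_trans (measureU2 _ _ _) _; try by apply: measurableI; exact: mz.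
    apply: leeD; apply: pair_disjoint => //.
      by rewrite /A' /I -subset0 => p [[_ h] [_ /h]].
    by rewrite /A' /B' -subset0 => p [[_ h] [/h]].
  apply: le_trans (measureU2 _ _ _) _; try by apply: measurableI; exact: mz.
  apply: leeD; first exact: pair_same.
  apply: pair_disjoint => //.
  by rewrite /B' /I -subset0 => p [[h _] [_ /(_ h)]].
have -> : area A = area A' + area I by exact: measureDI.
have -> : area B = area B' + area I by rewrite /I setIC; exact: measureDI.
have distr (a b c : R) : a%:E * c%:E + a%:E * b%:E + (c%:E * c%:E + c%:E * b%:E) <=
    (a%:E + c%:E) * (b%:E + c%:E).
  by rewrite -!(EFinM, EFinD) lee_fin le_eqVlt; apply/orP; left; apply/eqP; ring.
by rewrite (area_fineK A'1) (area_fineK B'1) (area_fineK I1); exact: distr.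
Qed.

Lemma eq0_le_inv (x : \bar R) (C : R) : 0 <= x ->
  (forall n : nat, x <= (C / n.+1%:R)%:E) -> x = 0.
Proof.
move=> x0 xC; apply/eqP; rewrite eq_le x0 andbT.
have C0 : (0 <= C)%R by have := le_trans x0 (xC 0%N); rewrite lee_fin divr1.
apply/lee_addgt0Pr => e e0; rewrite add0e.
apply: (le_trans (xC (Num.truncn (C / e)))); rewrite lee_fin.
rewrite ler_pdivrMr// mulrC -ler_pdivrMr//; apply/ltW; exact: truncnS_gt.
Qed.

(** By [poisson_pair] the law of the pair $(z_i,z_j)$ is bounded by the product of
    the areas on rectangles. Inside a bounded box the event is covered by of the
    order of $n$ pairs of strips of width $1/n$, each of probability of the
    order of $1/n^2$. *)
Lemma poisson_diff_null i j (delta : R) : i <> j ->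
  P [set w | ((z i w).1 : R) - (z j w).1 = delta]%R = 0.
Proof.
move=> ij.
have mz k C : measurable C -> measurable (z k @^-1` C) by exact: measurable_preimage_point.
pose E := [set w | ((z i w).1 : R) - (z j w).1 = delta]%R.
have mfst k : measurable_fun setT (fun w => (z k w).1 : R).
  by apply: (measurableT_comp measurable_fst); exact: (upp_measurable hz).
have mE : measurable E.
  rewrite -[X in measurable X]setTI.
  exact: (measurable_funB (mfst i) (mfst j) measurableT (measurable_set1 delta)).
pose F (L : nat) := E `&` (z i @^-1` box L `&` z j @^-1` box L).
have mF L : measurable (F L).
  by apply: measurableI => //; apply: measurableI; apply: mz; exact: measurable_box.
suff F0 L : P (F L) = 0.
  have EF : E = \bigcup_L F L.
    apply/seteqP; split => [w Ew|w [L _ []]//].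
    have [m _ mi] : (\bigcup_n box n) (z i w) by rewrite box_cover.
    have [n _ nj] : (\bigcup_n box n) (z j w) by rewrite box_cover.
    exists (maxn m n) => //; split => //; split; rewrite /preimage /=.
      exact: box_nd (leq_maxl _ _) _ mi.
    exact: box_nd (leq_maxr _ _) _ nj.
  rewrite -/E EF; apply/eqP; rewrite eq_le measure_ge0 andbT.
  apply: le_trans (measure_sigma_subadditive P _ _ (@subset_refl _ _)) _ => //.
    exact: bigcupT_measurable.
  by rewrite eseries0// => k _ _; exact: F0.
apply: (@eq0_le_inv _ ((L.*2.+1 * (L.*2 * L.*2))%:R)) => // n.
pose cell (k : nat) : set R := `[(- L%:R + k%:R / n.+1%:R)%R, (- L%:R + k.+1%:R / n.+1%:R)%R[%classic.
pose cell' (k : nat) : set R := `[(- L%:R + k%:R / n.+1%:R - delta)%R, (- L%:R + k.+1%:R / n.+1%:R - delta)%R[%classic.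
pose W : set R := `[(- L%:R)%R, L%:R]%classic.
pose G k := z i @^-1` (cell k `*` W) `&` z j @^-1` (cell' k `*` W).
have n0 : (0 < n.+1%:R :> R)%R by [].
have mc k : measurable (cell k `*` W : set plane) by apply: measurableX; exact: measurable_itv.
have mc' k : measurable (cell' k `*` W : set plane) by apply: measurableX; exact: measurable_itv.
have step (k : nat) : (k.+1%:R / n.+1%:R = k%:R / n.+1%:R + n.+1%:R^-1 :> R)%R.
  by rewrite -natr1 mulrDl mul1r.
have ac k : area (cell k `*` W : set plane) = (n.+1%:R^-1 * L.*2%:R)%:E.
  rewrite area_setX; [|exact: measurable_itv..]; rewrite lebesgue_window /cell lebesgue_measure_itv/=.
  rewrite lte_fin step ltrD2l ltrDl invr_gt0 n0 EFinM; congr (_ * _).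
  by rewrite -EFinB; congr EFin; ring.
have ac' k : area (cell' k `*` W : set plane) = (n.+1%:R^-1 * L.*2%:R)%:E.
  rewrite area_setX; [|exact: measurable_itv..]; rewrite lebesgue_window /cell' lebesgue_measure_itv/=.
  rewrite lte_fin step ltrD2r ltrD2l ltrDl invr_gt0 n0 EFinM; congr (_ * _).
  by rewrite -EFinB; congr EFin; ring.
pose M := (L.*2 * n.+1).+1.
apply: (@le_trans _ _ (\sum_(k < M) P (G k))).
  apply: content_subadditive => //.
    by move=> k _; apply: measurableI; exact: mz.
  move=> w [Ew [[/= xi ti] [/= xj tj]]].
  rewrite -bigcup_mkord.
  move: xi; rewrite in_itv/= => /andP[Lx xL].
  pose y := ((((z i w).1 : R) + L%:R) * n.+1%:R)%R.
  have y0 : (0 <= y)%R by rewrite mulr_ge0// -lerBlDr sub0r.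
  have /andP[ky yk] := truncn_itv y0.
  set k := Num.truncn y in ky yk.
  have kc : cell k (z i w).1.
    have -> : (z i w).1 = (- L%:R + y / n.+1%:R)%R :> R.
      by rewrite /y mulfK ?gt_eqF//; lra.
    by rewrite /cell/= in_itv/= lerD2l ltrD2l ler_pM2r ?ltr_pM2r ?invr_gt0// ky.
  exists k => /=.
    rewrite /M ltnS -(ler_nat R) natrM (le_trans ky)//.
    rewrite ler_pM2r// -muln2 natrM; lra.
  split; split => //=.
  move: kc; rewrite /cell /cell' /= !in_itv/= => /andP[h1 h2].
  have -> : ((z j w).1 = (z i w).1 - delta :> R)%R.
    by rewrite -Ew; lra.
  by rewrite lerD2r ltrD2r h1 h2.
apply: (@le_trans _ _ (\sum_(k < M) (n.+1%:R^-1 * L.*2%:R * (n.+1%:R^-1 * L.*2%:R))%:E)).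
  apply: lee_sum => k _; rewrite EFinM -{1}(ac k) -(ac' k).
  by apply: poisson_pair => //; rewrite ?ac ?ac' ltry.
rewrite sumEFin lee_fin sumr_const card_ord -[X in (X <= _)%R]mulr_natl.
have MM : (M%:R <= L.*2.+1%:R * n.+1%:R :> R)%R.
  by rewrite -natrM ler_nat /M mulSn addnC -addn1 leq_add2l.
apply: (@le_trans _ _ (L.*2.+1%:R * n.+1%:R * (n.+1%:R^-1 * L.*2%:R * (n.+1%:R^-1 * L.*2%:R))))%R.
  by rewrite ler_wpM2r// !mulr_ge0// invr_ge0.
rewrite le_eqVlt; apply/orP; left; apply/eqP; rewrite !natrM.
by field; rewrite gt_eqF.
Qed.

Lemma point_count_nat_near A w n : point_count z A w = n%:R%:E ->
  \forall J \near \oo, (\sum_(j < J) (`[< A (z j w) >] : nat))%N = n.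
Proof.
move=> An.
pose m J := (\sum_(j < J) (`[< A (z j w) >] : nat))%N.
have : (fun J => (m J)%:R%:E) @ \oo --> (n%:R%:E : \bar R).
  rewrite -An /point_count.
  have := @is_cvg_nneseries R (fun i => \d_(z i w) A) xpredT 0%N.
  move=> /(_ (fun _ _ _ => measure_ge0 _ _)).
  rewrite (_ : (fun J => _) = (fun J => (m J)%:R%:E)).
    by [].
  apply/funext => J; rewrite /m natr_sum -sumEFin big_mkord.
  by apply: eq_bigr => j _; rewrite diracE.
move=> /fine_cvg /= /cvgr_dist_lt /(_ 1%R ltr01).
apply: filterS => J /=; rewrite -/(m J).
have [mn|mn|//] := ltngtP (m J) n; rewrite ltr_norml => /andP[].
- move=> _; rewrite -natrB ?(ltnW mn)// -[1%R]/(1%:R)%R ltr_nat ltnS leqn0 subn_eq0.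
  by rewrite leqNgt mn.
- rewrite ltrNl opprB => + _; rewrite -natrB ?(ltnW mn)// -[1%R]/(1%:R)%R ltr_nat ltnS leqn0 subn_eq0.
  by rewrite leqNgt mn.
Qed.

(** * Laplace functional of the Poisson process *)

Definition step_fun n (D : 'I_n -> set plane) (a : 'I_n -> R) (p : plane) : R :=
  (\sum_(k < n) a k * \1_(D k) p)%R.

Lemma step_funE n (D : 'I_n -> set plane) a k p : trivIset setT D -> D k p ->
  step_fun D a p = a k.
Proof.
move=> tD Dk; rewrite /step_fun (bigD1 k)//= indicE mem_set// mulr1.
rewrite big1 ?addr0// => l lk; rewrite indicE memNset ?mulr0// => Dl.
by move/eqP: lk; apply; apply: tD => //; exists p.
Qed.

Lemma step_fun0 n (D : 'I_n -> set plane) a p : (forall k, ~ D k p) ->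
  step_fun D a p = 0%R.
Proof.
move=> nD; rewrite /step_fun big1// => k _.
by rewrite indicE memNset ?mulr0//; exact: nD.
Qed.

Lemma step_fun_prod n (D : 'I_n -> set plane) a p : trivIset setT D ->
  (1 - step_fun D a p = \prod_(k < n) (1 - a k) ^+ `[< D k p >])%R.
Proof.
move=> tD; have [[k Dk]|nD] := pselect (exists k, D k p).
  rewrite (step_funE _ tD Dk) (bigD1 k)//= asboolT// expr1 big1 ?mulr1// => l lk.
  rewrite asboolF ?expr0// => Dl.
  by move/eqP: lk; apply; apply: tD => //; exists p.
have nD' k : ~ D k p by move=> Dk; apply: nD; exists k.
by rewrite step_fun0// subr0 big1// => k _; rewrite asboolF ?expr0.
Qed.

Lemma measurable_step_fun n (D : 'I_n -> set plane) a :
  (forall k, measurable (D k)) -> measurable_fun setT (step_fun D a).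
Proof.
move=> mD; apply: measurable_sum => k.
by apply: measurable_funM => //; exact: measurable_indic.
Qed.

(** The conditional probability that none of the first $J$ points is retained, if
    a point at $p$ is retained with probability $u(p)$. *)
Definition survival (u : plane -> R) J w : R := (\prod_(j < J) (1 - u (z j w)))%R.

Lemma measurable_survival u J : measurable_fun setT u ->
  measurable_fun setT (survival u J).
Proof.
move=> mu; elim: J => [|J IH].
  rewrite (_ : survival u 0 = cst 1%R); first exact: measurable_cst.
  by apply/funext => w; rewrite /survival big_ord0.
rewrite (_ : survival u J.+1 = (survival u J \* (fun w => 1 - u (z J w)))%R).
  apply: measurable_funM => //; apply: measurable_funB => //.
  by apply: (measurableT_comp mu); exact: (upp_measurable hz).
by apply/funext => w; rewrite /survival big_ord_recr.
Qed.

Lemma survival_bounds u J w : (forall p, 0 <= u p <= 1)%R ->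
  (0 <= survival u J w <= 1)%R.
Proof.
move=> u01; apply/andP; split.
  by apply: prodr_ge0 => j _; rewrite subr_ge0; case/andP: (u01 (z j w)).
apply: prodr_ile1 => j _; have /andP[u0 u1] := u01 (z j w).
by rewrite subr_ge0 u1 gerBl.
Qed.

Lemma le_survival u v J w : (forall p, 0 <= u p)%R -> (forall p, v p <= 1)%R ->
  (forall p, u p <= v p)%R -> (survival v J w <= survival u J w)%R.
Proof.
move=> u0 v1 uv; apply: ler_prod => j _; rewrite subr_ge0 v1/=.
by rewrite lerD2l lerN2.
Qed.

(** For a step function the product over the points is a product of powers whose
    exponents are the counts of the level sets, and these counts are
    independent. *)
Lemma step_laplace n (D : 'I_n -> set plane) (a : 'I_n -> R) :
  (forall k, measurable (D k)) -> trivIset setT D ->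
  (forall k, area (D k) < +oo) -> (forall k, 0 <= a k <= 1)%R ->
  \int[P]_w (survival (step_fun D a) J w)%:E @[J --> \oo] -->
  (expR (- \sum_(k < n) a k * fine (area (D k))))%:E.
Proof.
move=> mD tD D1 a01.
have c01 k m : (0 <= (1 - a k) ^+ m <= 1)%R.
  have /andP[a0 a1] := a01 k.
  by rewrite exprn_ge0 ?subr_ge0// exprn_ile1 ?subr_ge0// gerBl.
have c0 k m : (0 <= (1 - a k) ^+ m)%R by case/andP: (c01 k m).
have mN k : measurable_fun setT (point_count z (D k)) by exact: measurable_point_count.
pose G w := \prod_(k <- enum 'I_n) nat_comp (fun m => (1 - a k) ^+ m)%R (point_count z (D k)) w.
have -> : (expR (- \sum_(k < n) a k * fine (area (D k))))%:E = \int[P]_w G w.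
  rewrite independent_nat_comp//; last 2 first.
  - exact: (upp_independent hz).
  - exact: enum_uniq.
  transitivity (\prod_(k <- enum 'I_n) (expR (- (a k * fine (area (D k)))))%:E).
    rewrite prodEFin big_enum/=; congr EFin.
    by rewrite -expR_sum sumrN.
  apply: eq_bigr => k _; rewrite integral_nat_comp1//.
  have /andP[a0 a1] := a01 k.
  rewrite -[X in (- (X * _))%R](subKr 1%R) -[LHS]poisson_generating ?subr_ge0 ?fine_ge0//.
  by apply: eq_eseriesr => m _; congr (_ * _); apply/esym/(upp_finite hz).
have mG : measurable_fun setT G.
  rewrite /G; elim: (enum _) => [|k s IH].
    by under eq_fun do rewrite big_nil; exact: measurable_cst.
  under eq_fun do rewrite big_cons.
  by apply: emeasurable_funM => //; exact: measurable_nat_comp.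
have s01 p : (0 <= step_fun D a p <= 1)%R.
  have [[k Dk]|nD] := pselect (exists k, D k p).
    by rewrite (step_funE _ tD Dk).
  by rewrite step_fun0 ?lexx ?ler01// => k Dk; apply: nD; exists k.
have [] := @dominated_convergence _ _ _ P setT measurableT
    (fun J w => (survival (step_fun D a) J w)%:E) G (cst 1) => //.
- by move=> J; apply/measurable_EFinP; apply: measurable_survival; exact: measurable_step_fun.
- have : \forall w \ae P, forall k : 'I_n, exists m : nat, point_count z (D k) w = m%:R%:E.
    by apply: filter_forall => k; exact: point_count_nat.
  apply: filterS => w /choice[m hm] _.
  rewrite /G; under eq_bigr do rewrite (nat_compE _ (hm _))//.
  rewrite prodEFin; apply/cvg_EFin; first by near=> J.
  have near_m : \forall J \near \oo, forall k : 'I_n,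
      (\sum_(j < J) (`[< D k (z j w) >] : nat))%N = m k.
    by apply: filter_forall => k; exact: point_count_nat_near.
  apply: cvg_near_cst; apply: filterS near_m => J hJ.
  rewrite /= /survival.
  transitivity (\prod_(j < J) \prod_(k < n) (1 - a k) ^+ `[< D k (z j w) >])%R.
    by apply: eq_bigr => j _; exact: step_fun_prod.
  rewrite exchange_big/= big_enum/=; apply: eq_bigr => k _.
  by rewrite prodrXr hJ.
- exact: finite_measure_integrable_cst.
- apply: aeW => w J _; have /andP[h0 h1] := survival_bounds J w s01.
  by rewrite gee0_abs ?lee_fin.
Unshelve. all: by end_near. Qed.
Lemma integral_step_fun n (D : 'I_n -> set plane) (a : 'I_n -> R) :
  (forall k, measurable (D k)) -> (forall k, area (D k) < +oo) ->
  (forall k, 0 <= a k)%R ->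
  \int[@area R]_p (step_fun D a p)%:E = (\sum_(k < n) a k * fine (area (D k)))%:E.
Proof.
move=> mD D1 a0; rewrite -sumEFin.
transitivity (\int[@area R]_p \sum_(k < n) ((a k)%:E * (\1_(D k) p)%:E)).
  by apply: eq_integral => p _; rewrite /step_fun -sumEFin.
rewrite ge0_integral_sum//; last 2 first.
- move=> k; apply: emeasurable_funM => //.
  by apply/measurable_EFinP; exact: measurable_indic.
- by move=> k p _; rewrite mule_ge0// lee_fin.
apply: eq_bigr => k _; rewrite ge0_integralZl_EFin//; last first.
  by apply/measurable_EFinP; exact: measurable_indic.
by rewrite integral_indic ?setIT// EFinM fineK// ge0_fin_numE.
Qed.

(** The function $u$ is bracketed between the step functions of its level sets
    $k\le(n+1)u<k+1$, which are at distance at most $1/(n+1)$, and the survival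
    probability is antitone in $u$. *)
Lemma poisson_laplace (u : plane -> R) B : measurable_fun setT u ->
  (forall p, 0 <= u p <= 1)%R -> (forall p, ~ B p -> u p = 0%R) ->
  measurable B -> area B < +oo ->
  \int[P]_w (survival u J w)%:E @[J --> \oo] -->
  (expR (- fine (\int[@area R]_p (u p)%:E)))%:E.
Proof.
move=> mu u01 uB mB B1.
pose iu := \int[@area R]_p (u p)%:E.
have u0 p : (0 <= u p)%R by case/andP: (u01 p).
have u1 p : (u p <= 1)%R by case/andP: (u01 p).
have mEu : measurable_fun setT (fun p => (u p)%:E) by exact/measurable_EFinP.
have indB : \int[@area R]_p (\1_B p)%:E = area B by rewrite integral_indic// setIT.
have iuB : iu <= area B.
  rewrite -indB.
  apply: ge0_le_integral => //.
  - by move=> p _; rewrite lee_fin.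
  - by apply/measurable_EFinP; exact: measurable_indic.
  - move=> p _; rewrite lee_fin indicE; have [/mem_set ->|nB] := pselect (B p); first exact: u1.
    by rewrite uB// ler0n.
have iu_fin : iu = (fine iu)%:E.
  rewrite fineK// ge0_fin_numE ?(le_lt_trans iuB)//.
  by apply: integral_ge0 => p _; rewrite lee_fin.
set b := fine (area B); set I := fine iu in iu_fin *.
have b0 : (0 <= b)%R by exact: fine_ge0.
pose q J := \int[P]_w (survival u J w)%:E.
have q_ni : {homo q : m n / (m <= n)%N >-> n <= m}.
  apply/nonincreasing_seqP => J; apply: ge0_le_integral => //.
  - by move=> w _; rewrite lee_fin; case/andP: (survival_bounds J.+1 w u01).
  - by apply/measurable_EFinP; exact: measurable_survival.
  - by apply/measurable_EFinP; exact: measurable_survival.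
  - move=> w _; rewrite lee_fin /survival big_ord_recr/= ler_piMr//.
      by have /andP[] := survival_bounds J w u01.
    by rewrite gerBl.
have q_cvg := ereal_nonincreasing_is_cvgn q_ni.
have bracket n : (expR (- I - b / n.+1%:R))%:E <= limn q <= (expR (- I + b / n.+1%:R))%:E.
  have n0 : (0 < n.+1%:R :> R)%R by [].
  pose D (k : 'I_n.+2) : set plane := B `&` [set p | k%:R <= n.+1%:R * u p < k.+1%:R]%R.
  have mhu : measurable_fun setT (fun p => n.+1%:R * u p)%R by exact: measurable_funM.
  have mD k : measurable (D k).
    apply: measurableI => //.
    rewrite (_ : [set _ | _] = setT `&` (fun p => n.+1%:R * u p)%R @^-1` `[k%:R, k.+1%:R[%classic).
      by apply: mhu => //; exact: measurable_itv.
    by rewrite setTI; apply/seteqP; split => p /=; rewrite in_itv.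
  have tD : trivIset setT D.
    move=> k l _ _ [p [[_ /= hk] [_ /= hl]]].
    by apply/val_inj; rewrite /= -(truncn_def hk) -(truncn_def hl).
  have D1 k : area (D k) < +oo.
    by apply: le_lt_trans B1; apply: le_measure; rewrite ?inE//; move=> p [].
  have DB p : B p -> exists k, D k p.
    move=> Bp; have h0 : (0 <= n.+1%:R * u p)%R by rewrite mulr_ge0.
    have hk := truncn_itv h0.
    have kn : (Num.truncn (n.+1%:R * u p)%R < n.+2)%N.
      rewrite ltnS -(ler_nat R); case/andP: hk => hk _; apply: (le_trans hk).
      by rewrite -[leRHS]mulr1 ler_pM2l.
    by exists (Ordinal kn).
  pose a (k : 'I_n.+2) : R := (k%:R / n.+1%:R)%R.
  pose a' (k : 'I_n.+2) : R := Num.min 1%R (k.+1%:R / n.+1%:R)%R.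
  have a01 k : (0 <= a k <= 1)%R.
    by rewrite /a divr_ge0//= ler_pdivrMr// mul1r ler_nat -ltnS.
  have a'01 k : (0 <= a' k <= 1)%R.
    by rewrite /a' le_min ler01 divr_ge0//= ge_min lexx.
  have aa' k : (a' k <= a k + n.+1%:R^-1)%R.
    rewrite /a' /a ge_min -[in X in _ || X]natr1 mulrDl mul1r lexx orbT//.
  have uD k p : D k p -> (a k <= u p <= a' k)%R.
    move=> [_ /= /andP[h1 h2]]; rewrite /a /a' ler_pdivrMr// mulrC h1/= le_min u1/=.
    by rewrite ler_pdivlMr// mulrC ltW.
  have uv p : (step_fun D a p <= u p)%R.
    have [/DB[k Dk]|nB] := pselect (B p).
      by rewrite (step_funE _ tD Dk); case/andP: (uD _ _ Dk).
    by rewrite step_fun0// => k [].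
  have uv' p : (u p <= step_fun D a' p)%R.
    have [/DB[k Dk]|nB] := pselect (B p).
      by rewrite (step_funE _ tD Dk); case/andP: (uD _ _ Dk).
    by rewrite step_fun0 ?uB// => k [].
  have v0 p : (0 <= step_fun D a p)%R.
    by apply: sumr_ge0 => k _; rewrite mulr_ge0//; case/andP: (a01 k).
  have v1 p : (step_fun D a' p <= 1)%R.
    have [/DB[k Dk]|nB] := pselect (B p).
      by rewrite (step_funE _ tD Dk); case/andP: (a'01 k).
    by rewrite step_fun0// => k [].
  pose s := (\sum_(k < n.+2) a k * fine (area (D k)))%R.
  pose s' := (\sum_(k < n.+2) a' k * fine (area (D k)))%R.
  have iS : (s <= I)%R.
    rewrite -lee_fin -iu_fin -integral_step_fun//; last by move=> k; case/andP: (a01 k).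
    apply: ge0_le_integral => //.
    - by move=> p _; rewrite lee_fin.
    - by apply/measurable_EFinP; exact: measurable_step_fun.
    - by move=> p _; rewrite lee_fin.
  have iS' : (I <= s')%R.
    rewrite -lee_fin -iu_fin -integral_step_fun//; last by move=> k; case/andP: (a'01 k).
    apply: ge0_le_integral => //.
    - by move=> p _; rewrite lee_fin.
    - by apply/measurable_EFinP; exact: measurable_step_fun.
    - by move=> p _; rewrite lee_fin.
  have sumD : (\sum_(k < n.+2) fine (area (D k)) <= b)%R.
    rewrite -lee_fin /b -area_fineK//.
    under eq_bigr do rewrite -[fine _]mul1r.
    rewrite -integral_step_fun//.
    rewrite -indB.
    apply: ge0_le_integral => //.
    - by move=> p _; rewrite lee_fin; apply: sumr_ge0 => k _; rewrite mulr_ge0.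
    - by apply/measurable_EFinP; exact: measurable_step_fun.
    - by apply/measurable_EFinP; exact: measurable_indic.
    - move=> p _; rewrite lee_fin indicE; have [Bp|nB] := pselect (B p).
        by have [k Dk] := DB _ Bp; rewrite (step_funE _ tD Dk) mem_set.
      by rewrite step_fun0 ?ler0n// => k [].
  have ss' : (s' <= s + b / n.+1%:R)%R.
    apply: (@le_trans _ _ (\sum_(k < n.+2) (a k + n.+1%:R^-1) * fine (area (D k))))%R.
      by apply: ler_sum => k _; rewrite ler_wpM2r ?fine_ge0.
    under eq_bigr do rewrite mulrDl.
    rewrite big_split/= lerD2l -mulr_sumr mulrC ler_wpM2r// invr_ge0 ltW//.
  have lo : (- I - b / n.+1%:R <= - s')%R.
    by rewrite -opprD lerN2 (le_trans ss')// lerD2r.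
  have hi : (- s <= - I + b / n.+1%:R)%R.
    by rewrite lerNl opprD opprK lerBlDr (le_trans iS').
  have h := step_laplace mD tD D1 a01; have h' := step_laplace mD tD D1 a'01.
  apply/andP; split.
    apply: (@le_trans _ _ (expR (- s'))%:E); first by rewrite lee_fin ler_expR.
    rewrite -(cvg_lim (@ereal_hausdorff R) h').
    apply: lee_lim => //; first by apply/cvg_ex; exists (expR (- s'))%:E.
    apply: nearW => J; apply: ge0_le_integral => //.
    + move=> w _; rewrite lee_fin; apply: prodr_ge0 => j _; rewrite subr_ge0; exact: v1.
    + by apply/measurable_EFinP/measurable_survival; exact: measurable_step_fun.
    + by apply/measurable_EFinP; exact: measurable_survival.
    + by move=> w _; rewrite lee_fin; exact: le_survival.
  apply: (@le_trans _ _ (expR (- s))%:E); last by rewrite lee_fin ler_expR.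
  rewrite -(cvg_lim (@ereal_hausdorff R) h).
  apply: lee_lim => //; first by apply/cvg_ex; exists (expR (- s))%:E.
  apply: nearW => J; apply: ge0_le_integral => //.
  + by move=> w _; rewrite lee_fin; case/andP: (survival_bounds J w u01).
  + by apply/measurable_EFinP; exact: measurable_survival.
  + by apply/measurable_EFinP/measurable_survival; exact: measurable_step_fun.
  + by move=> w _; rewrite lee_fin; exact: le_survival.
have lim_fin : limn q = (fine (limn q))%:E.
  rewrite fineK//; have /andP[h1 h2] := bracket 0%N.
  by rewrite fin_numE; apply/andP; split; apply/eqP => e; move: h1 h2; rewrite e ?leeNy_eq ?leye_eq.
suff e : fine (limn q) = expR (- I) by move: q_cvg; rewrite -/q lim_fin e.
have inv0 : (fun n => b / n.+1%:R)%R @ \oo --> (0 : R)%R.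
  by rewrite -(mulr0 b); apply: cvgMr; exact: cvg_harmonic.
have cE (f : nat -> R) : f @ \oo --> (- I)%R -> (expR \o f) @ \oo --> expR (- I).
  by move=> fI; apply: continuous_cvg => //; exact: continuous_expR.
have c1 : (expR \o (fun n => - I - b / n.+1%:R)%R) @ \oo --> expR (- I).
  by apply: cE; rewrite -[X in _ --> X]subr0; apply: cvgB => //; exact: cvg_cst.
have c2 : (expR \o (fun n => - I + b / n.+1%:R)%R) @ \oo --> expR (- I).
  by apply: cE; rewrite -[X in _ --> X]addr0; apply: cvgD => //; exact: cvg_cst.
apply/eqP; rewrite eq_le; apply/andP; split.
  rewrite -(cvg_lim (@Rhausdorff R) c2); apply: limr_ge.
    by apply/cvg_ex; exists (expR (- I)).
  by apply: nearW => n /=; have /andP[_] := bracket n; rewrite lim_fin lee_fin.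
rewrite -(cvg_lim (@Rhausdorff R) c1); apply: limr_le.
  by apply/cvg_ex; exists (expR (- I)).
by apply: nearW => n /=; have /andP[+ _] := bracket n; rewrite lim_fin lee_fin.
Qed.

End poisson_plane.

(** * Independent marks *)

Section product_spaces.
Context d1 d2 (T1 : measurableType d1) (T2 : measurableType d2) (R : realType).
Local Open Scope ereal_scope.

Lemma eq_measure_setX (m1 m2 : {measure set (T1 * T2) -> \bar R}) :
  m1 setT < +oo ->
  (forall A B, measurable A -> measurable B -> m1 (A `*` B) = m2 (A `*` B)) ->
  forall D, measurable D -> m1 D = m2 D.
Proof.
move=> m1fin m12 D mD.
pose G : set (set (T1 * T2)) :=
  [set C | exists A, measurable A /\ exists B, measurable B /\ C = A `*` B].
apply: (measure_unique G (fun=> setT)) => //.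
- rewrite measurable_prod_measurableType //; congr (<<s _ >>).
  rewrite predeqE; split => [[A mA [B mB <-]]|[A [mA [B [mB ->]]]]].
    by exists A; split => //; exists B.
  by exists A => //; exists B.
- move=> _ _ [A [mA [B [mB ->]]]] [A' [mA' [B' [mB' ->]]]].
  rewrite -setXI; exists (A `&` A'); split; first exact: measurableI.
  by exists (B `&` B'); split => //; exact: measurableI.
- by move=> _; exists setT; split => //; exists setT; rewrite setXTT.
- by rewrite bigcup_const.
- by move=> _ [A [mA [B [mB ->]]]]; exact: m12.
Qed.

End product_spaces.

Section mixture.
Context d (Omega : measurableType d) d1 d2 (T1 : measurableType d1)
  (T2 : measurableType d2) (R : realType).
Variables (P : probability Omega R) (Q : probability T2 R).
Variables (h : Omega -> R) (f : Omega -> T1).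
Hypotheses (mh : measurable_fun setT h) (h0 : forall w, 0 <= h w).
Hypothesis mf : measurable_fun setT f.
Local Open Scope ereal_scope.

Lemma measurable_section_comp (D : set (T1 * T2)) : measurable D ->
  measurable_fun setT (fun w => Q (xsection D (f w))).
Proof.
by move=> mD; apply: (measurableT_comp (measurable_fun_xsection Q mD)).
Qed.

(** For $h=1$ this is the law of the pair of $f$ and an independent mark with law
    $Q$; the weight $h$ keeps track of what happens to the other points. *)
Definition mixture (D : set (T1 * T2)) : \bar R :=
  \int[P]_w ((h w)%:E * Q (xsection D (f w))).

Let mixture0 : mixture set0 = 0.
Proof.
rewrite /mixture integral0_eq// => w _.
by rewrite xsection0 measure0 mule0.
Qed.

Let mixture_ge0 D : 0 <= mixture D.
Proof. by apply: integral_ge0 => w _; rewrite mule_ge0// lee_fin. Qed.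

Let mixture_sigma_additive : semi_sigma_additive mixture.
Proof.
move=> F mF tF mUF.
rewrite [X in _ --> X](_ : _ = \sum_(0 <= n <oo) mixture (F n)).
  by apply: is_cvg_nneseries => n _ _; exact: mixture_ge0.
rewrite /mixture -integral_nneseries//; last 2 first.
- move=> n; apply: emeasurable_funM; last exact: measurable_section_comp.
  exact/measurable_EFinP.
- by move=> n w _; rewrite mule_ge0// lee_fin.
apply: eq_integral => w _.
rewrite nneseriesZl// xsection_bigcup measure_semi_bigcup//.
- by move=> n; exact: measurable_xsection.
- exact: trivIset_xsection.
- by apply: bigcupT_measurable => n; exact: measurable_xsection.
Qed.

Definition mixture_measure : {measure set (T1 * T2) -> \bar R} :=
  HB.pack mixture (isMeasure.Build _ _ _ mixture
    mixture0 mixture_ge0 mixture_sigma_additive).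

End mixture.
Section sigma_generated.
Context d (Omega : measurableType d) (I : Type) d' (T : measurableType d').
Variable X : I -> Omega -> T.

(** The underlying space with the $\sigma$-algebra generated by the family, so that
    membership in this $\sigma$-algebra can be proved as measurability. *)
Definition generated_space : Type :=
  g_sigma_algebraType (\bigcup_i preimage_set_system [set: Omega] (X i) measurable).

HB.instance Definition _ := Measurable.on generated_space.

Lemma measurable_generated i :
  measurable_fun [set: generated_space] (X i : generated_space -> T).
Proof.
move=> _ A mA; rewrite setTI; apply: sub_sigma_algebra.
by exists i => //; exists A => //; rewrite setTI.
Qed.

Lemma generated_preimage i A :
  measurable A -> @measurable _ generated_space (X i @^-1` A).
Proof.
by move=> mA; rewrite -[X in measurable X]setTI; exact: measurable_generated.
Qed.

End sigma_generated.

Section marked_points.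
Context d (Omega : measurableType d) (R : realType) (P : probability Omega R).
Context d1 (T1 : measurableType d1) d2 (T2 : measurableType d2).
Variables (Q : probability T2 R) (z : nat -> Omega -> T1) (S : nat -> Omega -> T2).
Hypothesis mz : forall i, measurable_fun setT (z i).
Hypothesis mS : forall i, measurable_fun setT (S i).
Hypothesis S_law : forall i A, measurable A -> pushforward P (S i) A = Q A.
Hypothesis S_indep : mutually_independent P S.
Hypothesis zS_indep : independent_families P z S.
Local Open Scope ereal_scope.

Definition leaf i w : T1 * T2 := (z i w, S i w).

Lemma measurable_leaf i : measurable_fun setT (leaf i).
Proof. exact: measurable_fun_pair. Qed.

(** The conditional probability, given a point at $p$, that its leaf is in $D$. *)
Definition mark_prob (D : set (T1 * T2)) (p : T1) : R := fine (Q (xsection D p)).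

Lemma mark_probE D p : measurable D -> Q (xsection D p) = (mark_prob D p)%:E.
Proof.
move=> mD; rewrite /mark_prob fineK//; apply: fin_num_measure.
exact: measurable_xsection.
Qed.

Lemma mark_prob_bounds D p : measurable D -> (0 <= mark_prob D p <= 1)%R.
Proof.
move=> mD; rewrite -!lee_fin -mark_probE// measure_ge0/=.
by apply: probability_le1; exact: measurable_xsection.
Qed.

Lemma measurable_mark_prob D : measurable D -> measurable_fun setT (mark_prob D).
Proof.
move=> mD; apply/measurable_EFinP.
apply: (eq_measurable_fun (Q \o xsection D)) => [p _|].
  by rewrite /= mark_probE.
exact: measurable_fun_xsection.
Qed.

Let z_sigma G := sigma_generated z G.

Let measurable_z_sigma G : z_sigma G -> measurable G.
Proof.
apply: smallest_sub; first exact: sigma_algebra_measurable.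
by move=> _ [i _ [A mA <-]]; rewrite setTI -[X in measurable X]setTI; exact: mz.
Qed.

Let mleafP i D : measurable D -> measurable (leaf i @^-1` D).
Proof.
by move=> mD; rewrite -[X in measurable X]setTI; exact: measurable_leaf.
Qed.

Let leaves (s : seq nat) (D : nat -> set (T1 * T2)) :=
  \bigcap_(i in [set` s]) (leaf i @^-1` D i).

Let marks (s : seq nat) (E : nat -> set T2) :=
  \bigcap_(i in [set` s]) (S i @^-1` E i).

Let m_leaves s D : (forall i, measurable (D i)) -> measurable (leaves s D).
Proof.
move=> mD; apply: fin_bigcap_measurable; first exact: finite_seq.
by move=> i _; exact: mleafP.
Qed.

Let m_marks s E : (forall i, measurable (E i)) -> measurable (marks s E).
Proof.
move=> mE; apply: fin_bigcap_measurable; first exact: finite_seq.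
by move=> i _; rewrite -[X in measurable X]setTI; exact: mS.
Qed.

Let weight G (s : seq nat) D w : R := (\1_G w * \prod_(i <- s) mark_prob (D i) (z i w))%R.

Let m_weight G s D : measurable G -> (forall i, measurable (D i)) ->
  measurable_fun setT (weight G s D).
Proof.
move=> mG mD; apply: measurable_funM; first exact: measurable_indic.
elim: s => [|i s IH].
  by under eq_fun do rewrite big_nil; exact: measurable_cst.
under eq_fun do rewrite big_cons.
apply: measurable_funM => //.
by apply: (measurableT_comp (measurable_mark_prob (mD i))); exact: mz.
Qed.

Let weight_ge0 G s D w : (forall i, measurable (D i)) -> (0 <= weight G s D w)%R.
Proof.
move=> mD; apply: mulr_ge0; first by rewrite indicE.
by apply: prodr_ge0 => i _; case/andP: (mark_prob_bounds (z i w) (mD i)).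
Qed.

(** The marks of the leaves of $s$ are integrated out one leaf at a time: in one
    leaf both sides are finite measures, compared on rectangles, and a rectangle
    moves its first side into $G$ and its second side into the list $s'$. *)
Let leaves_marks_prob (s s' : seq nat) G D E : uniq (s ++ s') -> z_sigma G ->
  (forall i, measurable (D i)) -> (forall i, measurable (E i)) ->
  P (G `&` leaves s D `&` marks s' E) =
  \int[P]_w (weight G s D w)%:E * \prod_(i <- s') Q (E i).
Proof.
move=> + + mD + ; elim: s s' G E => [|i s IH] s' G E us' zG mE.
  have -> : leaves [::] D = setT by apply/seteqP; split.
  rewrite setIT zS_indep//; last first.
    apply: (@fin_bigcap_measurable _ (generated_space S)); first exact: finite_seq.
    by move=> i _; exact: generated_preimage.
  congr (_ * _).
    rewrite -[in LHS](setIT G) -integral_indic//; last exact: measurable_z_sigma.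
    by apply: eq_integral => w _; rewrite /weight big_nil mulr1.
  rewrite [LHS]S_indep//.
  by apply: eq_bigr => j _; exact: S_law.
have mG := measurable_z_sigma zG.
have [is0 is'] : i \notin s /\ i \notin s'.
  by move: us' => /= /andP[]; rewrite mem_cat negb_or => /andP[].
have us0 : uniq (s ++ i :: s') by rewrite -[i :: s']cat1s uniq_catCA.
pose rest := G `&` leaves s D `&` marks s' E.
have mrest : measurable rest.
  by apply: measurableI; [apply: measurableI => //; exact: m_leaves|exact: m_marks].
pose c := \prod_(j <- s') Q (E j).
have c_fin : c = (fine c)%:E.
  by rewrite fineK//; apply: prode_fin_num => j _; exact: fin_num_measure.
have c0 : (0 <= fine c)%R.
  by apply: fine_ge0; apply: prode_ge0.
pose h w := (fine c * weight G s D w)%R.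
have mh : measurable_fun setT h.
  by apply: measurable_funM => //; exact: m_weight.
have h0 w : (0 <= h w)%R by rewrite mulr_ge0// weight_ge0.
pose m1 := image_measure (mrestr P mrest) (measurable_leaf i).
pose m2 := mixture_measure P Q mh h0 (mz i).
have key : forall C, measurable C -> m1 C = m2 C.
  apply: eq_measure_setX.
    apply: (@le_lt_trans _ _ 1); last exact: ltry.
    by apply: probability_le1; apply: measurableI => //; exact: mleafP.
  move=> A B mA mB.
  pose G' := G `&` z i @^-1` A.
  have zG' : z_sigma G'.
    apply: (@measurableI _ (generated_space z)) => //.
    exact: generated_preimage.
  pose E' j := if j == i then B else E j.
  have mE' j : measurable (E' j) by rewrite /E'; case: ifP.
  have -> : m1 (A `*` B) = P (G' `&` leaves s D `&` marks (i :: s') E').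
    congr (P _); apply/seteqP; split => w /=.
      move=> [[Aw Bw] [[Gw Dw] Ew]]; split; first by split.
      move=> j /=; rewrite inE /E'; case: eqP => [-> _ //|_ /=]; exact: Ew.
    move=> [[[Gw Aw] Dw] Ew]; split.
      by split => //; have := Ew i; rewrite /E'/= eqxx; apply; exact: mem_head.
    split => // j /= js'; have := Ew j; rewrite /E'/=; case: eqP => [ji|_].
      by move: is'; rewrite -ji js'.
    by apply; rewrite inE js' orbT.
  rewrite IH// big_cons {1}/E' eqxx (eq_big_seq (fun j => Q (E j))); last first.
    move=> j js'; rewrite /E'; case: eqP => // ji.
    by move: is'; rewrite -ji js'.
  rewrite -/c c_fin [RHS](_ : _ = \int[P]_w ((fine c)%:E * (Q B * (weight G' s D w)%:E))).
    rewrite ge0_integralZl_EFin//; last 2 first.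
    - by move=> w _; rewrite mule_ge0// lee_fin weight_ge0.
    - apply: emeasurable_funM => //; apply/measurable_EFinP; apply: m_weight => //.
      exact: measurable_z_sigma.
    rewrite ge0_integralZl//.
    - by rewrite [LHS]muleC [Q B * _]muleC muleA.
    - apply/measurable_EFinP; apply: m_weight => //; exact: measurable_z_sigma.
    - by move=> w _; rewrite lee_fin weight_ge0.
  apply: eq_integral => w _; rewrite /h EFinM -muleA; congr (_ * _).
  rewrite /weight /G' indicI /=.
  have [Aw|nAw] := pselect (A (z i w)).
    by rewrite in_xsectionX ?inE// muleC [\1_(_ @^-1` _) _]indicE mem_set// mulr1.
  rewrite notin_xsectionX; last by apply/negP; rewrite inE.
  by rewrite measure0 mule0 [\1_(_ @^-1` _) _]indicE memNset// mulr0 mul0r mule0.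
have -> : G `&` leaves (i :: s) D `&` marks s' E = leaf i @^-1` D i `&` rest.
  apply/seteqP; split => w /=.
    move=> [[Gw Dw] Ew]; split; first by apply: (Dw i); exact: mem_head.
    by split => //; split => // j /= js; apply: (Dw j); rewrite /= inE js orbT.
  move=> [iw [[Gw Dw] Ew]]; split => //; split => // j /=.
  by rewrite inE => /orP[/eqP -> //|]; exact: Dw.
rewrite [LHS](key _ (mD i)) -/c c_fin muleC -ge0_integralZl_EFin//.
- apply: eq_integral => w _; rewrite /h mark_probE// -!EFinM; congr EFin.
  by rewrite /weight big_cons; ring.
- by move=> w _; rewrite lee_fin weight_ge0.
- by apply/measurable_EFinP; exact: m_weight.
Qed.

(** Given the points, the marks are independent, so that leaves in $D$ are retained
    points of a thinning. *)
Lemma leaves_avoid_prob D J : measurable D ->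
  P [set w | forall j, (j < J)%N -> ~ D (leaf j w)] =
  \int[P]_w (\prod_(j < J) (1 - mark_prob D (z j w)))%:E.
Proof.
move=> mD; have mCD : measurable (~` D) by exact: measurableC.
have := @leaves_marks_prob (iota 0 J) [::] setT (fun=> ~` D) (fun=> setT).
rewrite cats0 iota_uniq => /(_ isT) h.
transitivity (P (setT `&` leaves (iota 0 J) (fun=> ~` D) `&` marks [::] (fun=> setT))).
  congr (P _); apply/seteqP; split => w /=.
    by move=> hw; split => //; split => // j /=; rewrite mem_iota add0n => /hw.
  by move=> [[_ hw] _] j jJ; apply: (hw j); rewrite /= mem_iota.
rewrite h//; last exact: (@measurableT _ (generated_space z)).
rewrite big_nil mule1; apply: eq_integral => w _; congr EFin.
rewrite /weight indicT mul1r -[J in iota 0 J]subn0 big_mkord.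
apply: eq_bigr => j _; apply: EFin_inj.
rewrite -mark_probE// EFinB -mark_probE//.
rewrite (_ : xsection (~` D) _ = ~` xsection D (z j w)); last first.
  by apply/seteqP; split => y; rewrite /xsection /= !inE.
by rewrite probability_setC//; exact: measurable_xsection.
Qed.

End marked_points.

(** * Void probabilities and the Mecke equation for the leaves *)

Section marked_poisson.
Context d (Omega : measurableType d) (R : realType) (P : probability Omega R).
Local Notation mR := (measurableTypeR R).
Local Notation plane := (mR * mR)%type.
Context d2 (T2 : measurableType d2).
Variables (Q : probability T2 R) (z : nat -> Omega -> plane) (S : nat -> Omega -> T2).
Hypothesis hz : unit_poisson_process P z.
Hypothesis mS : forall i, measurable_fun setT (S i).
Hypothesis S_law : forall i A, measurable A -> pushforward P (S i) A = Q A.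
Hypothesis S_indep : mutually_independent P S.
Hypothesis zS_indep : independent_families P z S.
Local Open Scope ereal_scope.
Local Notation X := (plane * T2)%type.
Local Notation leaf := (leaf z S).
Implicit Types A B D H : set X.

Let mz := upp_measurable hz.

Definition leaf_intensity : set X -> \bar R := (@area R \x Q).

HB.instance Definition _ := Measure.copy leaf_intensity (@area R \x Q).

Local Notation mu := leaf_intensity.

Definition slab n : set X := box n `*` setT.

Lemma measurable_slab n : measurable (slab n).
Proof. by apply: measurableX => //; exact: measurable_box. Qed.

Lemma slab_nd m n : (m <= n)%N -> slab m `<=` slab n.
Proof. by move=> mn [p K] [/= h _]; split => //; exact: (box_nd mn). Qed.

Lemma slab_cover : \bigcup_n slab n = setT.
Proof.
apply/seteqP; split => // -[p K] _.
have [n _ np] : (\bigcup_n box n) p by rewrite box_cover.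
by exists n.
Qed.

Lemma leaf_intensity_setX (A : set plane) (B : set T2) : measurable A -> measurable B ->
  mu (A `*` B) = area A * Q B.
Proof. by move=> mA mB; exact: product_measure1E. Qed.

Lemma slab_fin n : mu (slab n) < +oo.
Proof. by rewrite leaf_intensity_setX ?probability_setT ?mule1 ?area_box_fin//; exact: measurable_box. Qed.

Lemma sub_slab_fin n A : measurable A -> A `<=` slab n -> mu A < +oo.
Proof.
move=> mA An; apply: le_lt_trans (slab_fin n).
by apply: le_measure; rewrite ?inE//; exact: measurable_slab.
Qed.

Let leaf_intensity_sigma_finite : sigma_finite setT mu.
Proof.
exists slab; first by rewrite slab_cover.
by move=> k; split; [exact: measurable_slab|exact: slab_fin].
Qed.

HB.instance Definition _ := Measure_isSigmaFinite.Build _ _ _ mu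
  leaf_intensity_sigma_finite.

Lemma cvg_slab_measure (m : {measure set X -> \bar R}) A :
  measurable A -> m (A `&` slab n) @[n --> \oo] --> m A.
Proof.
move=> mA; rewrite -[X in m X](setIT A) -slab_cover setI_bigcupr.
apply: (@nondecreasing_cvg_mu _ _ _ m (fun n => A `&` slab n)).
- by move=> n; apply: measurableI => //; exact: measurable_slab.
- by apply: bigcupT_measurable => n; apply: measurableI => //; exact: measurable_slab.
- by move=> i j ij; apply/subsetPset; apply: setIS; exact: slab_nd.
Qed.

Lemma measurable_preimage_leaf i A : measurable A -> measurable (leaf i @^-1` A).
Proof.
by move=> mA; rewrite -[X in measurable X]setTI; exact: (measurable_leaf mz mS).
Qed.

(** Both sides are measures, and on rectangles the point and the mark are
    independent. *)
Lemma campbell A : measurable A -> \sum_(0 <= i <oo) P (leaf i @^-1` A) = mu A.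
Proof.
move=> mA.
pose m := mseries (fun i => image_measure P (measurable_leaf mz mS i)) 0.
apply/esym; apply: (@product_measure_unique _ _ _ _ _ (@area R) Q m) => // B E mB mE.
transitivity (Q E * \sum_(0 <= i <oo) P (z i @^-1` B)); last first.
  by rewrite (poisson_intensity hz mB) muleC.
rewrite -(fineK (fin_num_measure Q _ mE)) -nneseriesZl//.
apply: eq_eseriesr => i _; rewrite fineK ?fin_num_measure//.
transitivity (P (z i @^-1` B `&` S i @^-1` E)); first by [].
rewrite zS_indep.
- by rewrite muleC; congr (_ * _); exact: S_law.
- exact: generated_preimage.
- exact: generated_preimage.
Qed.

Definition avoid D : set Omega := [set w | forall j, ~ D (leaf j w)].

Lemma measurable_avoid D : measurable D -> measurable (avoid D).
Proof.
move=> mD; rewrite (_ : avoid D = \bigcap_j ~` (leaf j @^-1` D)).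
  apply: bigcapT_measurable => j; apply: measurableC.
  exact: measurable_preimage_leaf.
by apply/seteqP; split => w h j; [move=> _|]; exact: h.
Qed.

Lemma avoidU D D' : avoid (D `|` D') = avoid D `&` avoid D'.
Proof.
apply/seteqP; split => [w h|w [h h'] j [|]]; [|exact: h|exact: h'].
by split => j hj; apply: (h j); [left|right].
Qed.

Let mu_fineK D : mu D < +oo -> mu D = (fine (mu D))%:E.
Proof. by move=> D1; rewrite fineK// ge0_fin_numE. Qed.

Let avoid_prob_slab n D : measurable D -> D `<=` slab n ->
  P (avoid D) = (expR (- fine (mu D)))%:E.
Proof.
move=> mD Dn.
pose V J := [set w | forall j, (j < J)%N -> ~ D (leaf j w)].
have mV J : measurable (V J).
  rewrite (_ : V J = \bigcap_(j in `I_J) ~` (leaf j @^-1` D)).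
    apply: fin_bigcap_measurable; first exact: finite_II.
    by move=> j _; apply: measurableC; exact: measurable_preimage_leaf.
  by apply/seteqP; split => w h j /=; exact: h.
have cV : P (V J) @[J --> \oo] --> P (avoid D).
  rewrite (_ : avoid D = \bigcap_J V J).
    apply: (@nonincreasing_cvg_mu _ _ _ P V) => //.
    - by apply: (le_lt_trans (probability_le1 P (mV 0%N))); exact: ltry.
    - exact: bigcapT_measurable.
    - by move=> i j ij; apply/subsetPset => w h k ki; apply: h; exact: leq_trans ij.
  apply/seteqP; split => w h j; first by move=> _ k _; exact: h.
  exact: (h j.+1 Logic.I j).
have muD : mu D = \int[@area R]_p (mark_prob Q D p)%:E.
  by apply: eq_integral => p _; rewrite /= mark_probE.
have := poisson_laplace hz (measurable_mark_prob Q mD)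
  (fun p => mark_prob_bounds Q p mD) _ (measurable_box n) (area_box_fin n).
have h0 p : ~ box n p -> mark_prob Q D p = 0%R.
  move=> np; rewrite /mark_prob (_ : xsection D p = set0) ?measure0//.
  by rewrite -subset0 => K; rewrite /xsection/= inE => /Dn[].
move=> /(_ h0); rewrite -muD => cD.
rewrite -(cvg_lim (@ereal_hausdorff R) cV) -(cvg_lim (@ereal_hausdorff R) cD).
suff -> : (fun J => P (V J)) = (fun J => \int[P]_w (survival z (mark_prob Q D) J w)%:E) by [].
by apply/funext => J; exact: (leaves_avoid_prob mz mS S_law S_indep zS_indep J mD).
Qed.

(** Given the points, the leaves in $D$ are a thinning with retention probability
    [mark_prob], whose integral over the plane is $\mu(D)$. A set of finite
    intensity is exhausted by slabs. *)
Lemma avoid_prob D : measurable D -> mu D < +oo ->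
  P (avoid D) = (expR (- fine (mu D)))%:E.
Proof.
move=> mD D1.
have mDn n : measurable (D `&` slab n) by apply: measurableI => //; exact: measurable_slab.
have cV : P (avoid (D `&` slab n)) @[n --> \oo] --> P (avoid D).
  rewrite (_ : avoid D = \bigcap_n avoid (D `&` slab n)).
    apply: (@nonincreasing_cvg_mu _ _ _ P (fun n => avoid (D `&` slab n))).
    - apply: (@le_lt_trans _ _ 1); last exact: ltry.
      by apply: probability_le1; exact: measurable_avoid.
    - by move=> n; exact: measurable_avoid.
    - by apply: bigcapT_measurable => n; exact: measurable_avoid.
    - by move=> i j ij; apply/subsetPset => w h k [Dk ik]; apply: (h k); split => //; exact: slab_nd ik.
  apply/seteqP; split => w h j; first by move=> _ k [/h].
  move=> Dj; have [n _ nj] : (\bigcup_n slab n) (leaf j w) by rewrite slab_cover.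
  exact: (h n Logic.I j).
have cD : (expR (- fine (mu (D `&` slab n))))%:E @[n --> \oo] --> (expR (- fine (mu D)))%:E.
  apply/cvg_EFin; first by near=> n.
  apply: continuous_cvg; first exact: continuous_expR.
  apply: cvgN; apply: fine_cvg; rewrite -mu_fineK//.
  exact: cvg_slab_measure.
rewrite -(cvg_lim (@ereal_hausdorff R) cV) -(cvg_lim (@ereal_hausdorff R) cD).
suff -> : (fun n => P (avoid (D `&` slab n))) =
  (fun n => (expR (- fine (mu (D `&` slab n))))%:E) by [].
apply/funext => n.
by rewrite (@avoid_prob_slab n)//; exact: subIsetr.
Unshelve. all: by end_near. Qed.

Definition strip L n (k : nat) : set X :=
  [set x : X | (k%:R <= ((x.1.1 : R) + L%:R) * n.+1%:R < k.+1%:R)%R].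

Lemma measurable_strip L n k : measurable (strip L n k).
Proof.
pose f (x : X) : R := (((x.1.1 : R) + L%:R) * n.+1%:R)%R.
have mf : measurable_fun setT f.
  apply: measurable_funM => //; apply: measurable_funD => //.
  exact: (measurableT_comp measurable_fst measurable_fst).
rewrite (_ : strip L n k = setT `&` f @^-1` `[k%:R, k.+1%:R[%classic).
  by apply: mf => //; exact: measurable_itv.
by rewrite setTI; apply/seteqP; split => x /=; rewrite in_itv.
Qed.

Lemma strip_cover L n : slab L `<=` \bigcup_(k in `I_(L.*2 * n.+1).+1) strip L n k.
Proof.
move=> [[x t] K] [[/= xL _] _]; move: xL; rewrite in_itv/= => /andP[Lx xL].
have y0 : (0 <= ((x : R) + L%:R) * n.+1%:R)%R by rewrite mulr_ge0// -lerBlDr sub0r.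
have h := truncn_itv y0; exists (Num.truncn (((x : R) + L%:R) * n.+1%:R)%R) => //=.
rewrite ltnS -(ler_nat R); case/andP: h => h _; apply: (le_trans h).
rewrite natrM ler_pM2r// -muln2 natrM; lra.
Qed.

Lemma strip_triv L n : trivIset setT (strip L n).
Proof.
move=> k l _ _ [x [/= hk hl]].
by rewrite -(truncn_def hk) -(truncn_def hl).
Qed.

Lemma strip_intensity L n k : mu (slab L `&` strip L n k) <= (L.*2%:R / n.+1%:R)%:E.
Proof.
have n0 : (0 < n.+1%:R :> R)%R by [].
pose I : set mR := `[(- L%:R + k%:R / n.+1%:R)%R, (- L%:R + k.+1%:R / n.+1%:R)%R[%classic.
pose W : set mR := `[(- L%:R)%R, L%:R]%classic.
have mI : measurable I by exact: measurable_itv.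
have mW : measurable W by exact: measurable_itv.
have step : (k.+1%:R / n.+1%:R = k%:R / n.+1%:R + n.+1%:R^-1 :> R)%R.
  by rewrite -natr1 mulrDl mul1r.
apply: (@le_trans _ _ (mu ((I `*` W) `*` setT))).
  apply: le_measure; rewrite ?inE.
  - by apply: measurableI; [exact: measurable_slab|exact: measurable_strip].
  - by apply: measurableX => //; exact: measurableX.
  move=> [[x t] K] [[[/= _ tL] _] /= hk]; split => //; split => //=.
  rewrite /I/= in_itv/=.
  have -> : (x : R) = (- L%:R + ((x : R) + L%:R) * n.+1%:R / n.+1%:R)%R.
    by rewrite mulfK ?gt_eqF//; lra.
  by rewrite lerD2l ltrD2l ler_pM2r ?ltr_pM2r ?invr_gt0.
rewrite leaf_intensity_setX//; last exact: measurableX.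
rewrite probability_setT mule1 area_setX// lebesgue_window /I lebesgue_measure_itv/=.
rewrite lte_fin step ltrD2l ltrDl invr_gt0 n0 -EFinB -EFinM lee_fin.
by rewrite le_eqVlt; apply/orP; left; apply/eqP; ring.
Qed.

Lemma lee_sub_inv (x C : R) (E : \bar R) : (0 <= C)%R ->
  (forall n : nat, (x - C / n.+1%:R)%:E <= E) -> x%:E <= E.
Proof.
move=> C0 h; apply/lee_addgt0Pr => e e0.
apply: le_trans (leeD2r e%:E (h (Num.truncn (C / e)%R))).
rewrite -EFinD lee_fin -addrA lerDl addrC subr_ge0.
by rewrite ler_pdivrMr// mulrC -ler_pdivrMr//; exact/ltW/truncnS_gt.
Qed.

Lemma expR_lower (a : R) : (0 <= a)%R -> (a - a * a <= 1 - expR (- a))%R.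
Proof.
move=> a0; rewrite expRN.
have a1 : (0 < 1 + a)%R by lra.
have : ((expR a)^-1 <= (1 + a)^-1)%R.
  by rewrite lef_pV2 ?posrE ?expR_gt0// expR_ge1Dx.
suff : ((1 + a)^-1 <= 1 - a + a * a)%R by lra.
rewrite -[X in (X <= _)%R]mul1r ler_pdivrMr//.
have : (0 <= a * a * a)%R by rewrite !mulr_ge0.
lra.
Qed.

(** Half of the independence of the points in $A$ from an event $\Gamma$: on a
    fine partition of $A$ the number of points of a cell is at least the
    indicator of the cell being hit. *)
Lemma palm_lower L A (Gamma : set Omega) : measurable A -> A `<=` slab L ->
  measurable Gamma ->
  (forall B, measurable B -> B `<=` A ->
    P (avoid B `&` Gamma) = (expR (- fine (mu B)))%:E * P Gamma) ->
  mu A * P Gamma <= \sum_(0 <= i <oo) P (leaf i @^-1` A `&` Gamma).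
Proof.
move=> mA AL mG indep.
pose p := fine (P Gamma).
have pE : P Gamma = p%:E by rewrite fineK// fin_num_measure.
have p0 : (0 <= p)%R by exact: fine_ge0.
have A1 := sub_slab_fin mA AL.
pose a := fine (mu A).
have aE : mu A = a%:E by exact: mu_fineK.
have a0 : (0 <= a)%R by exact: fine_ge0.
set E := \sum_(0 <= i <oo) _.
rewrite aE pE -EFinM.
have C0 : (0 <= L.*2%:R * a * p)%R by rewrite !mulr_ge0.
apply: (lee_sub_inv C0) => n.
rewrite (_ : _ / _ = (L.*2%:R / n.+1%:R) * a * p)%R; last by ring.
pose M := (L.*2 * n.+1).+1.
pose Ak k := A `&` strip L n k.
have mAk k : measurable (Ak k) by apply: measurableI => //; exact: measurable_strip.
have AkA k : Ak k `<=` A by exact: subIsetl.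
have tAk : trivIset setT Ak by apply: trivIset_setIl; exact: strip_triv.
have ak1 k : mu (Ak k) < +oo.
  by apply: le_lt_trans A1; apply: le_measure; rewrite ?inE.
pose ak k := fine (mu (Ak k)).
have ak0 k : (0 <= ak k)%R by exact: fine_ge0.
have akE k : mu (Ak k) = (ak k)%:E by exact: mu_fineK.
have ak_small k : (ak k <= L.*2%:R / n.+1%:R)%R.
  rewrite -lee_fin -akE; apply: le_trans (strip_intensity L n k).
  apply: le_measure; rewrite ?inE//; last by apply: setSI.
  by apply: measurableI; [exact: measurable_slab|exact: measurable_strip].
have AU : A = \big[setU/set0]_(k < M) Ak k.
  rewrite -bigcup_mkord -setI_bigcupr; apply/esym/setIidPl.
  by apply: subset_trans AL _; exact: strip_cover.
have suma : (\sum_(k < M) ak k = a)%R.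
  apply: EFin_inj; rewrite -aE AU measure_bigsetU//.
  by rewrite -sumEFin; apply: eq_bigr => k _; exact: (esym (akE k)).
apply: (@le_trans _ _ (\sum_(k < M) ((1 - expR (- ak k)) * p)%:E)).
  rewrite sumEFin lee_fin -suma -mulr_suml -mulrBl ler_wpM2r//.
  rewrite mulr_sumr -sumrB; apply: ler_sum => k _.
  apply: le_trans (expR_lower (ak0 k)); rewrite lerD2l lerN2.
  by rewrite ler_wpM2r.
apply: (@le_trans _ _ (\sum_(k < M) \sum_(0 <= i <oo) P (leaf i @^-1` Ak k `&` Gamma))).
  apply: lee_sum => k _.
  have -> : ((1 - expR (- ak k)) * p)%:E = P (~` avoid (Ak k) `&` Gamma).
    rewrite mulrBl mul1r EFinB EFinM -pE -(indep _ (mAk k) (AkA k)).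
    rewrite [in LHS]setIC [in RHS]setIC -setDE; apply/esym.
    apply: measureD => //; first exact: measurable_avoid.
    by apply: (le_lt_trans (probability_le1 P mG)); exact: ltry.
  have cover : ~` avoid (Ak k) `&` Gamma `<=` \bigcup_i (leaf i @^-1` Ak k `&` Gamma).
    move=> w [/= /existsNP[j /contrapT hj] Gw]; by exists j.
  apply: measure_sigma_subadditive cover.
  - by move=> i; apply: measurableI => //; exact: measurable_preimage_leaf.
  - by apply: measurableI => //; apply: measurableC; exact: measurable_avoid.
rewrite -nneseries_sum//; apply: lee_nneseries => i _.
  by move=> _; exact: sume_ge0.
pose F k := leaf i @^-1` Ak k `&` Gamma.
have mF k : measurable (F k).
  by apply: measurableI => //; exact: measurable_preimage_leaf.
have tF : trivIset setT F.
  by move=> k l _ _ [w [[kw _] [lw _]]]; apply: (tAk k l) => //; exists (leaf i w).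
have FU : P (\big[setU/set0]_(k < M) F k) = \sum_(k < M) P (F k) by exact: measure_bigsetU.
rewrite -[X in X <= _]FU.
apply: le_measure; rewrite ?inE//.
- exact: bigsetU_measurable.
- by apply: measurableI => //; exact: measurable_preimage_leaf.
- by rewrite -bigcup_mkord => w [k _ [[Aw _] Gw]].
Qed.

(** The points in $A$ are independent of an event $\Gamma$ which is independent
    of the void events of the subsets of $A$: the lower bound holds for $\Gamma$
    and for its complement, and the two bounds add up to the intensity. *)
Lemma palm L A (Gamma : set Omega) : measurable A -> A `<=` slab L ->
  measurable Gamma ->
  (forall B, measurable B -> B `<=` A ->
    P (avoid B `&` Gamma) = (expR (- fine (mu B)))%:E * P Gamma) ->
  \sum_(0 <= i <oo) P (leaf i @^-1` A `&` Gamma) = mu A * P Gamma.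
Proof.
move=> mA AL mG indep.
have A1 := sub_slab_fin mA AL.
have low := palm_lower mA AL mG indep.
have mCG : measurable (~` Gamma) by exact: measurableC.
have lowC := palm_lower mA AL mCG.
have indepC B : measurable B -> B `<=` A ->
    P (avoid B `&` ~` Gamma) = (expR (- fine (mu B)))%:E * P (~` Gamma).
  move=> mB BA; have B1 := sub_slab_fin mB (subset_trans BA AL).
  rewrite -setDE measureD//; [|exact: measurable_avoid|]; last first.
    by apply: (@le_lt_trans _ _ 1); [exact/probability_le1/measurable_avoid|exact: ltry].
  rewrite [X in X - _](avoid_prob mB B1) [X in _ - X](indep _ mB BA).
  rewrite probability_setC// muleBr ?mule1//.
move: {lowC} (lowC indepC) => lowC.
set E := \sum_(0 <= i <oo) _; set E' := \sum_(0 <= i <oo) _ in lowC.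
have EE' : E + E' = mu A.
  rewrite -campbell// -nneseriesD//.
  apply: eq_eseriesr => i _; rewrite -setDE.
  by rewrite [RHS](measureDI P _ mG) 1?addeC//; exact: measurable_preimage_leaf.
have E0 : 0 <= E by exact: nneseries_ge0.
have E'0 : 0 <= E' by exact: nneseries_ge0.
have Efin : E \is a fin_num.
  by rewrite ge0_fin_numE// (le_lt_trans _ A1)// -EE' leeDl.
have E'fin : E' \is a fin_num.
  by rewrite ge0_fin_numE// (le_lt_trans _ A1)// -EE' leeDr.
apply/eqP; rewrite eq_le low andbT.
have Gfin : P Gamma \is a fin_num by exact: fin_num_measure.
move: low lowC EE'; rewrite probability_setC//.
rewrite -(fineK Efin) -(fineK E'fin) -(fineK Gfin) (mu_fineK A1).
move: (fine E) (fine E') (fine (P Gamma)) (fine (mu A)) => e e' g m.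
rewrite -EFinB -!EFinM -EFinD !lee_fin => h1 h2 [h3]; nra.
Qed.

Definition avoid_after (E : set (X * X)) i : set Omega :=
  [set w | forall j, ~ E (leaf i w, leaf j w)].

Lemma measurable_avoid_after E i : measurable E -> measurable (avoid_after E i).
Proof.
move=> mE; rewrite (_ : avoid_after E i =
    \bigcap_j ~` ((fun w => (leaf i w, leaf j w)) @^-1` E)).
  apply: bigcapT_measurable => j; apply: measurableC.
  rewrite -[X in measurable X]setTI.
  have mp : measurable_fun setT (fun w => (leaf i w, leaf j w)).
    by apply: measurable_fun_pair; exact: (measurable_leaf mz mS).
  exact: mp.
by apply/seteqP; split => w h j; [move=> _|]; exact: h.
Qed.

(** By [avoid_prob] this is the probability that no leaf lies in the section of $E$
    at $x$. *)
Definition void_weight (E : set (X * X)) (x : X) : \bar R :=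
  (expR (- fine (mu (xsection E x))))%:E.

Lemma measurable_void_weight E : measurable E -> measurable_fun setT (void_weight E).
Proof.
move=> mE; apply/measurable_EFinP.
apply: (measurableT_comp (@measurable_expR R)).
apply: measurable_funN.
apply: (measurableT_comp (fine_measurable measurableT)).
exact: (measurable_fun_xsection mu mE).
Qed.

Lemma eq_void_weight E E' x : (forall y, E (x, y) <-> E' (x, y)) ->
  void_weight E x = void_weight E' x.
Proof.
move=> EE'; rewrite /void_weight (_ : xsection E x = xsection E' x)//.
by apply/seteqP; split => y /xsectionP/EE' h; apply/xsectionP.
Qed.

Section rectangles.
Variables (L : nat) (A D : nat -> set X).
Hypotheses (mA : forall q, measurable (A q)) (mD : forall q, measurable (D q)).
Hypothesis AD : forall q, A q `&` D q = set0.
Hypothesis D1 : forall q, mu (D q) < +oo.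

Let E n D0 : set (X * X) := (setT `*` D0) `|` \bigcup_(q in `I_n) (A q `*` D q).

Let mE n D0 : measurable D0 -> measurable (E n D0).
Proof.
move=> mD0; apply: measurableU; first exact: measurableX.
by apply: fin_bigcup_measurable => // q _; exact: measurableX.
Qed.

(** By induction on the number of rectangles: the set $H$ is split according to
    $A_n$, and on each part the $n$-th rectangle either joins $D_0$ or drops out.
    Since $A_n\cap D_n=\emptyset$ the sets $H$ and $D_0$ stay disjoint, so that
    the leaves in $H$ are independent of the event that $D_0$ is void. *)
Let palm_finite n H D0 : measurable H -> H `<=` slab L -> measurable D0 ->
  mu D0 < +oo -> H `&` D0 = set0 ->
  \sum_(0 <= i <oo) P (leaf i @^-1` H `&` avoid_after (E n D0) i) =
  \int[mu]_(x in H) void_weight (E n D0) x.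
Proof.
elim: n H D0 => [|n IH] H D0 mH HL mD0 D01 HD0.
  have E0 : E 0 D0 = setT `*` D0 by rewrite /E bigcup0 ?setU0// => q.
  rewrite E0 (_ : \int[mu]_(x in H) _ = mu H * P (avoid D0)).
    rewrite -(palm mH HL (measurable_avoid mD0)).
      apply: eq_eseriesr => i _; congr (P (_ `&` _)).
      by apply/seteqP; split => w h j hj; [apply: (h j)|apply: (h j); case: hj].
    move=> B mB BH; have B1 := sub_slab_fin mB (subset_trans BH HL).
    rewrite -avoidU avoid_prob//; last 2 first.
    - exact: measurableU.
    - apply: (le_lt_trans (measureU2 _ mB mD0)).
      by rewrite lte_add_pinfty.
    have BD0 : B `&` D0 = set0 by rewrite -subset0 -HD0; exact: setSI.
    rewrite [mu _](measureU _ mB mD0 BD0) (avoid_prob mD0 D01) -EFinM -expRD -opprD fineD//.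
    - by rewrite ge0_fin_numE.
    - by rewrite ge0_fin_numE.
  rewrite (avoid_prob mD0 D01) muleC.
  transitivity (\int[mu]_(x in H) (cst (expR (- fine (mu D0)))%:E) x); last exact: integral_cst.
  apply: eq_integral => x _.
  rewrite /void_weight (_ : xsection _ x = D0)//.
  by apply/seteqP; split => [y|y Dy]; rewrite /xsection/= inE // => -[].
have H12 : H = (H `&` A n) `|` (H `\` A n) by rewrite setUIDK.
have mH1 : measurable (H `&` A n) by exact: measurableI.
have mH2 : measurable (H `\` A n) by exact: measurableD.
have mDD : measurable (D0 `|` D n) by exact: measurableU.
have DD1 : mu (D0 `|` D n) < +oo.
  apply: le_lt_trans (measureU2 _ mD0 (mD n)) _.
  by rewrite lte_add_pinfty.
have in1 x y : A n x -> E n.+1 D0 (x, y) <-> E n (D0 `|` D n) (x, y).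
  move=> Ax; split.
    move=> [[_ y0]|[q /= qn [Aq Dq]]]; first by left; split => //; left.
    move: qn; rewrite ltnS leq_eqVlt => /orP[/eqP qn|qn].
      by left; split => //=; right; rewrite -qn.
    by right; exists q.
  move=> [[_ /= [y0|Dy]]|[q /= qn Dq]]; first by left.
    by right; exists n => //=; split.
  by right; exists q => //=; exact: ltnW.
have in2 x y : ~ A n x -> E n.+1 D0 (x, y) <-> E n D0 (x, y).
  move=> nAx; split.
    move=> [[_ y0]|[q /= qn [/= Aq Dq]]]; first by left.
    move: qn; rewrite ltnS leq_eqVlt => /orP[/eqP qn|qn]; last by right; exists q.
    by case: nAx; rewrite -qn.
  by move=> [[_ /= y0]|[q /= qn Dq]]; [left|right; exists q => //=; exact: ltnW].
transitivity (\sum_(0 <= i <oo) (P (leaf i @^-1` (H `&` A n) `&` avoid_after (E n (D0 `|` D n)) i) +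
    P (leaf i @^-1` (H `\` A n) `&` avoid_after (E n D0) i))).
  apply: eq_eseriesr => i _; rewrite -measureU//.
  - congr (P _); apply/seteqP; split => w.
      move=> [Hw Ew]; have [Aw|nAw] := pselect (A n (leaf i w)); [left|right].
        by split => // j /(in1 _ _ Aw); exact: Ew.
      by split => // j /(in2 _ _ nAw); exact: Ew.
    move=> [[[Hw Aw] Ew]|[[Hw nAw] Ew]]; split => // j.
      by move/(in1 _ _ Aw); exact: Ew.
    by move/(in2 _ _ nAw); exact: Ew.
  - apply: measurableI; first exact: measurable_preimage_leaf.
    by apply: measurable_avoid_after; exact: mE.
  - apply: measurableI; first exact: measurable_preimage_leaf.
    by apply: measurable_avoid_after; exact: mE.
  - by rewrite -subset0 => w [[[_ Aw] _] [[_ nAw] _]].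
rewrite nneseriesD// IH//; last 2 first.
- by apply: subset_trans HL; exact: subIsetl.
- rewrite setIUr setIAC HD0 set0I set0U -setIA AD setI0//.
rewrite IH//; last 2 first.
- by apply: subset_trans HL; exact: subDsetl.
- by rewrite setDE setIAC HD0 set0I.
have mw : measurable_fun setT (void_weight (E n.+1 D0)).
  by apply: measurable_void_weight; exact: mE.
have w0 x : 0 <= void_weight (E n.+1 D0) x by rewrite lee_fin expR_ge0.
have h1 x : A n x -> void_weight (E n.+1 D0) x = void_weight (E n (D0 `|` D n)) x.
  by move=> Ax; apply: eq_void_weight => y; exact: in1.
have h2 x : ~ A n x -> void_weight (E n.+1 D0) x = void_weight (E n D0) x.
  by move=> Ax; apply: eq_void_weight => y; exact: in2.
have HH : [disjoint (H `&` A n) & (H `\` A n)].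
  by rewrite disj_set2E; apply/eqP; rewrite -subset0 => x [[_ Ax] [_ nAx]].
move: mw w0 h1 h2; move: (void_weight (E n.+1 D0))
  (void_weight (E n (D0 `|` D n))) (void_weight (E n D0)) => f g h mf f0 fg fh.
rewrite [in RHS]H12 [RHS](ge0_integral_setU mu mH1 mH2 _ _ HH)//.
  congr (_ + _).
    by apply: eq_integral => x /set_mem[_ Ax]; rewrite fg.
  by apply: eq_integral => x /set_mem[_ Ax]; rewrite fh.
exact: measurable_funTS.
Qed.

(** The instance of the Mecke equation for the event that no leaf lies in the
    section at $x$. It passes from finitely many rectangles to countably many by
    continuity from above on the left, for a measure on pairs of an index and an
    outcome, and by dominated convergence on the right. *)
Lemma palm_sections H : measurable H -> H `<=` slab L ->
  (forall x, H x -> mu (xsection (\bigcup_q (A q `*` D q)) x) < +oo) ->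
  \sum_(0 <= i <oo)
    P (leaf i @^-1` H `&` avoid_after (\bigcup_q (A q `*` D q)) i) =
  \int[mu]_(x in H) void_weight (\bigcup_q (A q `*` D q)) x.
Proof.
move=> mH HL Hfin; have H1 := sub_slab_fin mH HL.
set Eoo := \bigcup_q (A q `*` D q).
pose En n := E n set0.
have mEn n : measurable (En n) by exact: mE.
have mEoo : measurable Eoo by apply: bigcupT_measurable => q; exact: measurableX.
have EnP n x y : En n (x, y) <-> exists2 q, (q < n)%N & A q x /\ D q y.
  by split=> [[[]//|[q qn ?]]|[q qn ?]]; [exists q|right; exists q].
have En_nd m n : (m <= n)%N -> En m `<=` En n.
  by move=> mn [x y] /EnP[q qm Aq]; apply/EnP; exists q => //; exact: leq_trans mn.
have EnU : \bigcup_n En n = Eoo.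
  apply/seteqP; split => [[x y] [n _ /EnP[q _ Aq]]|[x y] [q _ Aq]]; first by exists q.
  by exists q.+1 => //; apply/EnP; exists q.
have fin n : \sum_(0 <= i <oo) P (leaf i @^-1` H `&` avoid_after (En n) i) =
    \int[mu]_(x in H) void_weight (En n) x.
  by apply: palm_finite => //; rewrite ?measure0 ?setI0.
have mpair i : measurable_fun setT (fun w : Omega => (i, w) : nat * Omega).
  by apply: measurable_fun_pair => //; exact: measurable_cst.
pose m := mseries (fun i => image_measure P (mpair i)) 0.
pose G (F : set (X * X)) : set (nat * Omega) :=
  [set iw | (leaf iw.1 @^-1` H `&` avoid_after F iw.1) iw.2].
have mGF F : m (G F) = \sum_(0 <= i <oo) P (leaf i @^-1` H `&` avoid_after F i) by [].
have mG F : measurable F -> measurable (G F).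
  move=> mF; rewrite (_ : G F = \bigcup_i ([set i] `*` (leaf i @^-1` H `&` avoid_after F i))).
    apply: bigcupT_measurable => i; apply: measurableX => //.
    apply: measurableI; first exact: measurable_preimage_leaf.
    exact: measurable_avoid_after.
  by apply/seteqP; split => [[i w] h|[_ w] [i _ [/= -> h]]//]; exists i.
have cl : m (G (En n)) @[n --> \oo] --> m (G Eoo).
  rewrite (_ : G Eoo = \bigcap_n G (En n)).
    apply: (@nonincreasing_cvg_mu _ _ _ m (fun n => G (En n))) => //.
    - apply: le_lt_trans H1; rewrite -campbell//.
      change (\sum_(0 <= i <oo) P (leaf i @^-1` H `&` avoid_after (En 0%N) i) <=
        \sum_(0 <= i <oo) P (leaf i @^-1` H)).
      apply: lee_nneseries => // i _; apply: le_measure; rewrite ?inE.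
      + by apply: measurableI; [exact: measurable_preimage_leaf|exact: measurable_avoid_after].
      + exact: measurable_preimage_leaf.
      + exact: subIsetl.
    - by move=> n; exact: mG.
    - by apply: bigcapT_measurable => n; exact: mG.
    - move=> k l kl; apply/subsetPset => -[i w] [Hw h]; split => // j /(En_nd _ _ kl).
      exact: h.
  apply/seteqP; split => -[i w].
    by move=> [Hw h] n _; split => // j hj; apply: (h j); rewrite -EnU; exists n.
  move=> h; split; first by have [] := h 0%N Logic.I.
  by move=> j /=; rewrite -EnU => -[n _ hj]; have [_ /(_ j)] := h n Logic.I.
have cr : \int[mu]_(x in H) void_weight (En n) x @[n --> \oo] -->
    \int[mu]_(x in H) void_weight Eoo x.
  apply: (@dominated_cvg _ _ _ mu H mH _ _ (cst 1)) => //.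
  - by move=> n; apply: measurable_funTS; exact: measurable_void_weight.
  - move=> x Hx; apply/cvg_EFin; first by near=> n.
    apply: continuous_cvg; first exact: continuous_expR.
    apply: cvgN; apply: fine_cvg.
    rewrite fineK; last by rewrite ge0_fin_numE//; exact: Hfin.
    have -> : xsection Eoo x = \bigcup_n xsection (En n) x.
      by rewrite -xsection_bigcup EnU.
    apply: (@nondecreasing_cvg_mu _ _ _ mu (fun n => xsection (En n) x)).
    + by move=> n; exact: measurable_xsection.
    + by apply: bigcupT_measurable => n; exact: measurable_xsection.
    + move=> k l kl; apply/subsetPset => y; rewrite /xsection/= !inE.
      exact: En_nd.
  - apply/integrableP; split; first exact: measurable_cst.
    under eq_integral do rewrite abse1.
    by rewrite integral_cst// mul1e.
  - move=> n x _; rewrite gee0_abs ?lee_fin ?expR_ge0//.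
    by rewrite -[leRHS](@expR0 R) ler_expR lerNl oppr0 fine_ge0.
rewrite -mGF -(cvg_lim (@ereal_hausdorff R) cl) -(cvg_lim (@ereal_hausdorff R) cr).
suff -> : (fun n => m (G (En n))) = (fun n => \int[mu]_(x in H) void_weight (En n) x) by [].
by apply/funext => n; rewrite mGF fin.
Unshelve. all: by end_near. Qed.

End rectangles.

End marked_poisson.

(** * Translations of the line and size of the grains *)

Section translations.
Context {R : realType}.
Local Notation mR := (measurableTypeR R).
Local Notation leb := (@lebesgue_measure R).
Implicit Types A : set mR.

Lemma measurable_translation (b : R) :
  measurable_fun [set: mR] ((fun x => (x : R) + b) : mR -> mR).
Proof.
have h : @measurable_fun _ _ R R setT (id \+ cst b) by apply: measurable_funD.
by move=> _ B mB; exact: (h measurableT B mB).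
Qed.

Lemma measurable_translated b A :
  measurable A -> measurable [set x : mR | A ((x : R) + b)%R].
Proof.
by move=> mA; rewrite -[X in measurable X]setTI; exact: measurable_translation.
Qed.

Lemma lebesgue_translation b A :
  measurable A -> leb [set x : mR | A ((x : R) + b)%R] = leb A.
Proof.
move=> mA; pose m := image_measure leb (measurable_translation b).
apply/esym; apply: (lebesgue_measure_unique (mu := m)) => // _ [[u v] _ <-].
rewrite [RHS](_ : _ = leb `](u - b), (v - b)]).
  rewrite [LHS]lebesgue_measure_itv [RHS]lebesgue_measure_itv/=.
  rewrite !lte_fin ltrD2r; case: ifP => // _.
  by rewrite -!EFinB; congr EFin; ring.
congr (leb _); apply/seteqP; split => x /=; rewrite !in_itv/=.
  by rewrite ltrBlDr lerBrDr.
by rewrite ltrBlDr lerBrDr.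
Qed.

Lemma measurable_reflection (b : R) :
  measurable_fun [set: mR] ((fun x => b - (x : R)) : mR -> mR).
Proof.
have h : @measurable_fun _ _ R R setT (cst b \- id) by apply: measurable_funB.
by move=> _ B mB; exact: (h measurableT B mB).
Qed.

Lemma lebesgue_reflection b A :
  measurable A -> leb [set x : mR | A (b - (x : R))%R] = leb A.
Proof.
move=> mA; have mAb := measurable_translated b mA.
rewrite -[RHS](lebesgue_translation b mA) -[RHS](lebesgue_measureN mAb).
by congr (leb _); apply/seteqP; split => x /=; rewrite addrC.
Qed.

End translations.

Section compact_set_size.
Context {R : realType}.
Local Notation mR := (measurableTypeR R).
Local Notation C := (compact_set R).
Local Notation leb := (@lebesgue_measure R).
Implicit Types K : C.

Lemma compact_set_measurable K : measurable (K : set mR).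
Proof. by apply: closed_measurable; exact: compact_set_closed. Qed.

Lemma radius_has_sup K : (K : set R) !=set0 -> has_sup [set `|x| | x in (K : set R)].
Proof.
move=> [x0 Kx0]; split; first by exists `|x0|; exists x0.
have [M [_ hM]] := compact_bounded (@compact_set_compact R K).
by exists (M + 1) => _ [x Kx <-]; apply: hM => //; rewrite ltrDl.
Qed.

Lemma norm_le_radius K x : (K : set R) x -> `|x| <= Defs.radius K.
Proof.
move=> Kx; apply: ub_le_sup; last by exists x.
by have [] : has_sup [set `|x| | x in (K : set R)] by apply: radius_has_sup; exists x.
Qed.

Lemma radius_ge0 K : 0 <= Defs.radius K.
Proof.
have [[x Kx]|K0] := pselect ((K : set R) !=set0).
  by apply: le_trans (norm_le_radius Kx).
rewrite /Defs.radius (_ : [set `|x| | x in (K : set R)] = set0) ?sup0//.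
by apply/seteqP; split => // r [x Kx _]; apply: K0; exists x.
Qed.

Lemma measurable_radius : measurable_fun setT (Defs.radius : C -> R).
Proof.
apply: (measurability _ (RGenOInfty.measurableE R)) => _ [_ [a ->] <-]; rewrite setTI.
have [a0|a0] := ltP a 0.
  rewrite (_ : _ @^-1` _ = setT)//; apply/seteqP; split => // K _ /=.
  by rewrite in_itv/= andbT; exact: lt_le_trans a0 (radius_ge0 K).
pose G : set R := [set x | a < `|x|].
have oG : open G.
  rewrite (_ : G = (fun x : R => `|x|) @^-1` `]a, +oo[%classic).
    by apply: open_comp; [move=> x _; exact: norm_continuous|exact: interval_open].
  by apply/seteqP; split => x /=; rewrite in_itv/= andbT.
rewrite (_ : _ @^-1` _ = [set K : C | (K : set R) `&` G !=set0]); first exact: measurable_hits.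
apply/seteqP; split => K /=; rewrite in_itv/= andbT.
  move=> aK; have K0 : (K : set R) !=set0.
    apply: contrapT => K0; move: aK; rewrite /Defs.radius.
    rewrite (_ : [set `|x| | x in (K : set R)] = set0) ?sup0 ?ltNge ?a0//.
    by apply/seteqP; split => // r [x Kx _]; apply: K0; exists x.
  have [|_ [x Kx <-] ax] := sup_gt _ aK; first by have [x Kx] := K0; exists `|x|; exists x.
  by exists x.
by move=> [x [Kx ax]]; apply: lt_le_trans ax (norm_le_radius Kx).
Qed.

Lemma length_le_radius K : (leb (K : set mR) <= (2 * Defs.radius K)%:E)%E.
Proof.
have -> : ((2 * Defs.radius K)%:E = leb `[(- Defs.radius K)%R, Defs.radius K])%E.
  rewrite lebesgue_measure_itv/= lte_fin.
  have := radius_ge0 K; rewrite le_eqVlt => /orP[/eqP <-|r0].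
    by rewrite oppr0 ltxx mulr0.
  by rewrite gtrN// -EFinB; congr EFin; ring.
apply: le_measure; rewrite ?inE.
- exact: compact_set_measurable.
- exact: measurable_itv.
- by move=> x Kx /=; rewrite in_itv/= -ler_norml; exact: norm_le_radius.
Qed.

Lemma measurable_ysection_length (G : set (mR * C)) : measurable G ->
  measurable_fun setT (fun K => leb (ysection G K)).
Proof. by move=> mG; exact: (measurable_fun_ysection leb). Qed.

Lemma ysection_mem K : ysection [set p : mR * C | (p.2 : set R) p.1] K = K.
Proof. by apply/seteqP; split => y; rewrite /ysection/= inE. Qed.

Lemma ysection_interior K : ysection [set p : mR * C | (p.2 : set R)° p.1] K = K°.
Proof. by apply/seteqP; split => y; rewrite /ysection/= inE. Qed.

Lemma measurable_length : measurable_fun setT (fun K : C => leb (K : set mR)).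
Proof.
have := measurable_ysection_length (@measurable_mem R).
by under eq_fun do rewrite ysection_mem.
Qed.

Lemma measurable_interior_length : measurable_fun setT (fun K : C => leb (K° : set mR)).
Proof.
have := measurable_ysection_length (@measurable_mem_interior R).
by under eq_fun do rewrite ysection_interior.
Qed.

Lemma interior_length_gt0 K : K° !=set0 -> (0 < leb (K° : set mR))%E.
Proof.
move=> [y Ky]; have [n [ny nK]] := rat_itv_nbhs (open_nbhs_nbhs (conj (@open_interior _ _) Ky)).
have mI : measurable (K° : set mR) by apply: open_measurable; exact: open_interior.
apply: (@lt_le_trans _ _ (leb (rat_itv n))); last first.
  by apply: le_measure; rewrite ?inE//; exact: rat_itv_measurable.
move: ny; rewrite /rat_itv; case: choice.unpickle => //= -[a b] /=.
rewrite in_itv/= => /andP[ay yb].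
by rewrite lebesgue_measure_itv/= lte_fin (lt_trans ay yb) -EFinB lte_fin subr_gt0 (lt_trans ay yb).
Qed.

End compact_set_size.

(** * Edges of the leaves and the leaves that cover them *)

Section edges.
Context {R : realType}.
Local Notation mR := (measurableTypeR R).
Local Notation C := (compact_set R).
Local Notation X := ((mR * mR) * C)%type.
Local Notation leb := (@lebesgue_measure R).
Implicit Types (x : X) (B : set mR).

Definition edge_pt (m : nat) x : R := (boundary_pt m x.2 : R) + x.1.1.

Definition edge_in (m : nat) B : set X :=
  [set x | [/\ (0 <= (x.1.2 : R)), boundary_new m x.2 & B (edge_pt m x)]].

Definition covers (m : nat) : set (X * X) :=
  [set u : X * X | (0 <= (u.2.1.2 : R) < u.1.1.2) /\
           (u.2.2 : set R)° (edge_pt m u.1 - u.2.1.1)].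

(** A leaf $x'$ covers an edge of $x$ before $x$ arrives if some rational interval
    around the edge is contained in $x'$ and some rational time separates the two
    arrivals. A natural number codes the interval and the time. The leaf $x$ is
    in [edge_cell], the leaf $x'$ in [cell_cover]; the time makes these two sets
    disjoint, and the interval is required to be nonempty because any leaf
    contains the empty one, which would make the intensity infinite. *)
Definition edge_cell (m q : nat) : set X :=
  if choice.unpickle q is Some (n, s) then
    [set x | rat_itv n (edge_pt m x) /\ ratr s < (x.1.2 : R)]
  else set0.

Definition cell_cover (q : nat) : set X :=
  if choice.unpickle q is Some (n, s) then
    [set x : X | [/\ (0 <= (x.1.2 : R) <= ratr s), (@rat_itv R n !=set0) &
      (forall y, rat_itv n y -> (x.2 : set R) (y - x.1.1))]]
  else set0.

Lemma coversE m : covers m = \bigcup_q (edge_cell m q `*` cell_cover q).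
Proof.
apply/seteqP; split => [[x x'] [/= /andP[t0 tt']]|[x x'] [q _]].
  set y := edge_pt m x => Ky.
  have [s] := rat_in_itvoo tt'; rewrite in_itv/= => /andP[ts st].
  have : nbhs y [set u | (x'.2 : set R) (u - x'.1.1)].
    have : (fun u : R => u - x'.1.1) @ y --> y - (x'.1.1 : R).
      by apply: cvgB; [exact: cvg_id|exact: cvg_cst].
    exact.
  move=> /rat_itv_nbhs[n [ny nK]].
  exists (choice.pickle (n, s)) => //; split; rewrite /edge_cell /cell_cover choice.pickleK//=.
  by split => //; [rewrite t0 ltW|exists y].
rewrite /edge_cell /cell_cover; case: choice.unpickle => [[n s]|[]//].
move=> [/= [ny st] [/andP[t0 ts] _ nK]]; split => /=.
  by rewrite t0 (le_lt_trans ts).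
have : nbhs (edge_pt m x - x'.1.1) [set u | rat_itv n (u + x'.1.1)].
  have : (fun u : R => u + x'.1.1) @ (edge_pt m x - x'.1.1) --> edge_pt m x - x'.1.1 + (x'.1.1 : R).
    by apply: cvgD; [exact: cvg_id|exact: cvg_cst].
  apply; rewrite subrK; apply: open_nbhs_nbhs; split => //; exact: rat_itv_open.
by apply: filterS => u /nK; rewrite addrK.
Qed.

Lemma edge_cell_cover_disj m q : edge_cell m q `&` cell_cover q = set0.
Proof.
rewrite /edge_cell /cell_cover; case: choice.unpickle => [[n s]|]; last by rewrite setI0.
rewrite -subset0 => x [[_ st] [/andP[_ ts] _ _]].
by move: (lt_le_trans st ts); rewrite ltxx.
Qed.

Let measurable_place : measurable_fun setT (fun x : X => x.1.1 : R).
Proof. exact: (measurableT_comp measurable_fst measurable_fst). Qed.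

Let measurable_time : measurable_fun setT (fun x : X => x.1.2 : R).
Proof. exact: (measurableT_comp measurable_snd measurable_fst). Qed.

Lemma measurable_edge_pt m : measurable_fun setT (edge_pt m : X -> R).
Proof.
apply: measurable_funD => //.
exact: (measurableT_comp (@measurable_boundary_pt R m) measurable_snd).
Qed.

Lemma measurable_edge_in m B : measurable B -> measurable (edge_in m B).
Proof.
move=> mB; rewrite (_ : edge_in m B =
    ((fun x : X => x.1.2 : R) @^-1` `[0, +oo[%classic) `&`
    (snd @^-1` boundary_new m) `&` ((edge_pt m : X -> mR) @^-1` B)).
  apply: measurableI; first apply: measurableI.
  - by rewrite -[X in measurable X]setTI; apply: measurable_time => //; exact: measurable_itv.
  - by rewrite -[X in measurable X]setTI; apply: measurable_snd => //; exact: measurable_boundary_new.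
  - by rewrite -[X in measurable X]setTI; exact: measurable_edge_pt.
by apply/seteqP; split => x /=; rewrite in_itv/= andbT; [case|case=> -[]].
Qed.

Lemma measurable_edge_cell m q : measurable (edge_cell m q).
Proof.
rewrite /edge_cell; case: choice.unpickle => [[n s]|//].
rewrite (_ : [set _ | _] = ((edge_pt m : X -> mR) @^-1` rat_itv n) `&`
    ((fun x : X => x.1.2 : R) @^-1` `](ratr s), +oo[%classic)).
  apply: measurableI; rewrite -[X in measurable X]setTI.
    by apply: measurable_edge_pt => //; exact: rat_itv_measurable.
  by apply: measurable_time => //; exact: measurable_itv.
by apply/seteqP; split => x /=; rewrite in_itv/= andbT.
Qed.

(** The position of the point $b$ relative to the grain of the leaf. *)
Let shifted (b : R) x : mR * C := (b - (x.1.1 : R), x.2).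

Let measurable_shifted b : measurable_fun setT (shifted b).
Proof.
apply: measurable_fun_pair; last exact: measurable_snd.
exact: (measurableT_comp (measurable_reflection b)).
Qed.

Lemma measurable_hitting (b : R) (J : set mR) (G : set (mR * C)) :
  measurable J -> measurable G ->
  measurable [set x : X | J x.1.2 /\ G (b - (x.1.1 : R), x.2)].
Proof.
move=> mJ mG; apply: measurableI.
  by rewrite -[X in measurable X]setTI; apply: measurable_time.
by rewrite -[X in measurable X]setTI; exact: (measurable_shifted b).
Qed.

(** A closed set contains an open interval as soon as it contains the rational
    points of the interval. *)
Lemma measurable_cell_cover q : measurable (cell_cover q).
Proof.
rewrite /cell_cover; case: choice.unpickle => [[n s]|//].
have [n0|n0] := pselect (@rat_itv R n !=set0); last first.
  rewrite (_ : [set _ | _] = set0)//.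
  by apply/seteqP; split => // x [].
rewrite (_ : [set _ | _] = \bigcap_(r : rat) [set x : X | (`[0, ratr s]%classic : set mR) x.1.2 /\
   ([set p : mR * C | (p.2 : set R) p.1] `|` [set p | ~ rat_itv n (ratr r : R)])
     ((ratr r : R) - (x.1.1 : R), x.2)]).
  rewrite -[X in measurable X]setCK setC_bigcap; apply: measurableC.
  apply: bigcupT_measurable_rat => r; apply: measurableC; apply: measurable_hitting.
    exact: measurable_itv.
  apply: measurableU; first exact: measurable_mem.
  have [nr|nr] := pselect (rat_itv n (ratr r : R)).
    by rewrite (_ : [set _ | _] = set0)//; apply/seteqP; split.
  by rewrite (_ : [set _ | _] = setT)//; apply/seteqP; split.
apply/seteqP; split => x.
  move=> [t0s _ nK] r _ /=; rewrite in_itv/=; split => //.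
  by have [/nK|] := pselect (rat_itv n (ratr r : R)); [left|right].
move=> h; have := h 0 Logic.I; rewrite /= in_itv/= => -[t0s _].
split => // y ny; apply: contrapT => nKy.
have : nbhs y (rat_itv n `&` [set u | ~ (x.2 : set R) (u - x.1.1)]).
  apply: filterI; first by apply: open_nbhs_nbhs; split => //; exact: rat_itv_open.
  have : (fun u : R => u - x.1.1) @ y --> y - (x.1.1 : R).
    by apply: cvgB; [exact: cvg_id|exact: cvg_cst].
  move/(_ (~` (x.2 : set R))); apply; apply: open_nbhs_nbhs; split => //.
  by rewrite openC; exact: compact_set_closed.
rewrite nbhs_ballP => -[e /= e0 he].
have : y - e < y + e by rewrite ltrBlDr -addrA ltrDl addr_gt0.
move=> /rat_in_itvoo[r]; rewrite in_itv/= => /andP[yr ry].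
have [nr nKr] : (rat_itv n `&` [set u | ~ (x.2 : set R) (u - x.1.1)]) (ratr r).
  by apply: he; rewrite /ball/= distrC ltr_distl yr ry.
by have [_ [|]] := h r Logic.I.
Qed.

Lemma measurable_covers m : measurable (covers m).
Proof.
rewrite coversE; apply: bigcupT_measurable => q; apply: measurableX.
  exact: measurable_edge_cell.
exact: measurable_cell_cover.
Qed.

End edges.

(** * Mean number of visible edges *)

Section grain_lengths.
Context {R : realType} (Q : probability (compact_set R) R).
Local Notation mR := (measurableTypeR R).
Local Notation C := (compact_set R).
Local Notation X := ((mR * mR) * C)%type.
Local Notation leb := (@lebesgue_measure R).
Local Notation mu := (leaf_intensity Q).
Local Open Scope ereal_scope.

(** Fubini, with the grain integrated last: for a fixed grain the places of the
    leaf form a reflected translate of the section of $G$. *)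
Lemma hitting_intensity (b : R) (J : set mR) (G : set (mR * C)) :
  measurable J -> measurable G ->
  mu [set x : X | J x.1.2 /\ G ((b - (x.1.1 : R))%R, x.2)] =
  leb J * \int[Q]_K leb (ysection G K).
Proof.
move=> mJ mG; set D := [set x | _].
have mD : measurable D by exact: measurable_hitting.
have -> : mu D = (@area R \x^ Q) D.
  apply: (@product_measure_unique _ _ _ _ _ (@area R) Q (@area R \x^ Q)) => // A B mA mB.
  exact: product_measure2E.
transitivity (\int[Q]_K (leb J * leb (ysection G K))).
  apply: eq_integral => K _ /=.
  have mGK : measurable (ysection G K) by exact: measurable_ysection.
  rewrite (_ : ysection D K = [set y : mR | ysection G K (b - (y : R))%R] `*` J).
    rewrite area_setX//; first by rewrite lebesgue_reflection// muleC.
    by rewrite -[X in measurable X]setTI; exact: measurable_reflection.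
  by apply/seteqP; split => -[y t]; rewrite /ysection/= !inE => -[].
rewrite ge0_integralZl//; last exact: measurable_ysection_length.
Qed.

Hypothesis radius_integrable : mean_radius Q < +oo.
Hypothesis boundary_integrable : mean_boundary_count Q < +oo.

Lemma mean_length_fin : mean_length Q < +oo.
Proof.
apply: (@le_lt_trans _ _ (\int[Q]_K (2%:E * (Defs.radius K)%:E))).
  apply: ge0_le_integral => //.
  - exact: measurable_length.
  - apply: measurable_funeM; apply/measurable_EFinP; exact: measurable_radius.
  - by move=> K _; rewrite -EFinM; exact: length_le_radius.
rewrite ge0_integralZl//.
- by rewrite lte_mul_pinfty.
- by apply/measurable_EFinP; exact: measurable_radius.
- by move=> K _; rewrite lee_fin radius_ge0.
Qed.

Lemma ae_finite_boundary : {ae Q, forall K : C, finite_set (boundary (K : set R))}.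
Proof.
have : Q.-integrable setT (fun K : C => counting (boundary (K : set R)) : \bar R).
  apply/integrableP; split; first exact: measurable_counting_boundary.
  by under eq_integral do rewrite gee0_abs//.
move=> /(integrable_ae measurableT); apply: filterS => K /(_ Logic.I).
rewrite /counting; case: asboolP => //.
Qed.

(** The boundary is almost surely finite, hence of length zero. *)
Lemma mean_interior_length : \int[Q]_K leb ((K : set R)° : set mR) = mean_length Q.
Proof.
apply: ae_eq_integral => //.
- exact: measurable_interior_length.
- exact: measurable_length.
have := ae_finite_boundary; apply: filterS => K fK _.
have mI : measurable ((K : set R)° : set mR) by apply: open_measurable; exact: open_interior.
have mB : measurable (boundary K : set mR).
  by rewrite compact_boundaryE; apply: measurableD => //; exact: compact_set_measurable.
have B0 : leb (boundary K : set mR) = 0.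
  by apply: countable_lebesgue_measure0; exact: finite_set_countable.
have KIB : (K : set mR) = (K : set R)° `|` boundary K.
  by rewrite compact_boundaryE setDUK//; exact: interior_subset.
have IB0 : (K : set R)° `&` boundary K = set0 by rewrite compact_boundaryE setDIK.
have := measureU leb mI mB IB0; rewrite -[X in leb X = _ -> _]KIB => ->.
by rewrite [X in _ = _ + X]B0 adde0.
Qed.

Lemma mean_length_gt0 : 0 < Q [set K : C | (K : set R)° !=set0] -> 0 < mean_length Q.
Proof.
move=> Q0; rewrite lt0e; apply/andP; split; last exact: integral_ge0.
rewrite -mean_interior_length; apply/eqP => I0.
have : Q.-integrable setT (fun K : C => leb ((K : set R)° : set mR)).
  apply/integrableP; split; first exact: measurable_interior_length.
  under eq_integral do rewrite gee0_abs//.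
  by rewrite I0.
have := (ae_eq_integral_abs Q measurableT (@measurable_interior_length R)).
under eq_integral do rewrite gee0_abs//.
move=> [+ _] _ => /(_ I0) [N [mN N0 sN]].
move: Q0; rewrite ltNge => /negP; apply; rewrite -N0.
apply: le_measure; rewrite ?inE//.
  rewrite (_ : [set _ | _] = \bigcup_(n in [set n | @rat_itv R n !=set0])
      [set K : C | rat_itv n `<=` (K : set R)]).
    apply: bigcup_measurable => n _; apply: measurable_supset; exact: rat_itv_open.
  apply/seteqP; split => [K [y /interior_rat_itvP[n [ny nK]]]|K [n [y ny] nK]].
    by exists n => //; exists y.
  by exists y; apply/interior_rat_itvP; exists n.
move=> K /= K0; apply: sN => /= /(_ Logic.I) h.
by have := interior_length_gt0 K0; rewrite h ltxx.
Qed.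
End grain_lengths.
Section dead_leaves_process.
Context d (Omega : measurableType d) (R : realType) (P : probability Omega R).
Local Notation mR := (measurableTypeR R).
Local Notation plane := (mR * mR)%type.
Local Notation C := (compact_set R).
Local Notation X := (plane * C)%type.
Local Notation leb := (@lebesgue_measure R).
Variables (Q : probability C R) (z : nat -> Omega -> plane) (S : nat -> Omega -> C).
Hypothesis Q_interior : (0 < Q [set K : C | (K : set R)° !=set0])%E.
Hypothesis hz : unit_poisson_process P z.
Hypothesis mS : forall i, measurable_fun setT (S i).
Hypothesis S_law : forall i A, measurable A -> pushforward P (S i) A = Q A.
Hypothesis S_indep : mutually_independent P S.
Hypothesis zS_indep : independent_families P z S.
Hypothesis radius_integrable : (mean_radius Q < +oo)%E.
Hypothesis boundary_integrable : (mean_boundary_count Q < +oo)%E.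
Local Open Scope ereal_scope.
Local Notation mu := (leaf_intensity Q).
Local Notation leaf := (leaf z S).
Local Notation avoid_after := (avoid_after z S).

Let lambda : R := fine (mean_length Q).

Let lambda0 : (0 < lambda)%R.
Proof. by rewrite fine_gt0// mean_length_gt0//= mean_length_fin. Qed.

Let lambdaE : mean_length Q = lambda%:E.
Proof. by rewrite fineK// ge0_fin_numE ?mean_length_fin//; exact: integral_ge0. Qed.

Lemma covers_intensity m (x : X) : (0 <= x.1.2 :> R)%R ->
  mu (xsection (covers m) x) = (lambda * x.1.2)%:E.
Proof.
move=> t0; pose J : set mR := `[0%R, (x.1.2 : R)[%classic.
rewrite (_ : xsection _ x = [set x' : X | J x'.1.2 /\
  [set p : mR * C | (p.2 : set R)° p.1] ((edge_pt m x - (x'.1.1 : R))%R, x'.2)]); last first.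
  by apply/seteqP; split => x'; rewrite /xsection/= inE /J/= in_itv.
rewrite hitting_intensity//; last 2 first.
- exact: measurable_itv.
- exact: measurable_mem_interior.
under eq_integral do rewrite ysection_interior.
rewrite mean_interior_length// lambdaE lebesgue_measure_itv/= lte_fin.
move: t0; rewrite le_eqVlt => /orP[/eqP <-|t0].
  by rewrite ltxx mul0e mulr0.
by rewrite t0 oppr0 adde0 -EFinM mulrC.
Qed.

Lemma cell_cover_fin q : mu (cell_cover q) < +oo.
Proof.
rewrite /cell_cover; case: choice.unpickle => [[n s]|]; last by rewrite measure0.
have [[y ny]|n0] := pselect (@rat_itv R n !=set0); last first.
  by rewrite (_ : [set _ | _] = set0) ?measure0//; apply/seteqP; split => // x [].
pose J : set mR := `[0%R, (ratr s : R)]%classic.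
have mJ : measurable J by exact: measurable_itv.
apply: (@le_lt_trans _ _ (mu [set x : X | J x.1.2 /\
  [set p : mR * C | (p.2 : set R) p.1] ((y - (x.1.1 : R))%R, x.2)])).
  apply: le_measure; rewrite ?inE.
  - have := @measurable_cell_cover R (choice.pickle (n, s)).
    by rewrite /cell_cover choice.pickleK.
  - by apply: measurable_hitting => //; exact: measurable_mem.
  - by move=> x [t0s _ nK]; split; [rewrite /J/= in_itv|exact: nK].
rewrite hitting_intensity//; last exact: measurable_mem.
under eq_integral do rewrite ysection_mem.
rewrite -/(mean_length Q) lambdaE lebesgue_measure_itv/=.
by case: ifP => _; rewrite ?mul0e// -EFinB -EFinM ltry.
Qed.

Let mE m : measurable (covers m) := @measurable_covers R m.

(** The weight of a visible edge in $B$, times $\lambda$: an edge that arrives at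
    time $t$ is visible with probability $e^{-\lambda t}$, so that $\lambda$ times
    this weight is the exponential density in $t$. *)
Let density m B (x : X) : R :=
  (\1_(boundary_new m) x.2 * exponential_pdf lambda x.1.2 * \1_B (edge_pt m x : mR))%R.

Let mpdf : measurable_fun [set: mR] (exponential_pdf lambda : mR -> R).
Proof. exact: measurable_exponential_pdf. Qed.

Let density_ge0 m B x : (0 <= density m B x)%R.
Proof. by rewrite !mulr_ge0// ?indicE// exponential_pdf_ge0// ltW. Qed.

Let measurable_density m B : measurable B ->
  measurable_fun setT (fun x => (density m B x)%:E).
Proof.
move=> mB; have mtime : measurable_fun setT (fun x : X => x.1.2 : mR).
  exact: (measurableT_comp measurable_snd measurable_fst).
apply/measurable_EFinP.
apply: measurable_funM; first apply: measurable_funM.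
- apply: (measurableT_comp _ measurable_snd); apply: measurable_indic.
  exact: measurable_boundary_new.
- exact: (measurableT_comp mpdf mtime).
- apply: (measurableT_comp (measurable_indic mB)).
  exact: (@measurable_edge_pt R m).
Qed.

Let density_integral m B : measurable B ->
  \int[mu]_x (density m B x)%:E = Q (boundary_new m) * leb B.
Proof.
move=> mB.
rewrite (fubini_tonelli2 _ (measurable_density m mB)); last first.
  by move=> x; rewrite lee_fin.
transitivity (\int[Q]_K ((\1_(boundary_new m) K)%:E * leb B)).
  apply: eq_integral => K _; rewrite /fubini_G/=.
  pose b : R := boundary_pt m K.
  pose g (p : plane) : R := (exponential_pdf lambda p.2 * \1_B ((p.1 : R) + b : mR)%R)%R.
  have g0 p : (0 <= g p)%R by rewrite mulr_ge0// ?indicE// exponential_pdf_ge0// ltW.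
  have mg : measurable_fun setT g.
    apply: measurable_funM; first exact: (measurableT_comp mpdf measurable_snd).
    apply: (measurableT_comp (measurable_indic mB)).
    exact: (measurableT_comp (measurable_translation b) measurable_fst).
  transitivity (\int[@area R]_p ((\1_(boundary_new m) K)%:E * (g p)%:E)).
    apply: eq_integral => p _; rewrite -EFinM /density /g /edge_pt/= mulrA.
    by rewrite [(_ + (p.1 : R))%R]addrC.
  rewrite ge0_integralZl//; last 2 first.
  - exact/measurable_EFinP.
  - by move=> p _; rewrite lee_fin.
  congr (_ * _).
  have mgE : measurable_fun setT (fun p => (g p)%:E) by exact/measurable_EFinP.
  rewrite (fubini_tonelli2 _ mgE); last by move=> p; rewrite lee_fin.
  transitivity (\int[leb]_t ((exponential_pdf lambda t)%:E * leb B)).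
    apply: eq_integral => t _; rewrite /fubini_G/=.
    under eq_integral do rewrite /g/= EFinM.
    rewrite ge0_integralZl//; last 2 first.
    - apply/measurable_EFinP.
      exact: (measurableT_comp (measurable_indic mB) (measurable_translation b)).
    - by rewrite lee_fin exponential_pdf_ge0// ltW.
    congr (_ * _); rewrite -[RHS](lebesgue_translation b mB).
    have mBb := measurable_translated b mB.
    by have := integral_indic leb measurableT mBb; rewrite setIT.
  rewrite ge0_integralZr//; last 2 first.
  - exact/measurable_EFinP.
  - by move=> t _; rewrite lee_fin exponential_pdf_ge0// ltW.
  by rewrite integral_exponential_pdf// mul1e.
have mnew := @measurable_boundary_new R m.
rewrite ge0_integralZr//; last first.
  by apply/measurable_EFinP; exact: measurable_indic.
by congr (_ * _); have := integral_indic Q measurableT mnew; rewrite setIT.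
Qed.

(** [palm_sections] applies to the leaves of a slab, whose intensity is finite;
    both sides are monotone in the slab. The integral of $e^{-\lambda t}$ over the
    arrival time is $\lambda^{-1}$. *)
Lemma edge_intensity m B : measurable B ->
  \sum_(0 <= i <oo) P (leaf i @^-1` edge_in m B `&` avoid_after (covers m) i) =
  (lambda^-1)%:E * (Q (boundary_new m) * leb B).
Proof.
move=> mB; have mH := measurable_edge_in m mB.
have mleaf := measurable_leaf (upp_measurable hz) mS.
have mG i : measurable (avoid_after (covers m) i).
  exact: (measurable_avoid_after hz mS i (mE m)).
pose m0 := mseries (fun i => image_measure (mrestr P (mG i)) (mleaf i)) 0.
pose H n := edge_in m B `&` @slab R _ C n.
have mHn n : measurable (H n) by apply: measurableI => //; exact: measurable_slab.
have c0 : m0 (H n) @[n --> \oo] --> m0 (edge_in m B) by exact: cvg_slab_measure.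
pose f (x : X) := (lambda^-1)%:E * (density m B x)%:E.
have md := measurable_density m mB.
have mf : measurable_fun setT f by exact: measurable_funeM.
have d0 x : 0 <= (density m B x)%:E.
  by rewrite lee_fin.
have f0 x : 0 <= f x by rewrite mule_ge0// lee_fin invr_ge0 ltW.
have HnU : \bigcup_n H n = edge_in m B.
  by rewrite -setI_bigcupr slab_cover setIT.
have c1 : \int[mu]_(x in H n) f x @[n --> \oo] --> \int[mu]_(x in edge_in m B) f x.
  rewrite -HnU; apply: ge0_nondecreasing_set_cvg_integral => //.
  - by move=> i j ij; apply/subsetPset; apply: setIS; exact: slab_nd.
  - by move=> i; exact: measurable_funTS.
have e n : m0 (H n) = \int[mu]_(x in H n) f x.
  transitivity (\int[mu]_(x in H n) void_weight Q (covers m) x); last first.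
    apply: eq_integral => x /set_mem[[t0 nx Bx] _]; rewrite /void_weight covers_intensity//=.
    rewrite /f /density !indicE !mem_set// mul1r mulr1 exponential_pdfE//.
    by rewrite -EFinM mulrA mulVf ?gt_eqF// mul1r mulNr.
  have -> : m0 (H n) = \sum_(0 <= i <oo) P (leaf i @^-1` H n `&` avoid_after (covers m) i) by [].
  rewrite coversE -(palm_sections hz mS S_law S_indep zS_indep (L := n)) => //.
  - by move=> q; exact: measurable_edge_cell.
  - by move=> q; exact: measurable_cell_cover.
  - by move=> q; exact: edge_cell_cover_disj.
  - exact: cell_cover_fin.
  - exact: subIsetr.
  - by move=> x [[t0 _ _] _]; rewrite -coversE covers_intensity// ltry.
transitivity (\int[mu]_(x in edge_in m B) f x).
  rewrite -(cvg_lim (@ereal_hausdorff R) c1).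
  suff <- : (fun n => m0 (H n)) = (fun n => \int[mu]_(x in H n) f x).
    by apply/esym; exact: (cvg_lim (@ereal_hausdorff R) c0).
  by apply/funext.
rewrite integral_mkcond -density_integral// -[RHS]ge0_integralZl//; last first.
  by rewrite lee_fin invr_ge0 ltW.
apply: eq_integral => x _; rewrite patchE; case: ifPn => // /negP xH.
rewrite /f /density; apply/esym.
have [nx|nx] := pselect (boundary_new m x.2); last first.
  by rewrite [\1_(boundary_new m) _]indicE memNset// !mul0r mule0.
have [Bx|Bx] := pselect (B (edge_pt m x)); last first.
  by rewrite [\1_B _]indicE memNset// mulr0 mule0.
have [t0|t0] := ltP (x.1.2 : R) 0%R.
  by rewrite lt0_exponential_pdf// mulr0 mul0r mule0.
by case: xH; rewrite inE.
Qed.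

End dead_leaves_process.

(** * Leaves do not share edge points *)

Section coincidences.
Context d (Omega : measurableType d) (R : realType) (P : probability Omega R).
Local Notation mR := (measurableTypeR R).
Local Notation plane := (mR * mR)%type.
Local Notation C := (compact_set R).
Variables (z : nat -> Omega -> plane) (S : nat -> Omega -> C).
Hypothesis hz : unit_poisson_process P z.
Hypothesis mS : forall i, measurable_fun setT (S i).
Hypothesis zS_indep : independent_families P z S.
Local Open Scope ereal_scope.
Local Notation leaf := (leaf z S).

Let place i : generated_space z -> mR := fun w => (z i w).1.

Let pt_of m i : generated_space S -> mR := fun w => boundary_pt m (S i w).

Let measurable_place i : measurable_fun setT (place i).
Proof.
move=> _ A mA; rewrite setTI.
apply: (@generated_preimage _ _ _ _ _ z i (fst @^-1` A)).
by rewrite -[X in measurable X]setTI; exact: measurable_fst.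
Qed.

Let measurable_pt_of m i : measurable_fun setT (pt_of m i).
Proof.
move=> _ A mA; rewrite setTI.
apply: (@generated_preimage _ _ _ _ _ S i (boundary_pt m @^-1` A)).
by rewrite -[X in measurable X]setTI; exact: measurable_boundary_pt.
Qed.

Let z_sigma_measurable G : sigma_generated z G -> measurable G.
Proof.
apply: smallest_sub; first exact: sigma_algebra_measurable.
by move=> _ [i _ [A mA <-]]; apply: (upp_measurable hz).
Qed.

Let S_sigma_measurable G : sigma_generated S G -> measurable G.
Proof.
apply: smallest_sub; first exact: sigma_algebra_measurable.
by move=> _ [i _ [A mA <-]]; apply: mS.
Qed.

(** Given the two grains, the two edge points coincide only if the difference of
    the places of the leaves takes a prescribed value. *)
Lemma edge_pt_neq i j m m' : i <> j ->
  P [set w | edge_pt m (leaf i w) = edge_pt m' (leaf j w)] = 0.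
Proof.
move=> ij.
pose U (w : Omega) : mR := (((z i w).1 : R) - (z j w).1)%R.
pose V (w : Omega) : mR := ((boundary_pt m' (S j w) : R) - boundary_pt m (S i w))%R.
have sU A : measurable A -> sigma_generated z (U @^-1` A).
  have h : @measurable_fun _ _ (generated_space z) mR setT U.
    by apply: measurable_funB; exact: measurable_place.
  by move=> mA; have := h measurableT A mA; rewrite setTI.
have sV A : measurable A -> sigma_generated S (V @^-1` A).
  have h : @measurable_fun _ _ (generated_space S) mR setT V.
    by apply: measurable_funB; exact: measurable_pt_of.
  by move=> mA; have := h measurableT A mA; rewrite setTI.
have mU : measurable_fun setT U.
  by move=> _ A mA; rewrite setTI; apply: z_sigma_measurable; exact: sU.
have mV : measurable_fun setT V.
  by move=> _ A mA; rewrite setTI; apply: S_sigma_measurable; exact: sV.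
pose fU : {mfun Omega >-> mR} := HB.pack U (isMeasurableFun.Build _ _ _ _ U mU).
pose fV : {mfun Omega >-> mR} := HB.pack V (isMeasurableFun.Build _ _ _ _ V mV).
pose D : set (mR * mR) := [set p | (p.1 : R) = p.2].
have mD : measurable D.
  rewrite (_ : D = (fun p : mR * mR => ((p.1 : R) - p.2)%R) @^-1` [set 0%R]).
    rewrite -[X in measurable X]setTI.
    have h : measurable_fun setT (fun p : mR * mR => ((p.1 : R) - p.2)%R : mR).
      by apply: measurable_funB; [exact: measurable_fst|exact: measurable_snd].
    by apply: h => //; exact: measurable_set1.
  apply/seteqP; split => p /=; first by move=> ->; rewrite subrr.
  by move/eqP; rewrite subr_eq0 => /eqP.
have mVU : measurable_fun setT (fun w => (V w, U w)) by exact: measurable_fun_pair.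
have key := @eq_measure_setX _ _ _ _ R (image_measure P mVU)
  (distribution P fV \x distribution P fU) _ _ D mD.
transitivity (image_measure P mVU D).
  congr (P _); apply/seteqP; split => w; rewrite /edge_pt /D/= /U /V/= => h; lra.
rewrite key.
- apply: integral0_eq => v _ /=.
  rewrite (_ : xsection D v = [set v]); last first.
    by apply/seteqP; split => u /=; rewrite /xsection/= inE.
  exact: poisson_diff_null.
- apply: (@le_lt_trans _ _ 1); last exact: ltry.
  by change (P setT <= 1); rewrite probability_setT.
- move=> A B mA mB.
  transitivity (distribution P fV A * distribution P fU B); last first.
    exact/esym/product_measure1E.
  rewrite muleC -[RHS](zS_indep (sU _ mB) (sV _ mA)).
  by congr (P _); apply/seteqP; split => w [].
Qed.

End coincidences.

(** * The point process of the visible edges *)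

Section visible_edges.
Context {R : realType}.
Local Notation mR := (measurableTypeR R).
Local Notation C := (compact_set R).
Local Notation X := ((mR * mR) * C)%type.
Local Open Scope ereal_scope.
Implicit Types (x : nat -> X) (B : set mR).

Definition visible m x i := forall j, ~ covers m (x i, x j).

Definition edges x B : set (nat * nat) :=
  [set im | edge_in im.2 B (x im.1) /\ visible im.2 x im.1].

Definition edge_measure x : {measure set mR -> \bar R} :=
  mseries (fun i => mseries (fun m =>
    if `[< edges x setT (i, m) >]
    then (dirac (edge_pt m (x i) : mR) : {measure set mR -> \bar R})
    else mzero) 0) 0.

Lemma edge_measureE x B :
  edge_measure x B = \sum_(0 <= i <oo) \sum_(0 <= m <oo) (\1_(edges x B) (i, m))%:E.
Proof.
apply: eq_eseriesr => i _; apply: eq_eseriesr => m _.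
case: asboolP => [[[t0 nm _] vis]|h].
  rewrite [LHS]diracE indicE; congr ((_ : bool)%:R)%:E.
  apply/idP/idP => /set_mem h; apply/mem_set; first by split.
  by case: h => -[].
rewrite /= /mzero indicE memNset// => -[[t0 nm _] vis]; exact: h.
Qed.

Lemma edge_measure_counting x B : edge_measure x B = counting (edges x B).
Proof.
rewrite edge_measureE counting_esum.
rewrite nneseries_esumT => [|i]; last first.
  by apply: nneseries_ge0 => m _ _; rewrite lee_fin indicE.
under eq_esum => i _.
  rewrite nneseries_esumT => [|m]; last by rewrite lee_fin indicE.
  over.
rewrite (esum_esum (I := setT) (J := fun=> setT) (a := fun i m => (\1_(edges x B) (i, m))%:E)); last first.
  by move=> i m _ _; rewrite lee_fin indicE.
rewrite [RHS]esum_mkcond (_ : setT `*`` _ = setT); last by apply/seteqP; split.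
by apply: eq_esum => -[i m] _ /=; rewrite indicE; case: ifP.
Qed.

Lemma edge_measure_nat x B : edge_measure x B < +oo ->
  exists n : nat, edge_measure x B = n%:R%:E.
Proof.
by rewrite edge_measure_counting /counting; case: ifP => // _ _; eexists.
Qed.

(** Distinct visible edges are distinct points once no edge point is shared by
    two leaves, and then their number is the number of boundary points. *)
Lemma edge_measure_dlm x B : (forall i, finite_set (boundary ((x i).2 : set R))) ->
  (forall i j m m', i <> j -> edge_pt m (x i) <> edge_pt m' (x j)) ->
  edge_measure x B = dlm_eta (fun i => (x i).1) (fun i => (x i).2) B.
Proof.
move=> bfin distinct; rewrite edge_measure_counting /dlm_eta !counting_esum.
pose f (im : nat * nat) : R := edge_pt im.2 (x im.1).
have finj : {in edges x B &, injective f}.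
  move=> [i m] [j m'] /set_mem[[/= _ nm _] _] /set_mem[[/= _ nm' _] _] ff.
  have [ij|/eqP ij] := eqVneq i j; last by case: (distinct _ _ m m' ij).
  move: nm' ff; rewrite -ij => nm' /addIr ff.
  by congr (_, _); exact: boundary_new_inj ff.
rewrite -(esum_image _ _ (fun=> 1 : \bar R) finj).
congr (esum _ _); apply/seteqP; split => y.
  move=> [[i m] [[/= t0 nm By] vis] <-]; split => //.
  exists i => //; split.
    exists (boundary_pt m (x i).2) => //.
    by rewrite boundary_ptsE//; exists m.
  move=> [j /= /andP[tj tji] [u Ku uE]]; apply: (vis j); split => /=; first by rewrite tj.
  by move: uE; rewrite /f/= => <-; rewrite addrK.
move=> [[i /= t0 [[u bu uE] ncov]] By].
move: bu; rewrite boundary_ptsE// => -[m nm um].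
exists (i, m); last by rewrite /f/= /edge_pt um.
have yE : edge_pt m (x i) = y by rewrite /edge_pt um.
split; first by split => //=; rewrite yE.
move=> j [/= /andP[tj tji] Kj]; apply: ncov; exists j; first by rewrite /= tj.
by exists (edge_pt m (x i) - (x j).1.1)%R => //; rewrite subrK yE.
Qed.

Definition window (n : nat) : set mR := `[(- n%:R)%R, n%:R]%classic.

Lemma measurable_window n : measurable (window n).
Proof. exact: measurable_itv. Qed.

Definition finite_edges x : Prop := forall n, edge_measure x (window n) < +oo.

Lemma finite_edges_nat x (B : set mR) : finite_edges x -> measurable B ->
  bounded_set (B : set R) -> exists n : nat, edge_measure x B = n%:R%:E.
Proof.
move=> xfin mB bB; apply: edge_measure_nat.
have [M M0 BM] := @ex_strict_bound_gt0 R R R idfun (globally B) _ bB.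
apply: le_lt_trans (xfin (Num.truncn M).+1).
apply: le_measure; rewrite ?inE//; first exact: measurable_window.
move=> y /BM /= yM; rewrite /window/= in_itv/= -ler_norml ltW//.
by rewrite (lt_trans yM)// truncnS_gt.
Qed.

Let mzero_nat (B : set mR) : measurable B -> bounded_set (B : set R) ->
  exists n : nat, @mzero _ _ R B = n%:R%:E.
Proof. by move=> _ _; exists 0%N. Qed.

(** The zero measure is the value on the null event where the measure of visible
    edges is not locally finite. *)
Definition edge_config x : point_config R :=
  if pselect (finite_edges x) is left xfin
  then PointConfig (fun B => @finite_edges_nat x B xfin)
  else PointConfig mzero_nat.

Lemma edge_configE x B :
  edge_config x B = if `[< finite_edges x >] then edge_measure x B else 0.
Proof.
rewrite /edge_config; case: pselect => h; first by rewrite asboolT.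
by rewrite asboolF.
Qed.

End visible_edges.
Section edge_process.
Context d (Omega : measurableType d) (R : realType) (P : probability Omega R).
Local Notation mR := (measurableTypeR R).
Local Notation plane := (mR * mR)%type.
Local Notation C := (compact_set R).
Local Notation X := (plane * C)%type.
Local Notation leb := (@lebesgue_measure R).
Variables (Q : probability C R) (z : nat -> Omega -> plane) (S : nat -> Omega -> C).
Hypothesis Q_interior : (0 < Q [set K : C | (K : set R)° !=set0])%E.
Hypothesis hz : unit_poisson_process P z.
Hypothesis mS : forall i, measurable_fun setT (S i).
Hypothesis S_law : forall i A, measurable A -> pushforward P (S i) A = Q A.
Hypothesis S_indep : mutually_independent P S.
Hypothesis zS_indep : independent_families P z S.
Hypothesis radius_integrable : (mean_radius Q < +oo)%E.
Hypothesis boundary_integrable : (mean_boundary_count Q < +oo)%E.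
Local Open Scope ereal_scope.
Local Notation leaf := (leaf z S).

Lemma measurable_nneseries d0 (T : measurableType d0) (h : nat -> T -> \bar R) :
  (forall k x, 0 <= h k x) -> (forall k, measurable_fun setT (h k)) ->
  measurable_fun setT (fun x => \sum_(0 <= k <oo) h k x).
Proof.
move=> h0 mh; have := @ge0_emeasurable_sum _ T R setT h xpredT (fun k x _ _ => h0 k x) (fun k _ => mh k).
exact.
Qed.

Let edge_event B i m : set Omega :=
  leaf i @^-1` edge_in m B `&` avoid_after z S (covers m) i.

Let measurable_edge_event B i m : measurable B -> measurable (edge_event B i m).
Proof.
move=> mB; apply: measurableI.
  exact: (measurable_preimage_leaf hz mS i (measurable_edge_in m mB)).
exact: (measurable_avoid_after hz mS i (@measurable_covers R m)).
Qed.

Let edge_measure_events B w : edge_measure (leaf^~ w) B =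
  \sum_(0 <= i <oo) \sum_(0 <= m <oo) (\1_(edge_event B i m) w)%:E.
Proof. by rewrite edge_measureE. Qed.

Lemma measurable_edge_measure B : measurable B ->
  measurable_fun setT (fun w => edge_measure (leaf^~ w) B).
Proof.
move=> mB; under eq_fun do rewrite edge_measure_events.
apply: measurable_nneseries => [i w|i].
  by apply: nneseries_ge0 => m _ _; rewrite lee_fin.
apply: measurable_nneseries => [m w|m]; first by rewrite lee_fin.
by apply/measurable_EFinP; apply: measurable_indic; exact: measurable_edge_event.
Qed.

Lemma mean_boundary_countE :
  mean_boundary_count Q = \sum_(0 <= m <oo) Q (boundary_new m).
Proof.
rewrite /mean_boundary_count; under eq_integral do rewrite counting_boundary.
have mnew m := @measurable_boundary_new R m.
rewrite integral_nneseries//; last first.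
  by move=> m; apply/measurable_EFinP; exact: measurable_indic.
apply: eq_eseriesr => m _.
by have := integral_indic Q measurableT (mnew m); rewrite setIT.
Qed.

(** The series is an integral for the counting measure, so the factor may be
    infinite; it will be the length of an unbounded set. *)
Lemma nneseriesZr (a : nat -> \bar R) c : (forall k, 0 <= a k) -> 0 <= c ->
  \sum_(0 <= k <oo) (a k * c) = (\sum_(0 <= k <oo) a k) * c.
Proof.
move=> a0 c0; rewrite -!ge0_integral_count//; last by move=> k; rewrite mule_ge0.
by rewrite ge0_integralZr.
Qed.

Lemma inv_mean_lengthE : (mean_length Q)^-1 = ((fine (mean_length Q))^-1)%:E.
Proof.
have len0 := mean_length_gt0 boundary_integrable Q_interior.
have len1 := mean_length_fin radius_integrable.
rewrite -[in LHS](@fineK _ (mean_length Q)); last by rewrite ge0_fin_numE// ltW.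
by rewrite inver gt_eqF// fine_gt0// len0.
Qed.

Lemma edge_measure_mean B : measurable B ->
  \int[P]_w edge_measure (leaf^~ w) B =
  (mean_length Q)^-1 * mean_boundary_count Q * leb B.
Proof.
move=> mB; under eq_integral do rewrite edge_measure_events.
have mind i m : measurable_fun setT (fun w => (\1_(edge_event B i m) w)%:E : \bar R).
  by apply/measurable_EFinP; apply: measurable_indic; exact: measurable_edge_event.
rewrite integral_nneseries//; last 2 first.
- by move=> i; apply: measurable_nneseries => // m w; rewrite lee_fin.
- by move=> i w _; apply: nneseries_ge0 => m _ _; rewrite lee_fin.
transitivity (\sum_(0 <= i <oo) \sum_(0 <= m <oo) P (edge_event B i m)).
  apply: eq_eseriesr => i _; rewrite integral_nneseries//.
  apply: eq_eseriesr => m _.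
  by rewrite integral_indic ?setIT//; exact: measurable_edge_event.
rewrite nneseries_interchange//.
have c0 : 0 <= ((fine (mean_length Q))^-1)%:E.
  by rewrite lee_fin invr_ge0 fine_ge0//; exact: integral_ge0.
rewrite inv_mean_lengthE mean_boundary_countE [X in X * _]muleC -!nneseriesZr//.
  apply: eq_eseriesr => m _.
  rewrite (edge_intensity Q_interior hz mS S_law S_indep zS_indep)//.
  by rewrite muleA; congr (_ * _); rewrite muleC.
by move=> k; rewrite mule_ge0.
Qed.

Lemma ae_edge_measure_dlm : {ae P, forall w, forall B : set mR,
  edge_measure (leaf^~ w) B = dlm_eta (z^~ w) (S^~ w) B}.
Proof.
have bfin : {ae P, forall w, forall i, finite_set (boundary (S i w : set R))}.
  apply: ae_foralln => i.
  have [N [mN N0 sN]] := ae_finite_boundary boundary_integrable.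
  exists (S i @^-1` N); split.
  - by rewrite -[X in measurable X]setTI; exact: mS.
  - by rewrite -[RHS]N0; exact: S_law.
  - by move=> w hw; exact: sN.
have distinct : {ae P, forall w, forall i j m m', i <> j ->
    edge_pt m (leaf i w) <> edge_pt m' (leaf j w)}.
  apply: ae_foralln => i; apply: ae_foralln => j.
  apply: ae_foralln => m; apply: ae_foralln => m'.
  have [->|/eqP ij] := eqVneq i j; first by apply: filterE.
  have mpt k n : measurable_fun setT (fun w => edge_pt n (leaf k w)).
    apply: (measurableT_comp (@measurable_edge_pt R n)).
    exact: (measurable_leaf (upp_measurable hz)).
  exists [set w | edge_pt m (leaf i w) = edge_pt m' (leaf j w)]; split.
  - rewrite (_ : [set _ | _] = (fun w => edge_pt m (leaf i w) - edge_pt m' (leaf j w))%R @^-1` [set 0%R]).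
      rewrite -[X in measurable X]setTI.
      by apply: measurable_funB => //; exact: measurable_set1.
    apply/seteqP; split => w /=; first by move=> ->; rewrite subrr.
    by move/eqP; rewrite subr_eq0 => /eqP.
  - exact: edge_pt_neq.
  - by move=> w /= /not_implyP[_ /contrapT].
by apply: filterS2 bfin distinct => w bw dw B; exact: edge_measure_dlm.
Qed.

Lemma ae_finite_edges : {ae P, forall w, finite_edges (leaf^~ w)}.
Proof.
apply: ae_foralln => n; have mI := @measurable_window R n.
have : P.-integrable setT (fun w => edge_measure (leaf^~ w) (window n)).
  apply/integrableP; split; first exact: measurable_edge_measure.
  under eq_integral do rewrite gee0_abs//.
  rewrite edge_measure_mean// inv_mean_lengthE lebesgue_window.
  have b0 : 0 <= mean_boundary_count Q by exact: integral_ge0.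
  rewrite -(fineK (x := mean_boundary_count Q)) ?ge0_fin_numE//.
  by rewrite -!EFinM ltry.
move=> /(integrable_ae measurableT); apply: filterS => w /(_ Logic.I).
by rewrite ge0_fin_numE.
Qed.

Lemma measurable_edge_config : measurable_fun setT (fun w => edge_config (leaf^~ w)).
Proof.
apply: (measurability _ (erefl (@point_config_sigma R))) => _ [_ [B mB [U mU <-]] <-].
rewrite !setTI.
have mfin : measurable [set w | finite_edges (leaf^~ w)].
  rewrite (_ : [set _ | _] = \bigcap_n [set w | edge_measure (leaf^~ w) (window n) < +oo]).
    apply: bigcapT_measurable => n.
    have := measurable_edge_measure (measurable_window n) measurableT (emeasurable_itv (`]-oo, (+oo : \bar R)[)).
    by rewrite setTI; congr (measurable _); apply/seteqP; split => w; rewrite /= in_itv.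
  by apply/seteqP; split => w h n; [move=> _|]; exact: h.
have mfun : measurable_fun setT (fun w : Omega => if `[< finite_edges (leaf^~ w) >]
    then edge_measure (leaf^~ w) B else 0).
  apply: measurable_fun_ifT => //; last exact: measurable_edge_measure.
  by apply: (measurable_fun_bool true); rewrite setTI; rewrite (_ : _ @^-1` _ = [set w | finite_edges (leaf^~ w)])//; apply/seteqP; split => w /= /asboolP.
have := mfun measurableT U mU; rewrite setTI; congr (measurable _).
by apply/seteqP; split => w; rewrite /= edge_configE.
Qed.

End edge_process.

(** * Visible edges as a functional of the voids *)

Section configurations.
Context {R : realType}.
Local Notation mR := (measurableTypeR R).
Local Notation C := (compact_set R).
Local Notation X := ((mR * mR) * C)%type.
Local Open Scope ereal_scope.
Local Notation slab := (@slab R _ C).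
Implicit Types (D : set X) (xi : set X).

Definition void_on D : set (set X) := [set xi | xi `&` D = set0].

(** The $\sigma$-algebra is generated by the voids of bounded sets only: their
    intensity is finite, so that [avoid_prob] gives their probabilities. *)
Definition slab_voids : set (set (set X)) :=
  [set G | exists2 D, measurable D & (exists n, D `<=` slab n) /\ G = void_on D].

Definition conf : Type := g_sigma_algebraType slab_voids.

HB.instance Definition _ := Measurable.on conf.

Lemma measurable_void D : measurable D -> measurable (void_on D : set conf).
Proof.
move=> mD; rewrite (_ : void_on D = \bigcap_n void_on (D `&` slab n)).
  apply: bigcapT_measurable => n; apply: sub_sigma_algebra.
  exists (D `&` slab n); last by split => //; exists n; exact: subIsetr.
  by apply: measurableI => //; exact: measurable_slab.
apply/seteqP; split => xi h.
  by move=> n _; rewrite /void_on/= setIA h set0I.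
rewrite /void_on/= -subset0 => x [xix Dx].
have [n _ nx] : (\bigcup_n slab n) x by rewrite slab_cover.
by have := h n Logic.I; rewrite /void_on/= -subset0 => /(_ x); apply.
Qed.

Lemma indic_asbool (T : Type) (A : set T) x : \1_A x = (`[< A x >])%:R :> R.
Proof. by rewrite indicE; congr ((_ : bool)%:R); apply/idP/asboolP => [/set_mem|/mem_set]. Qed.

Lemma nneseries_at_most_one (A : set nat) : is_subset1 A ->
  \sum_(0 <= i <oo) (\1_A i)%:E = (`[< A !=set0 >]%:R)%:E :> \bar R.
Proof.
move=> A1; have [[k Ak]|A0] := pselect (A !=set0).
  rewrite asboolT; last by exists k.
  rewrite (@nneseries_single _ _ k) => [|i|i ik]; last 2 first.
  - by rewrite lee_fin.
  - by rewrite indicE memNset// => Ai; apply: ik; exact: A1.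
  by rewrite indicE mem_set.
rewrite asboolF// eseries0// => i _ _.
by rewrite indicE memNset// => Ai; apply: A0; exists i.
Qed.

(** When a cell of the partition into strips contains at most one point of the
    configuration, this event says that this point is a leaf with its $m$-th
    edge in $B$ and that no leaf covers the edge. *)
Definition cell_event B L n k m : set conf :=
  let cell := seqD slab L `&` strip L n k in
  ~` void_on (cell `&` edge_in m B) `&`
  \bigcap_q (void_on (cell `&` edge_cell m q) `|` void_on (cell_cover q)).

Definition cell_count B L n (xi : conf) : \bar R :=
  \sum_(0 <= k <oo) \sum_(0 <= m <oo) (\1_(cell_event B L n k m) xi)%:E.

(** The slabs are made disjoint so that their counts add up. The superior limit is
    a limit for the sets of leaves of interest, and it is measurable on the space
    of all sets of leaves. *)
Definition conf_count B (xi : conf) : \bar R :=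
  \sum_(0 <= L <oo) limn_esup (cell_count B L ^~ xi).

Lemma measurable_shell L : measurable (seqD slab L).
Proof.
case: L => [|L]; rewrite /seqD; first exact: measurable_slab.
by apply: measurableD; exact: measurable_slab.
Qed.

Lemma measurable_cell_event B L n k m : measurable B ->
  measurable (cell_event B L n k m).
Proof.
move=> mB; have mcell : measurable (seqD slab L `&` strip L n k).
  by apply: measurableI; [exact: measurable_shell|exact: measurable_strip].
apply: measurableI.
  apply: measurableC; apply: measurable_void; apply: measurableI => //.
  exact: measurable_edge_in.
apply: bigcapT_measurable => q; apply: measurableU; apply: measurable_void.
  by apply: measurableI => //; exact: measurable_edge_cell.
exact: measurable_cell_cover.
Qed.

Lemma cell_count_ge0 B L n xi : 0 <= cell_count B L n xi.
Proof. by do 2![apply: nneseries_ge0 => ? _ _]; rewrite lee_fin. Qed.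

Lemma measurable_conf_count B : measurable B -> measurable_fun setT (conf_count B).
Proof.
move=> mB; apply: measurable_nneseries => [L xi|L].
  rewrite limn_esup_lim; apply: lime_ge; first exact: is_cvg_esups.
  near=> n; apply: le_trans (cell_count_ge0 B L n xi) _.
  by apply: ereal_sup_ubound; exists n => /=.
apply: measurable_fun_limn_esup => n.
apply: measurable_nneseries => [k xi|k].
  by apply: nneseries_ge0 => m _ _; rewrite lee_fin.
apply: measurable_nneseries => [m xi|m]; first by rewrite lee_fin.
by apply/measurable_EFinP; apply: measurable_indic; exact: measurable_cell_event.
Unshelve. all: by end_near. Qed.

Definition slab_finite (x : nat -> X) := forall L, finite_set [set i | slab L (x i)].

Definition distinct_places (x : nat -> X) :=
  forall i j, i <> j -> (x i).1.1 <> (x j).1.1.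

(** Finitely many distinct places have a positive least distance. *)
Lemma strips_separate x L : slab_finite x -> distinct_places x ->
  exists N, forall n, (N <= n)%N -> forall i j k,
    slab L (x i) -> slab L (x j) -> strip L n k (x i) -> strip L n k (x j) -> i = j.
Proof.
move=> fx dx.
pose N i j := Num.truncn (`|((x i).1.1 : R) - (x j).1.1|^-1)%R.
have sep i j n k : i <> j -> (N i j <= n)%N -> strip L n k (x i) -> ~ strip L n k (x j).
  move=> ij Nn /andP[ki ik] /andP[kj jk].
  have d0 : (0 < `|((x i).1.1 : R) - (x j).1.1|)%R.
    by rewrite normr_gt0 subr_eq0; apply/eqP; exact: dx.
  have : (`|((x i).1.1 : R) - (x j).1.1|^-1 < n.+1%:R)%R.
    by rewrite (lt_le_trans (truncnS_gt _))// ler_nat ltnS.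
  rewrite -[X in (X < _)%R]mul1r ltr_pdivrMr// => h.
  have : (n.+1%:R * `|((x i).1.1 : R) - (x j).1.1| < 1)%R.
    rewrite -[n.+1%:R%R]gtr0_norm// -normrM ltr_norml.
    move: ki ik kj jk; rewrite -!natr1; move: (n%:R + 1)%R (k%:R : R) => c r.
    by rewrite !mulrDl => h1 h2 h3 h4; apply/andP; split; nra.
  by move=> /(lt_trans h); rewrite ltxx.
have [J hJ] : exists J, forall i, slab L (x i) -> (i < J)%N.
  have /finite_seqP[s sE] := fx L; exists (\max_(i <- s) i).+1 => i si.
  by rewrite ltnS; apply: leq_bigmax_seq => //; have : [set` s] i by rewrite -sE.
exists (\max_(i < J) \max_(j < J) N i j)%N => n Nn i j k si sj ki kj.
apply: contrapT => ij; apply: (sep i j n k) => //.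
apply: leq_trans Nn.
apply: leq_trans (leq_bigmax (Ordinal (hJ _ si))).
exact: (leq_bigmax (F := fun j : 'I_J => N (Ordinal (hJ _ si)) j) (Ordinal (hJ _ sj))).
Qed.

Lemma strip_unique L n k k' (y : X) : strip L n k y -> strip L n k' y -> k = k'.
Proof.
move=> h h'; have tS := @strip_triv R _ C L n.
by apply: (tS k k' Logic.I Logic.I); exists y.
Qed.

Lemma cell_count_range x B L n :
  (forall i j k, slab L (x i) -> slab L (x j) -> strip L n k (x i) ->
     strip L n k (x j) -> i = j) ->
  cell_count B L n (range x) =
  \sum_(0 <= i <oo) \sum_(0 <= m <oo)
    (\1_[set i | seqD slab L (x i) /\ edges x B (i, m)] i)%:E.
Proof.
move=> sep.
have shell_slab y : seqD slab L y -> slab L y.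
  by rewrite /seqD; case: (L) => // ? -[].
pose A k m := [set i | (seqD slab L `&` strip L n k) (x i) /\ edges x B (i, m)].
have eventE k m : cell_event B L n k m (range x) <-> A k m !=set0.
  split.
    move=> [+ h]; rewrite /void_on/= => /eqP/set0P[_ [[i _ <-] [ci ei]]].
    exists i; split => //; split => // j cov.
    have : covers m (x i, x j) by [].
    rewrite coversE => -[q _ [cq cc]].
    have [+|+] := h q Logic.I; rewrite /void_on/= -subset0.
      by move=> /(_ (x i)); apply; split; [exists i|split].
    by move=> /(_ (x j)); apply; split; [exists j|].
  move=> [i [ci [ei vi]]]; split.
    by rewrite /void_on/= => /eqP; apply/negP/set0P; exists (x i); split; [exists i|split].
  move=> q _; apply: contrapT => /not_orP[].
  rewrite /void_on/= => /eqP/set0P[_ [[i' _ <-] [ci' eci']]].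
  move=> /eqP/set0P[_ [[j _ <-] ccj]].
  have ii' : i' = i.
    apply: (sep i' i k).
    - by apply: shell_slab; case: ci'.
    - by apply: shell_slab; case: ci.
    - by case: ci'.
    - by case: ci.
  by apply: (vi j); rewrite /= coversE; exists q => //; split => //=; rewrite -ii'.
have A1 k m : is_subset1 (A k m).
  move=> i j [[si ki] _] [[sj kj] _]; apply: (sep i j k) => //; exact: shell_slab.
transitivity (\sum_(0 <= k <oo) \sum_(0 <= m <oo) \sum_(0 <= i <oo) (\1_(A k m) i)%:E : \bar R).
  apply: eq_eseriesr => k _; apply: eq_eseriesr => m _.
  rewrite nneseries_at_most_one// indic_asbool; congr ((_ : bool)%:R%:E).
  by apply/asboolP/asboolP => /eventE.
transitivity (\sum_(0 <= k <oo) \sum_(0 <= i <oo) \sum_(0 <= m <oo) (\1_(A k m) i)%:E : \bar R).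
  apply: eq_eseriesr => k _; apply: nneseries_interchange => m i.
  by rewrite lee_fin.
rewrite nneseries_interchange => [|k i]; last first.
  by apply: nneseries_ge0 => m _ _; rewrite lee_fin.
apply: eq_eseriesr => i _.
rewrite nneseries_interchange => [|k m]; last by rewrite lee_fin.
apply: eq_eseriesr => m _.
rewrite -[LHS](_ : \sum_(0 <= k <oo) (\1_[set k | A k m i] k)%:E = _); last first.
  by apply: eq_eseriesr => k _; rewrite !indic_asbool.
rewrite nneseries_at_most_one; last first.
  by move=> k k' [[_ h] _] [[_ h'] _]; exact: strip_unique h h'.
rewrite indic_asbool; congr ((_ : bool)%:R%:E); apply/asboolP/asboolP.
  by move=> [k [[ci _] ei]].
move=> [ci ei]; have [k _ ki] := @strip_cover _ _ C L n _ (shell_slab _ ci).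
by exists k.
Qed.

(** The partition into strips becomes fine enough to separate the finitely many
    leaves of each bounded region, so that the number of visible edges is a
    functional of the set of leaves that depends only on the voids of this set. *)
Lemma conf_count_range x B : slab_finite x -> distinct_places x ->
  conf_count B (range x) = edge_measure x B.
Proof.
move=> fx dx; rewrite edge_measureE.
transitivity (\sum_(0 <= L <oo) \sum_(0 <= i <oo) \sum_(0 <= m <oo)
    (\1_[set i | seqD slab L (x i) /\ edges x B (i, m)] i)%:E : \bar R).
  apply: eq_eseriesr => L _; have [N hN] := strips_separate L fx dx.
  set c := (RHS).
  have cc : cell_count B L n (range x) @[n --> \oo] --> c.
    apply: cvg_near_cst; exists N => // n Nn /=.
    by apply: cell_count_range; exact: hN.
  rewrite is_cvg_limn_esupE; last by apply/cvg_ex; exists c.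
  exact/cvg_lim.
rewrite nneseries_interchange => [|L i]; last first.
  by apply: nneseries_ge0 => m _ _; rewrite lee_fin.
apply: eq_eseriesr => i _.
rewrite nneseries_interchange => [|L m]; last by rewrite lee_fin.
apply: eq_eseriesr => m _.
rewrite -[LHS](_ : \sum_(0 <= L <oo)
    (\1_[set L | seqD slab L (x i) /\ edges x B (i, m)] L)%:E = _); last first.
  by apply: eq_eseriesr => L _; rewrite !indic_asbool.
rewrite nneseries_at_most_one; last first.
  move=> L L' [sL _] [sL' _].
  have tS : trivIset setT (seqD slab).
    by apply: trivIset_seqD => k l kl; apply/subsetPset; exact: slab_nd.
  by apply: (tS L L') => //; exists (x i).
rewrite indic_asbool; congr ((_ : bool)%:R%:E); apply/asboolP/asboolP.
  by move=> [L [_ ei]].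
move=> ei; have [L _ sL] : (\bigcup_L seqD slab L) (x i).
  by rewrite eq_bigcup_seqD slab_cover.
by exists L.
Qed.

End configurations.

(** * Translation invariance *)

Section shifted_leaves.
Context {R : realType} (y : R).
Local Notation mR := (measurableTypeR R).
Local Notation C := (compact_set R).
Local Notation X := ((mR * mR) * C)%type.
Local Open Scope ereal_scope.
Local Notation slab := (@slab R _ C).
Implicit Types (x : nat -> X) (u : X).

Definition shift_leaf u : X := (((u.1.1 : R) + y, u.1.2)%R, u.2).

Lemma measurable_shift_leaf : measurable_fun setT (shift_leaf : X -> X).
Proof.
apply: measurable_fun_pair; last exact: measurable_snd.
apply: measurable_fun_pair; last exact: (measurableT_comp measurable_snd measurable_fst).
apply: (measurableT_comp (measurable_translation y)).
exact: (measurableT_comp measurable_fst measurable_fst).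
Qed.

Lemma measurable_preimage_shift_leaf (D : set X) :
  measurable D -> measurable (shift_leaf @^-1` D).
Proof.
by move=> mD; rewrite -[X in measurable X]setTI; exact: measurable_shift_leaf.
Qed.

Lemma edge_pt_shift m u : edge_pt m (shift_leaf u) = (edge_pt m u + y)%R.
Proof. by rewrite /edge_pt/= addrA. Qed.

Lemma edges_shift x (B : set mR) :
  edges (shift_leaf \o x) B = edges x [set v : mR | B ((v : R) + y)%R].
Proof.
have cov m i j : covers m (shift_leaf (x i), shift_leaf (x j)) <-> covers m (x i, x j).
  rewrite /covers/= edge_pt_shift.
  by rewrite (_ : edge_pt m (x i) + y - ((x j).1.1 + y) = edge_pt m (x i) - (x j).1.1)%R//; ring.
apply/seteqP; split => [[i m] [[/= t0 nm By] vis]|[i m] [[/= t0 nm By] vis]]; split => //=.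
- by split => //=; rewrite -edge_pt_shift.
- by move=> j /cov; exact: vis.
- by split => //=; rewrite edge_pt_shift.
- by move=> j /cov; exact: vis.
Qed.

Lemma edge_measure_shift x (B : set mR) :
  edge_measure (shift_leaf \o x) B = edge_measure x [set v : mR | B ((v : R) + y)%R].
Proof. by rewrite !edge_measure_counting edges_shift. Qed.

Lemma shift_edge_config x (B : set mR) : finite_edges x ->
  Defs.shift y (edge_config x) B = edge_measure (shift_leaf \o x) B.
Proof.
move=> fx; transitivity (edge_config x [set v : mR | B ((v : R) + y)%R]); first by [].
by rewrite edge_configE asboolT// edge_measure_shift.
Qed.

Lemma slab_finite_shift x : slab_finite x -> slab_finite (shift_leaf \o x).
Proof.
move=> fx L; apply: sub_finite_set (fx (L + (Num.truncn `|y|).+1)%N).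
move=> i [[]]; rewrite /slab/box/= !in_itv/= => /andP[l1 l2] /andP[l3 l4] _.
have yb : (`|y| <= (Num.truncn `|y|).+1%:R)%R by rewrite ltW// truncnS_gt.
have L0 : (0 <= (Num.truncn `|y|).+1%:R :> R)%R by [].
have /andP[y1 y2] : (- `|y| <= y <= `|y|)%R by rewrite ler_norm andbT lerNl -normrN ler_norm.
by split => //; split; rewrite natrD; apply/andP; split; lra.
Qed.

Lemma distinct_places_shift x : distinct_places x -> distinct_places (shift_leaf \o x).
Proof. by move=> dx i j ij /addIr; exact: dx. Qed.

Lemma leaf_intensity_shift (Q : probability C R) (D : set X) : measurable D ->
  leaf_intensity Q (shift_leaf @^-1` D) = leaf_intensity Q D.
Proof.
move=> mD; pose m := image_measure (leaf_intensity Q) measurable_shift_leaf.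
have mtr : measurable_fun setT (fun p : mR * mR => ((p.1 : R) + y, p.2)%R : mR * mR).
  apply: measurable_fun_pair; last exact: measurable_snd.
  exact: (measurableT_comp (measurable_translation y) measurable_fst).
pose ma := image_measure (@area R) mtr.
have area_shift (A : set (mR * mR)) : measurable A -> ma A = area A.
  move=> mA; apply/esym; apply: (@product_measure_unique _ _ _ _ _
    (@lebesgue_measure R) (@lebesgue_measure R) ma) => // A1 A2 mA1 mA2.
  have mA1y := measurable_translated y mA1.
  transitivity (@lebesgue_measure R [set u : mR | A1 ((u : R) + y)%R] *
    @lebesgue_measure R A2); first exact: area_setX.
  by congr (_ * _); exact: lebesgue_translation.
apply/esym; apply: (@product_measure_unique _ _ _ _ _ (@area R) Q m) => // A E mA mE.
have mAy : measurable ((fun p : mR * mR => ((p.1 : R) + y, p.2)%R : mR * mR) @^-1` A).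
  by have := mtr measurableT A mA; rewrite setTI.
transitivity (ma A * Q E); last by congr (_ * _); exact: area_shift.
exact: (leaf_intensity_setX Q mAy mE).
Qed.

End shifted_leaves.

Section measurable_configs.
Context d (Omega : measurableType d) (R : realType).
Local Notation mR := (measurableTypeR R).

Lemma measurable_point_config (f : Omega -> point_config R) :
  (forall B : set mR, measurable B -> measurable_fun setT (fun w => f w B)) ->
  measurable_fun setT f.
Proof.
move=> mf.
apply: (measurability _ (erefl (@point_config_sigma R))) => _ [_ [B mB [U mU <-]] <-].
by have := mf B mB measurableT U mU; rewrite !setTI.
Qed.

Lemma measurable_evaluation (B : set mR) : measurable B ->
  measurable_fun setT (fun mu : point_config R => mu B).
Proof.
move=> mB _ U mU; rewrite setTI; apply: sub_sigma_algebra.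
by exists B => //; exists U => //; rewrite setTI.
Qed.

End measurable_configs.

Section represented_events.
Context {R : realType}.
Local Notation mR := (measurableTypeR R).

(** An event on point configurations can be expressed through the set of leaves
    whenever the counts of the configuration can. *)
Lemma config_represented (M : set (point_config R)) : measurable M ->
  exists2 G : set (@conf R), measurable G & forall (mu : point_config R) xi,
    (forall B : set mR, measurable B -> mu B = conf_count B xi) -> M mu <-> G xi.
Proof.
pose represented (A : set (point_config R)) := exists2 G : set (@conf R), measurable G &
  forall (mu : point_config R) xi,
    (forall B : set mR, measurable B -> mu B = conf_count B xi) -> A mu <-> G xi.
apply: (@smallest_sub _ (sigma_algebra setT) _ represented).
  split.
  - by exists set0.
  - move=> A [G mG GA]; exists (~` G); first exact: measurableC.
    by move=> mu xi h; rewrite setTD; split; apply: contra_not => /(GA mu xi h).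
  - move=> A hA.
    have {}hA n : exists G : set (@conf R), measurable G /\ forall (mu : point_config R) xi,
        (forall B : set mR, measurable B -> mu B = conf_count B xi) -> A n mu <-> G xi.
      by have [G mG GA] := hA n; exists G.
    have [G hG] := choice hA.
    exists (\bigcup_n G n); first by apply: bigcupT_measurable => n; case: (hG n).
    move=> mu xi h; split => -[n _ hn]; exists n => //; have [_ hn'] := hG n; exact/(hn' mu xi h).
move=> _ [B mB [U mU <-]]; exists (conf_count B @^-1` U).
  by rewrite -[X in measurable X]setTI; exact: measurable_conf_count.
by move=> mu xi h; rewrite setTI /= h.
Qed.

End represented_events.

Section leaf_configurations.
Context d (Omega : measurableType d) (R : realType) (P : probability Omega R).
Local Notation mR := (measurableTypeR R).
Local Notation plane := (mR * mR)%type.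
Local Notation C := (compact_set R).
Local Notation X := (plane * C)%type.
Variables (Q : probability C R) (z : nat -> Omega -> plane) (S : nat -> Omega -> C).
Hypothesis hz : unit_poisson_process P z.
Hypothesis mS : forall i, measurable_fun setT (S i).
Hypothesis S_law : forall i A, measurable A -> pushforward P (S i) A = Q A.
Hypothesis S_indep : mutually_independent P S.
Hypothesis zS_indep : independent_families P z S.
Local Open Scope ereal_scope.
Local Notation leaf := (leaf z S).

Definition leaves y w : @conf R := range (shift_leaf y \o leaf^~ w).

Lemma leaves_void y D : leaves y @^-1` void_on D = avoid z S (shift_leaf y @^-1` D).
Proof.
apply/seteqP; split => w.
  rewrite /void_on/= -subset0 => h j Dj; apply: (h (shift_leaf y (leaf j w))).
  by split => //; exists j.
by move=> h; rewrite /void_on/= -subset0 => _ [[j _ <-]]; exact: h.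
Qed.

Lemma measurable_leaves y : measurable_fun setT (leaves y).
Proof.
apply: (measurability _ (erefl (@measurable _ (@conf R)))).
move=> _ [_ [D mD [_ ->]] <-]; rewrite setTI leaves_void.
by apply: (measurable_avoid hz mS); exact: measurable_preimage_shift_leaf.
Qed.

(** The voids of bounded sets are stable under intersection, so their
    probabilities determine the law of the set of leaves; these probabilities
    depend only on the intensity, which is translation invariant. *)
Lemma leaves_law y (G : set (@conf R)) : measurable G ->
  P (leaves y @^-1` G) = P (leaves 0 @^-1` G).
Proof.
move=> mG.
pose m u := image_measure P (measurable_leaves u).
apply: (@measure_unique _ R (@conf R) (@slab_voids R) (fun=> setT) erefl _ _ _ (m y) (m 0%R) _ _ G mG) => //.
- move=> _ _ [D mD [[n Dn] ->]] [D' mD' [[n' Dn'] ->]].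
  exists (D `|` D'); first exact: measurableU.
  split.
    exists (maxn n n') => u [/Dn|/Dn']; apply: slab_nd; [exact: leq_maxl|exact: leq_maxr].
  apply/seteqP; split => xi; rewrite /void_on/= setIUr.
    by move=> [-> ->]; rewrite setU0.
  by move=> h; split; rewrite -subset0 -h => u hu; [left|right].
- move=> _; exists set0 => //; split; first by exists 0%N.
  by apply/seteqP; split => // xi _; rewrite /void_on/= setI0.
- by rewrite bigcup_const.
- move=> _ [D mD [[n Dn] ->]].
  have D1 : leaf_intensity Q D < +oo by exact: sub_slab_fin Dn.
  have h u : m u (void_on D) = (expR (- fine (leaf_intensity Q D)))%:E.
    transitivity (P (avoid z S (shift_leaf u @^-1` D))).
      by congr (P _); exact: leaves_void.
    have mDu := measurable_preimage_shift_leaf u mD.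
    rewrite (avoid_prob hz mS S_law S_indep zS_indep mDu) leaf_intensity_shift//.
  by rewrite !h.
- move=> _; change (P setT < +oo); rewrite probability_setT; exact: ltry.
Qed.

Lemma ae_distinct_places : {ae P, forall w, distinct_places (leaf^~ w)}.
Proof.
apply: ae_foralln => i; apply: ae_foralln => j.
have [->|/eqP ij] := eqVneq i j; first exact: filterE.
have mplace k : measurable_fun setT (fun w => (z k w).1 : R).
  exact: (measurableT_comp measurable_fst (upp_measurable hz k)).
exists [set w | ((z i w).1 : R) - (z j w).1 = 0]%R; split.
- rewrite (_ : [set _ | _] = setT `&` (fun w => ((z i w).1 : R) - (z j w).1)%R @^-1` [set 0%R]).
    by apply: measurable_funB => //; exact: measurable_set1.
  by rewrite setTI.
- exact: (poisson_diff_null hz).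
- by move=> w /= /not_implyP[_ /contrapT]; rewrite /leaf/= => ->; rewrite subrr.
Qed.

Lemma ae_slab_finite : {ae P, forall w, slab_finite (leaf^~ w)}.
Proof.
apply: ae_foralln => L.
have mslab : measurable (@slab R _ C L) by exact: measurable_slab.
have mA i : measurable (leaf i @^-1` @slab R _ C L).
  exact: (measurable_preimage_leaf hz mS i mslab).
pose f w : \bar R := \sum_(0 <= i <oo) (\1_(leaf i @^-1` @slab R _ C L) w)%:E.
have mind i : measurable_fun setT (fun w => (\1_(leaf i @^-1` @slab R _ C L) w)%:E : \bar R).
  by apply/measurable_EFinP; exact: measurable_indic.
have f0 w : 0 <= f w by apply: nneseries_ge0 => i _ _; rewrite lee_fin.
have : P.-integrable setT f.
  apply/integrableP; split.
    by apply: measurable_nneseries => // i w; rewrite lee_fin.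
  under eq_integral do rewrite gee0_abs//.
  rewrite integral_nneseries//.
  rewrite (_ : \sum_(0 <= i <oo) _ = leaf_intensity Q (slab L)); first exact: slab_fin.
  rewrite -(campbell hz mS S_law zS_indep mslab).
  by apply: eq_eseriesr => i _; have := integral_indic P measurableT (mA i); rewrite setIT.
move=> /(integrable_ae measurableT); apply: filterS => w /(_ Logic.I) fin.
have : f w = counting [set i | slab L (leaf i w)].
  rewrite counting_esum /f nneseries_esumT => [|i]; last by rewrite lee_fin.
  rewrite [RHS]esum_mkcond; apply: eq_esum => i _.
  by rewrite indic_asbool; case: asboolP => h; [rewrite mem_set|rewrite memNset].
by move=> e; move: fin; rewrite e /counting; case: asboolP.
Qed.

Hypothesis ae_fin : {ae P, forall w, finite_edges (leaf^~ w)}.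
Hypothesis mN : measurable_fun setT (fun w => edge_config (leaf^~ w)).

Lemma measurable_shift_config y :
  measurable_fun setT (fun w => Defs.shift y (edge_config (leaf^~ w))).
Proof.
apply: measurable_point_config => B mB.
exact: (measurableT_comp (measurable_evaluation (measurable_translated y mB)) mN).
Qed.

(** An event for the visible edges is almost surely the same event for the leaves,
    and the translated edges are the edges of the translated leaves. *)
Lemma edge_config_stationary : shift_invariant P (fun w => edge_config (leaf^~ w)).
Proof.
move=> y M mM; have [G mG GM] := config_represented mM.
have law u (f : Omega -> point_config R) : measurable_fun setT f ->
    (forall w B, finite_edges (leaf^~ w) ->
      f w B = edge_measure (shift_leaf u \o leaf^~ w) B) ->
    P (f @^-1` M) = P (leaves u @^-1` G).
  move=> mf fE.
  have m1 : measurable (f @^-1` M) by rewrite -[X in measurable X]setTI; exact: mf.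
  have m2 : measurable (leaves u @^-1` G).
    by rewrite -[X in measurable X]setTI; exact: measurable_leaves.
  rewrite -[f @^-1` M]setIT -[leaves u @^-1` G]setIT -!integral_indic//.
  apply: ae_eq_integral => //; try by apply/measurable_EFinP; exact: measurable_indic.
  apply: filterS3 ae_slab_finite ae_distinct_places ae_fin => w fx dx fe _.
  rewrite !indic_asbool; congr ((_ : bool)%:R%:E).
  suff h : M (f w) <-> G (leaves u w) by apply/asboolP/asboolP => /h.
  apply: GM => B mB; rewrite fE// conf_count_range//.
  - exact: slab_finite_shift.
  - exact: distinct_places_shift.
rewrite /pushforward (law y _ (measurable_shift_config y)); last first.
  by move=> w B; exact: shift_edge_config.
rewrite leaves_law//; apply/esym; apply: law => // w B fe.
rewrite edge_measure_shift edge_configE asboolT//.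
by congr (edge_measure _ _); apply/seteqP; split => v /=; rewrite addr0.
Qed.

End leaf_configurations.

Local Open Scope ereal_scope.

Theorem proposition2p1 (R : realType) (d : measure_display)
  (Omega : measurableType d) (P : probability Omega R)
  (Q : probability (compact_set R) R)
  (Q_interior : 0 < Q [set K : compact_set R | (K : set R)° !=set0])
  (z : nat -> Omega -> measurableTypeR R * measurableTypeR R)
  (S : nat -> Omega -> compact_set R)
  (z_poisson : unit_poisson_process P z)
  (S_measurable : forall i, measurable_fun setT (S i))
  (S_law : forall i A, measurable A -> pushforward P (S i) A = Q A)
  (S_independent : mutually_independent P S)
  (z_S_independent : independent_families P z S)
  (radius_integrable : mean_radius Q < +oo)
  (boundary_integrable : mean_boundary_count Q < +oo) :
  stationary_point_process P (fun w => dlm_eta (z^~ w) (S^~ w))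
    ((mean_length Q)^-1 * mean_boundary_count Q).
Proof.
pose N w := edge_config (fun i => leaf z S i w).
have ae_fin : {ae P, forall w, finite_edges (fun i => leaf z S i w)}.
  exact: (ae_finite_edges Q_interior).
have mN : measurable_fun setT N.
  exact: (measurable_edge_config z_poisson S_measurable).
exists N; split.
- split => //.
  have aeE := ae_edge_measure_dlm z_poisson S_measurable S_law z_S_independent boundary_integrable.
  by apply: filterS2 ae_fin aeE => w fe E B mB; rewrite /N edge_configE asboolT.
- exact: (edge_config_stationary z_poisson S_measurable S_law).
- move=> B mB.
  rewrite -(edge_measure_mean Q_interior z_poisson S_measurable S_law S_independent
    z_S_independent radius_integrable boundary_integrable mB).
  apply: ae_eq_integral => //.
  + exact: (measurableT_comp (measurable_evaluation mB) mN).
  + exact: (measurable_edge_measure z_poisson S_measurable).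
  + by apply: filterS ae_fin => w fe _; rewrite /N edge_configE asboolT.
Qed.
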